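(* Let $R$ be a semilocal principal ideal domain with fraction field $F\neq R$, and assume $2\in R^\times$. Let $A$ be an $R$-order, let $\{\sigma_i\}_{i\in I}$ be a family of $R$-involutions on $A$, and let $(P,\{f_i\}_{i\in I})$ be a system of sesquilinear forms over $(A,\{\sigma_i\}_{i\in I})$. Then $|\mathrm{gen}(P,\{f_i\})|$ is a finite power of $2$.
   Context: An $R$-order in an $F$-algebra $E$ is an $R$-subalgebra $A\subseteq E$ that is finitely generated as an $R$-module and contains an $F$-basis of $E$; equivalently (as $R$ is a PID), an $R$-algebra that is a finitely generated free $R$-module. An $R$-involution is an $R$-linear involution. For each involution $\sigma_i$ and each finitely generated projective right $A$-module $P$, let $P^{*_i}=\mathrm{Hom}_A(P,A)$ with right $A$-module structure $(\psi a)x=a^{\sigma_i}(\psi x)$; for a morphism $\phi:P\to P'$ let $\phi^{*_i}\psi=\psi\circ\phi$. A sesquilinear form over $(A,\sigma_i)$ on $P$ is $f\in\mathrm{Hom}_A(P,P^{*_i})$, equivalently the biadditive map $\tilde f(x,y)=(fx)y$, which satisfies $\tilde f(xa,yb)=a^{\sigma_i}\tilde f(x,y)b$. A system of sesquilinear forms over $(A,\{\sigma_i\}_{i\in I})$ is a pair $(P,\{f_i\}_{i\in I})$ with $P$ a finitely generated projective right $A$-module and $f_i$ a sesquilinear form on $P$ over $(A,\sigma_i)$ for each $i\in I$ (no unimodularity is assumed). An isometry $(P,\{f_i\})\to(P',\{f'_i\})$ is an $A$-module isomorphism $\phi:P\to P'$ with $f_i=\phi^{*_i}f'_i\phi$ for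 all $i$. For a commutative $R$-algebra $T$, the scalar extension of $(P,\{f_i\})$ to $T$ is the system $(P\otimes_RT,\{(f_i)_T\})$ over $(A\otimes_RT,\{\sigma_i\otimes\mathrm{id}_T\})$ with $(\tilde f_i)_T(x\otimes k,x'\otimes k')=\tilde f_i(x,x')\otimes kk'$. For $\mathfrak{p}\in\mathrm{Spec}\,R$, $\hat R_{\mathfrak p}$ is the $\mathfrak p$-adic completion of $R_{\mathfrak p}$; in particular $\hat R_0=F$. $\mathrm{gen}(P,\{f_i\})$ is the collection of isometry classes of systems of sesquilinear forms $(P',\{f'_i\})$ over $(A,\{\sigma_i\})$ that become isometric to $(P,\{f_i\})$ after scalar extension to $\hat R_{\mathfrak p}$ for every $\mathfrak p\in\mathrm{Spec}\,R$ (including $\mathfrak p=0$). *)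

(* Defs.v *)
From HB Require Import structures.
From mathcomp Require Import all_boot all_order all_algebra.
From mathcomp Require Import boolp classical_sets functions cardinality.

Set Implicit Arguments.
Unset Strict Implicit.
Unset Printing Implicit Defensive.

Import GRing.Theory.
Local Open Scope ring_scope.
Local Open Scope quotient_scope.

(* [idealr R] only contains proper ideals; the unit ideal is generated by 1. *)
Definition is_PID (R : idomainType) : Prop :=
  forall J : idealr R, exists d : R,
    forall x, x \in (J : {pred R}) <-> exists q, x = q * d.

Definition maximal_ideal (R : comNzRingType) (J : idealr R) : Prop :=
  forall J' : idealr R, {subset (J : {pred R}) <= (J' : {pred R})} ->
    {subset (J' : {pred R}) <= (J : {pred R})}.

Definition semilocal (R : comNzRingType) : Prop :=
  exists (n : nat) (m : 'I_n -> idealr R),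
    forall J : idealr R, maximal_ideal J ->
      exists i, (J : {pred R}) =i (m i : {pred R}).

Section Localization.
Variables (R : idomainType) (p : prime_idealr R).
Local Notation "x %:F" := (@FracField.tofrac R x).

Definition loc_pred : {pred {fraction R}} :=
  fun x => `[< exists a s : R, s \notin (p : {pred R}) /\ x = a%:F / s%:F >].

Let p1 : 1 \notin (p : {pred R}). Proof. by rewrite idealr1. Qed.

Let notinM s t : s \notin (p : {pred R}) -> t \notin (p : {pred R}) ->
  s * t \notin (p : {pred R}).
Proof. by move=> ps pt; rewrite prime_idealrM negb_or ps pt. Qed.

Let notin0 s : s \notin (p : {pred R}) -> s%:F != 0.
Proof.
by move=> ps; rewrite tofrac_eq0; apply: contra ps => /eqP->; exact: idealr0.
Qed.

Lemma loc_subring_closed : subring_closed loc_pred.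
Proof.
split.
- by apply/asboolP; exists 1, 1; rewrite tofrac1 divr1.
- move=> x y /asboolP[a [s [ps ->]]] /asboolP[b [t [pt ->]]].
  apply/asboolP; exists (a * t - b * s), (s * t); split; first exact: notinM.
  rewrite -mulNr addf_div ?notin0//.
  by rewrite tofracB !tofracM mulNr.
- move=> x y /asboolP[a [s [ps ->]]] /asboolP[b [t [pt ->]]].
  apply/asboolP; exists (a * b), (s * t); split; first exact: notinM.
  by rewrite mulf_div !tofracM.
Qed.
HB.instance Definition _ :=
  GRing.isSubringClosed.Build {fraction R} loc_pred loc_subring_closed.

Definition localization : Type := {x : {fraction R} | loc_pred x}.
HB.instance Definition _ := [isSub of localization for @sval _ _].
HB.instance Definition _ := [Choice of localization by <:].
HB.instance Definition _ :=
  [SubChoice_isSubComNzRing of localization by <:].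

Definition loc_ideal : {pred localization} := fun x =>
  `[< exists a s : R, [/\ a \in (p : {pred R}), s \notin (p : {pred R})
                        & val x = a%:F / s%:F] >].

Lemma loc_ideal_closed : idealr_closed loc_ideal.
Proof.
split.
- apply/asboolP; exists 0, 1; rewrite p1 idealr0; split=> //.
  by rewrite tofrac0 mul0r.
- apply/asboolP => -[a [s [pa ps]]] /= /(congr1 ( *%R^~ s%:F)).
  rewrite mul1r divfK ?notin0// => /eqP; rewrite tofrac_eq => /eqP eqs.
  by rewrite eqs pa in ps.
- move=> c u v /asboolP[a [s [pa ps eu]]] /asboolP[b [t [pb pt ev]]].
  have /asboolP[d [r [pr ec]]] := valP c.
  apply/asboolP; exists (d * a * t + b * (r * s)), (r * s * t).
  split; [|exact/notinM/pt/notinM|].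
    by rewrite rpredD// ?[_ * t]mulrC ?[b * _]mulrC ?idealMr.
  rewrite rmorphD rmorphM/= eu ev [val c]ec mulf_div addf_div ?notin0//.
    by rewrite tofracD !tofracM.
  by rewrite mulf_neq0 ?notin0.
Qed.
HB.instance Definition _ := isIdealr.Build localization loc_ideal loc_ideal_closed.

Lemma to_loc_subproof (r : R) : loc_pred r%:F.
Proof. by apply/asboolP; exists r, 1; rewrite tofrac1 divr1. Qed.

Definition to_loc (r : R) : localization := exist _ r%:F (to_loc_subproof r).

Lemma to_loc_zmod_morphism : zmod_morphism to_loc.
Proof. by move=> x y; apply: val_inj; rewrite /= rmorphB. Qed.
Lemma to_loc_monoid_morphism : monoid_morphism to_loc.
Proof.
by split=> [|x y]; apply: val_inj; rewrite /= ?rmorph1 ?rmorphM.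
Qed.
HB.instance Definition _ :=
  GRing.isZmodMorphism.Build R localization to_loc to_loc_zmod_morphism.
HB.instance Definition _ :=
  GRing.isMonoidMorphism.Build R localization to_loc to_loc_monoid_morphism.

End Localization.

Section Completion.
Variables (S : comNzRingType) (J : idealr S).

Fixpoint ideal_exp (n : nat) : set S :=
  if n is m.+1 then
    [set x | exists2 s : seq (S * S),
       (forall u, u \in s -> u.1 \in (J : {pred S}) /\ ideal_exp m u.2)
       & x = \sum_(u <- s) u.1 * u.2]
  else setT.

Lemma ideal_exp0 n : ideal_exp n 0.
Proof. by case: n => [//|n]; exists [::] => //; rewrite big_nil. Qed.

Lemma ideal_expMl n (a x : S) : ideal_exp n x -> ideal_exp n (a * x).
Proof.
case: n => [//|n] [s sJ ->].
exists [seq (a * u.1, u.2) | u <- s].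
  by move=> _ /mapP[u us ->] /=; have [uJ un] := sJ _ us; rewrite idealMr.
by rewrite big_map mulr_sumr; apply: eq_bigr => u _; rewrite mulrA.
Qed.

Lemma ideal_expD n (x y : S) :
  ideal_exp n x -> ideal_exp n y -> ideal_exp n (x + y).
Proof.
case: n => [//|n] [s sJ ->] [t tJ ->].
exists (s ++ t); last by rewrite big_cat.
by move=> u; rewrite mem_cat => /orP[/sJ|/tJ].
Qed.

Lemma ideal_expB n (x y : S) :
  ideal_exp n x -> ideal_exp n y -> ideal_exp n (x - y).
Proof. by move=> xn yn; rewrite -mulN1r; apply/ideal_expD/ideal_expMl. Qed.

(* The inverse limit of the S / J^n is presented as the ring of coherent
   sequences of S modulo the sequences whose n-th term lies in J^n. *)
Definition coherent : {pred nat -> S} := fun x =>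
  `[< forall n m, (n <= m)%N -> ideal_exp n (x m - x n) >].

Lemma coherent_subring_closed : subring_closed coherent.
Proof.
split.
- by apply/asboolP => n m _; rewrite subrr; exact: ideal_exp0.
- move=> x y /asboolP cx /asboolP cy; apply/asboolP => n m nm.
  rewrite (_ : (x - y) m - (x - y) n = (x m - x n) - (y m - y n)); last first.
    change ((x m - y m) - (x n - y n) = (x m - x n) - (y m - y n)).
    by rewrite !opprD !opprK addrACA.
  by apply: ideal_expB; [exact: cx|exact: cy].
- move=> x y /asboolP cx /asboolP cy; apply/asboolP => n m nm.
  rewrite (_ : (x * y) m - (x * y) n =
    x m * (y m - y n) + y n * (x m - x n)); last first.
    change (x m * y m - x n * y n = x m * (y m - y n) + y n * (x m - x n)).
    by rewrite mulrBr mulrBr [y n * x m]mulrC [y n * x n]mulrC addrA subrK.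
  by apply/ideal_expD; apply/ideal_expMl; [exact: cy|exact: cx].
Qed.
HB.instance Definition _ :=
  GRing.isSubringClosed.Build (nat -> S) coherent coherent_subring_closed.

Definition coherent_seq : Type := {x : nat -> S | coherent x}.
HB.instance Definition _ := [isSub of coherent_seq for @sval _ _].
HB.instance Definition _ := [Choice of coherent_seq by <:].
HB.instance Definition _ :=
  [SubChoice_isSubComNzRing of coherent_seq by <:].

Definition null_seq : {pred coherent_seq} := fun x =>
  `[< forall n, ideal_exp n (val x n) >].

Lemma null_seq_closed : idealr_closed null_seq.
Proof.
split.
- by apply/asboolP => n; exact: ideal_exp0.
- apply/asboolP => /(_ 1%N) /= [s sJ s1].
  have : (1 : S) \in (J : {pred S}).
    rewrite [1]s1 big_seq rpred_sum// => u /sJ[uJ _].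
    by rewrite mulrC idealMr.
  by rewrite idealr1.
- move=> a u v /asboolP nu /asboolP nv; apply/asboolP => n.
  by apply: ideal_expD => //; exact: ideal_expMl.
Qed.
HB.instance Definition _ := isIdealr.Build coherent_seq null_seq null_seq_closed.

Definition completion : Type := {ideal_quot null_seq}.
HB.instance Definition _ := GRing.ComNzRing.on completion.

Lemma to_compl_subproof (x : S) : coherent (fun=> x).
Proof. by apply/asboolP => n m _; rewrite subrr; exact: ideal_exp0. Qed.

Definition to_compl (x : S) : completion :=
  \pi_({ideal_quot null_seq}) (exist _ (fun=> x) (to_compl_subproof x)).

Lemma to_compl_zmod_morphism : zmod_morphism to_compl.
Proof.
move=> x y; rewrite /to_compl -rmorphB; congr (\pi _).
by apply: val_inj.
Qed.
Lemma to_compl_monoid_morphism : monoid_morphism to_compl.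
Proof.
split=> [|x y]; rewrite /to_compl.
  by rewrite -(rmorph1 (\pi_({ideal_quot null_seq}))); congr (\pi _); apply: val_inj.
by rewrite -rmorphM; congr (\pi _); apply: val_inj.
Qed.
HB.instance Definition _ :=
  GRing.isZmodMorphism.Build S completion to_compl to_compl_zmod_morphism.
HB.instance Definition _ :=
  GRing.isMonoidMorphism.Build S completion to_compl to_compl_monoid_morphism.

End Completion.

Section Tensor.
Variables (R : comNzRingType) (T : comPzRingType) (iota : {rmorphism R -> T}).

Section TensorModule.
Variable M : lmodType R.

Definition balanced (Z : zmodType) (b : M -> T -> Z) : Prop :=
  [/\ forall x y k, b (x + y) k = b x k + b y k,
      forall x k l, b x (k + l) = b x k + b x l
    & forall r x k, b (r *: x) k = b x (iota r * k)].

(* A sequence of pairs (x, k) stands for the formal sum of the x ⊗ k; two of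
   them are identified when no R-balanced biadditive map separates them (see
   [tens_lift_pure] and [tens_ext] for the universal property). *)
Definition tens_eq (s t : seq (M * T)) : bool :=
  `[< forall (Z : zmodType) (b : M -> T -> Z), balanced b ->
        \sum_(u <- s) b u.1 u.2 = \sum_(u <- t) b u.1 u.2 >].

Lemma tens_eq_is_equiv : equiv_class_of tens_eq.
Proof.
split=> [s|s t|s t u].
- by apply/asboolP.
- by apply/asboolP/asboolP => st Z b bb; rewrite st.
- by move=> /asboolP st /asboolP tu; apply/asboolP => Z b bb; rewrite st ?tu.
Qed.
Canonical tens_eq_equiv := EquivRelPack tens_eq_is_equiv.
Canonical tens_eq_encModRel := defaultEncModRel tens_eq.

Definition tens : Type := {eq_quot tens_eq}.
HB.instance Definition _ := Choice.on tens.
HB.instance Definition _ := EqQuotient.on tens.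

Definition tens_sum (s : seq (M * T)) : tens := \pi_tens s.
Definition pure (x : M) (k : T) : tens := tens_sum [:: (x, k)].

Lemma tens_sumP (s t : seq (M * T)) :
  tens_sum s = tens_sum t <->
  forall (Z : zmodType) (b : M -> T -> Z), balanced b ->
        \sum_(u <- s) b u.1 u.2 = \sum_(u <- t) b u.1 u.2.
Proof.
split=> [/eqP|st]; first by rewrite /tens_sum piE => /asboolP.
by apply/eqP; rewrite /tens_sum piE; apply/asboolP.
Qed.

Lemma tens_sum_surj (z : tens) : exists s, z = tens_sum s.
Proof. by exists (repr z); rewrite /tens_sum reprK. Qed.

Lemma balancedNl (Z : zmodType) (b : M -> T -> Z) : balanced b ->
  forall x k, b (- x) k = - b x k.
Proof.
move=> [bD _ _] x k; apply/eqP; rewrite -addr_eq0 -bD addNr.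
by apply/eqP/(addrI (b 0 k)); rewrite -bD !addr0.
Qed.

Lemma balanced_sum (Z : zmodType) (b : M -> T -> Z) : balanced b ->
  forall s, \sum_(u <- repr (tens_sum s)) b u.1 u.2 = \sum_(u <- s) b u.1 u.2.
Proof.
by move=> bb s; move: Z b bb; apply/tens_sumP; rewrite {1}/tens_sum reprK.
Qed.

Let oppl (s : seq (M * T)) := [seq (- u.1, u.2) | u <- s].
Definition tens_zero : tens := tens_sum [::].
Definition tens_opp (z : tens) : tens := tens_sum (oppl (repr z)).
Definition tens_add (z w : tens) : tens := tens_sum (repr z ++ repr w).

Let tens_oppE s : tens_opp (tens_sum s) = tens_sum (oppl s).
Proof.
apply/tens_sumP => Z b bb; rewrite !big_map /=.
under eq_bigr do rewrite balancedNl//.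
under [RHS]eq_bigr do rewrite balancedNl//.
by rewrite !sumrN balanced_sum.
Qed.

Let tens_addE s t : tens_add (tens_sum s) (tens_sum t) = tens_sum (s ++ t).
Proof. by apply/tens_sumP => Z b bb; rewrite !big_cat /= !balanced_sum. Qed.

Let tens_addA : associative tens_add.
Proof.
move=> x y z; have [s ->] := tens_sum_surj x; have [t ->] := tens_sum_surj y.
by have [u ->] := tens_sum_surj z; rewrite !tens_addE catA.
Qed.
Let tens_addC : commutative tens_add.
Proof.
move=> x y; have [s ->] := tens_sum_surj x; have [t ->] := tens_sum_surj y.
by rewrite !tens_addE; apply/tens_sumP => Z b bb; rewrite !big_cat/= addrC.
Qed.
Let tens_add0 : left_id tens_zero tens_add.
Proof. by move=> x; have [s ->] := tens_sum_surj x; rewrite tens_addE. Qed.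
Let tens_addN : left_inverse tens_zero tens_opp tens_add.
Proof.
move=> x; have [s ->] := tens_sum_surj x; rewrite tens_oppE tens_addE.
apply/tens_sumP => Z b bb; rewrite big_cat big_map big_nil /=.
by under eq_bigr do rewrite balancedNl//; rewrite sumrN addNr.
Qed.
HB.instance Definition _ :=
  GRing.isZmodule.Build tens tens_addA tens_addC tens_add0 tens_addN.

Lemma tens_sum_cat s t : tens_sum (s ++ t) = tens_sum s + tens_sum t.
Proof. by rewrite -tens_addE. Qed.

Lemma tens_sumE s : tens_sum s = \sum_(u <- s) pure u.1 u.2.
Proof.
elim: s => [|[x k] s IH]; first by rewrite big_nil.
by rewrite big_cons -cat1s tens_sum_cat IH.
Qed.

Lemma tensE (z : tens) : exists s, z = \sum_(u <- s) pure u.1 u.2.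
Proof. by have [s ->] := tens_sum_surj z; exists s; exact: tens_sumE. Qed.

Lemma pure_balanced : balanced pure.
Proof.
split=> *; rewrite -?tens_sum_cat; apply/tens_sumP => Z b [bDl bDr bZ];
  by rewrite !big_cons !big_nil /= !addr0 ?bDl ?bDr ?bZ.
Qed.

Lemma pureDl x y k : pure (x + y) k = pure x k + pure y k.
Proof. by case: pure_balanced. Qed.
Lemma pureDr x k l : pure x (k + l) = pure x k + pure x l.
Proof. by case: pure_balanced. Qed.
Lemma pureZ r x k : pure (r *: x) k = pure x (iota r * k).
Proof. by case: pure_balanced. Qed.

Definition tens_lift (Z : zmodType) (b : M -> T -> Z) (z : tens) : Z :=
  \sum_(u <- repr z) b u.1 u.2.

Section TensorLift.
Variables (Z : zmodType) (b : M -> T -> Z).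
Hypothesis bb : balanced b.

Lemma tens_lift_sum s : tens_lift b (tens_sum s) = \sum_(u <- s) b u.1 u.2.
Proof. exact: balanced_sum. Qed.

Lemma tens_lift_pure x k : tens_lift b (pure x k) = b x k.
Proof. by rewrite tens_lift_sum big_seq1. Qed.

Lemma tens_liftD z w : tens_lift b (z + w) = tens_lift b z + tens_lift b w.
Proof.
have [s ->] := tens_sum_surj z; have [t ->] := tens_sum_surj w.
by rewrite -tens_sum_cat !tens_lift_sum big_cat.
Qed.

End TensorLift.

Lemma additive_sum (U V : zmodType) (g : U -> V) :
  {morph g : z w / z + w} ->
  forall (I : Type) (s : seq I) F, g (\sum_(i <- s) F i) = \sum_(i <- s) g (F i).
Proof.
move=> gD I s F; apply: (big_morph g gD).
by apply/(addrI (g 0)); rewrite -gD !addr0.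
Qed.

Lemma tens_ext (Z : zmodType) (g h : tens -> Z) :
  {morph g : z w / z + w} -> {morph h : z w / z + w} ->
  (forall x k, g (pure x k) = h (pure x k)) -> g =1 h.
Proof.
move=> gD hD gh z; have [s ->] := tensE z.
by rewrite (additive_sum gD) (additive_sum hD); apply: eq_bigr => u _.
Qed.

End TensorModule.

Section TensorMap.
Variables M N L : lmodType R.

Definition tens_map (g : M -> L) : tens M -> tens L :=
  tens_lift (fun x k => pure (g x) k).

(* For bilinear mu, the pairing (x ⊗ k, y ⊗ l) |-> mu x y ⊗ kl; see
   [tens_map2_pure]. *)
Definition tens_map2 (mu : M -> N -> L) (z : tens M) (w : tens N) : tens L :=
  tens_lift (fun x k => tens_lift (fun y l => pure (mu x y) (k * l)) w) z.

Definition bilinear_map (mu : M -> N -> L) : Prop :=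
  [/\ forall x y z, mu (x + y) z = mu x z + mu y z,
      forall x y z, mu x (y + z) = mu x y + mu x z,
      forall r x y, mu (r *: x) y = r *: mu x y
    & forall r x y, mu x (r *: y) = r *: mu x y].

Section Linear.
Variable g : M -> L.
Hypotheses (gD : {morph g : x y / x + y}) (gZ : forall r x, g (r *: x) = r *: g x).

Let bal : balanced (fun x k => pure (g x) k).
Proof. by split=> *; rewrite ?gD ?gZ ?pureDl ?pureDr ?pureZ. Qed.

Lemma tens_map_pure x k : tens_map g (pure x k) = pure (g x) k.
Proof. exact: tens_lift_pure. Qed.
Lemma tens_mapD : {morph tens_map g : z w / z + w}.
Proof. exact: tens_liftD. Qed.
End Linear.

Section Bilinear.
Variable mu : M -> N -> L.
Hypothesis muP : bilinear_map mu.

Let bal2 x k : balanced (fun y l => pure (mu x y) (k * l)).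
Proof.
case: muP => _ muDr _ muZr; split=> *.
- by rewrite muDr pureDl.
- by rewrite mulrDr pureDr.
- by rewrite muZr pureZ mulrCA.
Qed.

Let bal1 w :
  balanced (fun x k => tens_lift (fun y l => pure (mu x y) (k * l)) w).
Proof.
case: muP => muDl _ muZl _; split=> *; rewrite /tens_lift -?big_split /=;
  apply: eq_bigr => u _.
- by rewrite muDl pureDl.
- by rewrite mulrDl pureDr.
- by rewrite muZl pureZ mulrA.
Qed.

Lemma tens_map2_pure x k y l :
  tens_map2 mu (pure x k) (pure y l) = pure (mu x y) (k * l).
Proof. by rewrite /tens_map2 tens_lift_pure// tens_lift_pure. Qed.

Lemma tens_map2Dl w : {morph (tens_map2 mu)^~ w : z z' / z + z'}.
Proof. exact: tens_liftD. Qed.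

Lemma tens_map2Dr z : {morph tens_map2 mu z : w w' / w + w'}.
Proof.
move=> w w'; rewrite /tens_map2 {1 3 5}/tens_lift -big_split /=.
by apply: eq_bigr => u _; exact: tens_liftD.
Qed.

End Bilinear.
End TensorMap.

Section TensorAlgebra.
Variable A : algType R.

Definition tens_alg : Type := tens A.
HB.instance Definition _ := GRing.Zmodule.on tens_alg.

Definition tens_one : tens_alg := pure 1 1.
Definition tens_mul (z w : tens_alg) : tens_alg :=
  tens_map2 (fun a b : A => a * b) z w.

Lemma mul_bilinear : bilinear_map (fun a b : A => a * b).
Proof.
split=> [x y z|x y z|r x y|r x y].
- exact: mulrDl.
- exact: mulrDr.
- by rewrite scalerAl.
- by rewrite scalerAr.
Qed.

Let tens_mul_pure (a b : A) k l :
  tens_mul (pure a k) (pure b l) = pure (a * b) (k * l).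
Proof. exact: (tens_map2_pure mul_bilinear). Qed.

Let tens_mulDl : left_distributive tens_mul +%R.
Proof. by move=> x y z; exact: (tens_map2Dl mul_bilinear). Qed.
Let tens_mulDr : right_distributive tens_mul +%R.
Proof. by move=> x y z; exact: (tens_map2Dr mul_bilinear). Qed.

Let tens_mulA : associative tens_mul.
Proof.
move=> x y z; move: x.
apply: (@tens_ext _ _ (fun x => tens_mul x (tens_mul y z))
                      (fun x => tens_mul (tens_mul x y) z)) => [x x'|x x'|a k].
- by rewrite tens_mulDl.
- by rewrite !tens_mulDl.
move: y.
apply: (@tens_ext _ _ (fun y => tens_mul (pure a k) (tens_mul y z))
          (fun y => tens_mul (tens_mul (pure a k) y) z)) => [y y'|y y'|b l].
- by rewrite tens_mulDl tens_mulDr.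
- by rewrite tens_mulDr tens_mulDl.
move: z.
apply: (@tens_ext _ _ (fun z => tens_mul (pure a k) (tens_mul (pure b l) z))
          (tens_mul (tens_mul (pure a k) (pure b l)))) => [z z'|z z'|c m].
- by rewrite !tens_mulDr.
- by rewrite tens_mulDr.
by rewrite !tens_mul_pure !mulrA.
Qed.
Let tens_mul1 : left_id tens_one tens_mul.
Proof.
apply: (@tens_ext _ _ (tens_mul tens_one) id) => [x y|//|a k].
  by rewrite tens_mulDr.
by rewrite tens_mul_pure !mul1r.
Qed.
Let tens_mulr1 : right_id tens_one tens_mul.
Proof.
apply: (@tens_ext _ _ (tens_mul^~ tens_one) id) => [x y|//|a k].
  by rewrite tens_mulDl.
by rewrite tens_mul_pure !mulr1.
Qed.
HB.instance Definition _ := GRing.Zmodule_isPzRing.Build tens_alg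
  tens_mulA tens_mul1 tens_mulr1 tens_mulDl tens_mulDr.

Lemma tens_alg_mul_pure (a b : A) k l :
  (pure a k : tens_alg) * (pure b l : tens_alg) = pure (a * b) (k * l).
Proof. exact: tens_mul_pure. Qed.

End TensorAlgebra.
End Tensor.

(* A right B-module is a left module over the converse ring B^c, and the
   right action x b is b *: x with b : B^c. *)
Notation "x '*r' b" := (GRing.scale (b : GRing.converse _) x)
  (at level 40, left associativity) : ring_scope.

Definition finitely_generated (B : pzRingType) (P : lmodType B) : Prop :=
  exists (n : nat) (g : 'I_n -> P),
    forall x, exists c : 'I_n -> B, x = \sum_(i < n) c i *: g i.

Definition projective (B : pzRingType) (P : lmodType B) : Prop :=
  forall (M N : lmodType B) (q : {linear M -> N}) (h : {linear P -> N}),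
    (forall y, exists x, q x = y) ->
    exists h' : {linear P -> M}, forall x, q (h' x) = h x.

(* The form f : P -> Hom_B(P, B) is given by its biadditive map. *)
Definition sesquilinear (B : pzRingType) (sigma : B -> B) (P : lmodType B^c)
    (f : P -> P -> B) : Prop :=
  [/\ forall x x' y, f (x + x') y = f x y + f x' y,
      forall x y y', f x (y + y') = f x y + f x y'
    & forall x y a b, f (x *r a) (y *r b) = sigma a * f x y * b].

Definition isometric_forms (B : pzRingType) (I : Type) (P P' : lmodType B^c)
    (f : I -> P -> P -> B) (f' : I -> P' -> P' -> B) : Prop :=
  exists2 phi : {linear P -> P'}, bijective phi
    & forall i x y, f i x y = f' i (phi x) (phi y).

Definition R_involution (R : nzRingType) (A : algType R) (sigma : A -> A) : Prop :=
  [/\ forall r a b, sigma (r *: a + b) = r *: sigma a + sigma b,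
      forall a b, sigma (a * b) = sigma b * sigma a
    & forall a, sigma (sigma a) = a].

(* For R a PID with fraction field F, being free of finite rank over R is the
   same as being an R-order in some F-algebra E (namely E = A ⊗ F). *)
Definition is_order (R : nzRingType) (A : algType R) : Prop :=
  exists (n : nat) (e : 'I_n -> A),
    forall a, exists! c : 'rV[R]_n, a = \sum_(i < n) c 0 i *: e i.

Section Systems.
Variables (R : comNzRingType) (A : algType R) (I : Type) (sigma : I -> A -> A).

Record system := System {
  sys_mod : lmodType A^c;
  sys_form : I -> sys_mod -> sys_mod -> A;
  sys_fg : finitely_generated sys_mod;
  sys_proj : projective sys_mod;
  sys_sesqui : forall i, sesquilinear (sigma i) (@sys_form i)
}.

Definition isometric (X Y : system) : Prop :=
  isometric_forms (@sys_form X) (@sys_form Y).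

End Systems.

Section RestrictScalars.
Variables (R : comNzRingType) (A : algType R) (P : lmodType A^c).

Definition restrict : Type := P.
HB.instance Definition _ := GRing.Zmodule.on restrict.

Definition restrict_scale (r : R) (x : restrict) : restrict :=
  (x : P) *r (r%:A : A).

Let scaleA r s x :
  restrict_scale r (restrict_scale s x) = restrict_scale (r * s) x.
Proof.
rewrite /restrict_scale scalerA; congr (_ *: _).
by change (s%:A * r%:A = (r * s)%:A :> A); rewrite mulr_algl scalerA mulrC.
Qed.
Let scale1 : left_id 1 restrict_scale.
Proof. by move=> x; rewrite /restrict_scale scale1r; exact: scale1r. Qed.
Let scaleDr : right_distributive restrict_scale +%R.
Proof. by move=> r x y; exact: scalerDr. Qed.
Let scaleDl x : {morph restrict_scale^~ x : r s / r + s}.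
Proof. by move=> r s; rewrite /restrict_scale scalerDl; exact: scalerDl. Qed.
HB.instance Definition _ :=
  GRing.Zmodule_isLmodule.Build R restrict scaleA scale1 scaleDr scaleDl.

End RestrictScalars.

Section ScalarExtension.
Variables (R : comNzRingType) (A : algType R).
Variables (T : comPzRingType) (iota : {rmorphism R -> T}).
Local Notation A_T := (tens_alg iota A).

Section Module.
Variable P : lmodType A^c.

Definition ext_mod : Type := tens iota (restrict P).
HB.instance Definition _ := GRing.Zmodule.on ext_mod.

Let ract (x : restrict P) (a : A) : restrict P := (x : P) *r a.

Let ractP : bilinear_map ract.
Proof.
split=> [x y a|x a b|r x a|r x a].
- exact: (@scalerDr A^c P).
- exact: (@scalerDl A^c P).
- change ((x *r (r%:A : A)) *r a = (x *r a) *r (r%:A : A) :> P).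
  rewrite !scalerA; congr (_ *: _).
  by change (r%:A * a = a * r%:A); rewrite mulr_algl mulr_algr.
- change (x *r (r *: a) = (x *r a) *r (r%:A : A) :> P).
  rewrite !scalerA; congr (_ *: _).
  by change (r *: a = a * r%:A); rewrite mulr_algr.
Qed.

Definition ext_scale (a : A_T^c) (x : ext_mod) : ext_mod := tens_map2 ract x a.

Lemma ext_scale_pure (x : P) (a : A) k l :
  ext_scale (pure iota a l) (pure iota (x : restrict P) k) =
  pure iota (x *r a : restrict P) (k * l).
Proof. exact: tens_map2_pure. Qed.

Let scaleDr : right_distributive ext_scale +%R.
Proof. by move=> a x y; exact: tens_map2Dl. Qed.
Let scaleDl x : {morph ext_scale^~ x : a b / a + b}.
Proof. by move=> a b; exact: tens_map2Dr. Qed.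
Let scale1 : left_id 1 ext_scale.
Proof.
apply: (@tens_ext _ _ _ _ _ (ext_scale 1) id) => [x y|//|x k].
  by rewrite scaleDr.
by rewrite ext_scale_pure mulr1 scale1r.
Qed.
Let scaleA a b x : ext_scale a (ext_scale b x) = ext_scale (a * b) x.
Proof.
move: x; apply: (@tens_ext _ _ _ _ _ (fun x => ext_scale a (ext_scale b x))
  (ext_scale (a * b))) => [x y|x y|x k]; rewrite ?scaleDr//.
apply: (@tens_ext _ _ iota A ext_mod
  (fun a => ext_scale a (ext_scale b (pure iota x k)))
  (fun a => ext_scale ((a : A_T^c) * b) (pure iota x k)) _ _ _ a)
  => {a} [a a'|a a'|a m].
- exact: scaleDl.
- by rewrite -scaleDl -mulrDl.
apply: (@tens_ext _ _ iota A ext_mod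
  (fun b => ext_scale (pure iota a m) (ext_scale b (pure iota x k)))
  (fun b => ext_scale ((pure iota a m : A_T^c) * b) (pure iota x k)) _ _ _ b)
  => {b} [b b'|b b'|b l].
- by rewrite -scaleDr -scaleDl.
- by rewrite -scaleDl -mulrDr.
rewrite !ext_scale_pure scalerA.
transitivity (ext_scale (pure iota (b * a) (l * m)) (pure iota x k)).
  by rewrite ext_scale_pure mulrA.
by congr (ext_scale _ _); rewrite -(tens_alg_mul_pure iota b a l m).
Qed.
HB.instance Definition _ :=
  GRing.Zmodule_isLmodule.Build A_T^c ext_mod scaleA scale1 scaleDr scaleDl.

Lemma ext_act_pure (x : P) (a : A) k l :
  (pure iota (x : restrict P) k : ext_mod) *r (pure iota a l : A_T) =
  pure iota (x *r a : restrict P) (k * l).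
Proof. exact: ext_scale_pure. Qed.

Definition ext_form (f : P -> P -> A) : ext_mod -> ext_mod -> A_T :=
  tens_map2 (fun x y : restrict P => f x y).

End Module.

Section Form.
Variables (P : lmodType A^c) (sigma : A -> A) (f : P -> P -> A).
Hypotheses (sigmaP : R_involution sigma) (fP : sesquilinear sigma f).

Lemma involutionZ r a : sigma (r *: a) = r *: sigma a.
Proof.
case: sigmaP => sL _ _; have s0 : sigma 0 = 0.
  by have := sL 1 0 0; rewrite !scale1r addr0 => h;
    apply: (addrI (sigma 0)); rewrite -h addr0.
by have := sL r a 0; rewrite s0 !addr0.
Qed.

Lemma involutionD : {morph sigma : a b / a + b}.
Proof. by case: sigmaP => sL _ _ a b; have := sL 1 a b; rewrite !scale1r. Qed.

Lemma involution1 : sigma 1 = 1.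
Proof.
case: sigmaP => _ sM sK.
by rewrite -[LHS]mul1r -{1}(sK 1) -sM mul1r sK.
Qed.

Lemma form_bilinear : bilinear_map (fun x y : restrict P => f x y).
Proof.
case: fP => fDl fDr fM; split=> [x y z|x y z|r x y|r x y].
- exact: fDl.
- exact: fDr.
- change (f (x *r (r%:A : A)) y = r *: f x y).
  have := fM x y r%:A 1; rewrite scale1r => ->.
  by rewrite involutionZ involution1 mulr_algl mulr1.
- change (f x (y *r (r%:A : A)) = r *: f x y).
  have := fM x y 1 r%:A; rewrite scale1r => ->.
  by rewrite involution1 mul1r mulr_algr.
Qed.

Lemma ext_form_pure (x y : P) k l :
  ext_form f (pure iota (x : restrict P) k) (pure iota (y : restrict P) l) =
  pure iota (f x y) (k * l).
Proof.
exact: (@tens_map2_pure R T iota (restrict P) (restrict P) A _ form_bilinear).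
Qed.

Lemma ext_form_sesquilinear :
  sesquilinear (tens_map sigma : A_T -> A_T) (ext_form f).
Proof.
have eDl y : {morph (ext_form f)^~ y : x x' / x + x'}.
  exact: (tens_map2Dl form_bilinear).
have eDr x : {morph ext_form f x : y y' / y + y'}.
  exact: (tens_map2Dr form_bilinear).
split=> [x x' y|x y y'|x y a b]; [exact: eDl|exact: eDr|].
have sD : {morph (tens_map sigma : A_T -> A_T) : z w / z + w}.
  exact: (tens_mapD involutionD involutionZ).
apply: (@tens_ext _ _ iota (restrict P) A_T
  (fun x => ext_form f ((x : ext_mod P) *r a) (y *r b))
  (fun x => (tens_map sigma a : A_T) * ext_form f x y * b) _ _ _ x)
  => {x} [x x'|x x'|x k].
- by rewrite -eDl -scalerDr.
- by rewrite -mulrDl -mulrDr -eDl.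
apply: (@tens_ext _ _ iota (restrict P) A_T
  (fun y => ext_form f ((pure iota x k : ext_mod P) *r a)
                       ((y : ext_mod P) *r b))
  (fun y => (tens_map sigma a : A_T) * ext_form f (pure iota x k) y * b)
  _ _ _ y) => {y} [y y'|y y'|y l].
- by rewrite -eDr -scalerDr.
- by rewrite -mulrDl -mulrDr -eDr.
apply: (@tens_ext _ _ iota A A_T
  (fun a => ext_form f ((pure iota x k : ext_mod P) *r (a : A_T))
                       ((pure iota y l : ext_mod P) *r b))
  (fun a => (tens_map sigma a : A_T) *
            ext_form f (pure iota x k) (pure iota y l) * b)
  _ _ _ a) => {a} [a a'|a a'|a m].
- by rewrite -eDl -scalerDl.
- by rewrite -!mulrDl -sD.
apply: (@tens_ext _ _ iota A A_T
  (fun b => ext_form f ((pure iota x k : ext_mod P) *r (pure iota a m : A_T))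
                       ((pure iota y l : ext_mod P) *r (b : A_T)))
  (fun b => (tens_map sigma (pure iota a m) : A_T) *
            ext_form f (pure iota x k) (pure iota y l) * (b : A_T))
  _ _ _ b) => {b} [b b'|b b'|b n].
- by rewrite -eDr -scalerDl.
- by rewrite -mulrDr.
rewrite !ext_act_pure !ext_form_pure.
rewrite (tens_map_pure iota involutionD involutionZ) !tens_alg_mul_pure.
by case: fP => _ _ ->; congr (pure _ _ _); rewrite [m * _]mulrCA !mulrA mulrAC.
Qed.
End Form.

Definition isometric_over (I : Type) (sigma : I -> A -> A)
    (X Y : system sigma) : Prop :=
  isometric_forms (fun i => ext_form (@sys_form _ _ _ _ X i))
                  (fun i => ext_form (@sys_form _ _ _ _ Y i)).

End ScalarExtension.

Section Genus.
Variables (R : idomainType) (A : algType R) (I : Type) (sigma : I -> A -> A).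

Section Local.
Variable p : prime_idealr R.

(* For p = 0, the localization is the fraction field F of R and its maximal
   ideal is 0, so the completion is F itself. *)
Definition completion_at : Type := completion (@loc_ideal R p).
HB.instance Definition _ := GRing.ComNzRing.on completion_at.

Definition to_completion_at : R -> completion_at :=
  to_compl (loc_ideal (p := p)) \o to_loc p.
HB.instance Definition _ := GRing.RMorphism.on to_completion_at.
End Local.

Definition locally_isometric (X Y : system sigma) : Prop :=
  forall p : prime_idealr R, isometric_over (to_completion_at p) X Y.

(* The isometry class of Y is the predicate [isometric Y]. *)
Definition gen (X : system sigma) : Type :=
  {C : system sigma -> Prop |
     exists2 Y, locally_isometric X Y & C = isometric Y}.

End Genus.

(* Main.v *)
(* Choose coordinates, so that P is given by matrices rho (the action of A) and B
   (the coordinates of the forms), and let U(K) be the group of isometries over K.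
   For the finitely many nonzero primes p let K_p be the fraction field of the
   completion O_p. A member of the genus is determined by the lattice gamma P with
   gamma = k_p g_p, g_p in U(K_p) and k_p in GL(O_p), so the genus is a double
   coset space of the product G of the U(K_p) by U(F) and the integral isometries.
   The elements c of G such that 1 + c is invertible have Cayley transforms
   a = (1 - c)/(1 + c), which form a linear space defined over F. Approximating a
   by a matrix over F shows that multiplication by such a c does not change the
   double coset.
   - Every g^2 is a product of two such elements: if e is the Fitting idempotent of
     1 + g, then c = g (2 e - 1) is an isometry with 1 + c invertible and c^2 = g^2.
     So the double cosets form a quotient group of G of exponent 2.
   - If 1 + g_i^-1 g_j is never invertible for i <> j, then the matrix with entries
     det (g_i + g_j) is diagonal with nonzero diagonal, while its rank is at most
     n! 2^n. So this quotient is finite. *)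
Require Import Defs.
From HB Require Import structures.
From mathcomp Require Import all_boot all_order all_algebra.
From mathcomp Require Import perm ring.
From mathcomp Require Import boolp classical_sets functions cardinality.

Set Implicit Arguments.
Unset Strict Implicit.
Unset Printing Implicit Defensive.

Import GRing.Theory.
Local Open Scope ring_scope.

(** * Finite groups of exponent two *)

(** A double coset space carries no multiplication a priori, since the integral isometries and U(F)
    need not be normal in G. What saves the product is that an element c with 1 + c invertible can
    be inserted on either side of a tuple: its conjugates have the same property. Hence squares, and
    with them commutators, act trivially from both sides, and multiplication descends to double
    cosets. Approximation is carried out on Cayley transforms because the equations g B g^T = B are
    quadratic in g, while skewness is linear with coefficients in F, and a linear projection over F
    turns any approximation into an approximation by solutions. That 2 is nonzero in F enters three
    times: in the inverse Cayley transform, in the invertibility of 2 - h on the nilpotent part of h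
    = 1 + g, and in det (g + g) being nonzero. Members of the genus may live on other modules. They
    are first brought to the action rho of P by approximating local isomorphisms with an intertwiner
    over F; afterwards only the matrices of the forms vary. *)

Section ElementaryTwoQuotient.
Variables (G : Type) (mul : G -> G -> G) (one : G) (r : G -> G -> Prop).
Variables (Omega : finType) (cls : G -> Omega).
Hypotheses (r_refl : forall a, r a a) (r_sym : forall a b, r a b -> r b a).
Hypothesis r_trans : forall b a c, r a b -> r b c -> r a c.
Hypothesis r_mul : forall a b c d, r a b -> r c d -> r (mul a c) (mul b d).
Hypothesis mulA : forall a b c, r (mul a (mul b c)) (mul (mul a b) c).
Hypothesis mul1 : forall a, r (mul one a) a.
Hypothesis mul_sq : forall a, r (mul a a) one.
Hypothesis cls_r : forall a b, cls a = cls b -> r a b.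

Let mulKl a b : r (mul a (mul a b)) b.
Proof.
by apply: r_trans (mulA _ _ _) _; apply: r_trans (r_mul (mul_sq a) (r_refl b)) _.
Qed.

Let mul_inj a b c : r (mul a b) (mul a c) -> r b c.
Proof.
move=> h; apply: r_trans (r_sym (mulKl a b)) _.
by apply: r_trans (r_mul (r_refl a) h) _.
Qed.

(** Squares are trivial, so a b a b and a a agree; cancelling a gives b a b = a. *)
Let mulC a b : r (mul a b) (mul b a).
Proof.
apply: (@mul_inj b); apply: r_sym; apply: r_trans (mulKl b a) _; apply: r_sym.
apply: (@mul_inj a); apply: r_trans (mulA _ _ _) _.
apply: r_trans (mulA _ _ _) _; apply: r_trans (r_sym (mulA _ _ _)) _.
by apply: r_trans (mul_sq _) _; apply: r_sym.
Qed.

(** Representatives of a subgroup of order 2^k of the quotient by [r], which is never formed as a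
    type. *)
Let transversal k (J : finType) (f : J -> G) :=
  [/\ #|J| = (2 ^ k)%N, forall i j, r (f i) (f j) -> i = j,
      exists i, r one (f i)
    & forall i j, exists l, r (mul (f i) (f j)) (f l)].

(** The subgroup H is enlarged to the union of H and g H. These are disjoint because g f_i = f_j
    would give g = f_i f_j, an element of H. *)
Let transversal_double k (J : finType) (f : J -> G) g :
    transversal k f -> (forall i, ~ r g (f i)) ->
  transversal k.+1 (fun x : bool * J => if x.1 then mul g (f x.2) else f x.2).
Proof.
case=> cJ injf [i1 f1] fM gf.
have gfM i j : ~ r (mul g (f i)) (f j).
  have [l fl] := fM i j.
  move=> h; apply: (gf l); apply: r_trans fl.
  apply: (@mul_inj (f i)); apply: r_trans (mulC _ _) _; apply: r_trans h _.
  exact: r_sym (mulKl _ _).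
split.
- by rewrite card_prod card_bool cJ expnS.
- case=> [[] i] [[] j] /=.
  + by move/mul_inj/injf->.
  + by move/gfM.
  + by move/r_sym/gfM.
  + by move/injf->.
- by exists (false, i1).
- move=> [b i] [c j]; have [l fl] := fM i j.
  case: b c => [] [] /=.
  + exists (false, l) => /=; apply: r_trans fl.
    apply: r_trans (r_sym (mulA _ _ _)) _.
    apply: r_trans (r_mul (r_refl g) (mulA _ _ _)) _.
    apply: r_trans (r_mul (r_refl g) (r_mul (mulC _ _) (r_refl _))) _.
    by apply: r_trans (r_mul (r_refl g) (r_sym (mulA _ _ _))) _.
  + exists (true, l) => /=.
    by apply: r_trans (r_sym (mulA _ _ _)) _; apply: r_mul.
  + exists (true, l) => /=; apply: r_trans (mulA _ _ _) _.
    apply: r_trans (r_mul (mulC _ _) (r_refl _)) _.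
    by apply: r_trans (r_sym (mulA _ _ _)) _; apply: r_mul.
  + by exists (false, l).
Qed.

(** Inequivalent elements have different colours, so a transversal has 2^k <= #|Omega| elements and
    doubling must stop, which it does only when every class is represented. *)
Lemma elementary_two_quotient :
  exists n (f : 'I_(2 ^ n) -> G),
    forall g, exists i, r g (f i) /\ forall j, r g (f j) -> j = i.
Proof.
have bound k (J : finType) (f : J -> G) : transversal k f -> (k < #|Omega|)%N.
  case=> cJ injf _ _; apply: leq_trans (ltn_expl k (ltnSn 1)) _.
  by rewrite -cJ; apply: (@leq_card _ _ (cls \o f)) => i j /cls_r /injf.
suff [k [J [f [[cJ injf _ _] sf]]]] : exists k (J : finType) (f : J -> G),
    transversal k f /\ forall g, exists i, r g (f i).
  exists k, (fun i => f (enum_val (cast_ord (esym cJ) i))) => g.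
  have [i gi] := sf g; exists (cast_ord cJ (enum_rank i)).
  rewrite cast_ordK enum_rankK; split=> // j gj; apply: (canRL (cast_ordKV _)).
  apply/(can_inj (@enum_valK J)); rewrite enum_rankK.
  by apply: injf; apply: r_trans gi; apply: r_sym.
have t0 : transversal 0 (fun _ : unit => one).
  split; first by rewrite card_unit.
  - by move=> [] [].
  - by exists tt.
  - by move=> _ _; exists tt; exact: mul_sq.
suff ext m : forall k (J : finType) (f : J -> G), transversal k f ->
    (#|Omega| - k < m)%N ->
  exists k (J : finType) (f : J -> G),
    transversal k f /\ forall g, exists i, r g (f i) by exact: (ext _ _ _ _ t0).
elim: m => // m IH k J f tf km.
have [sf|/existsNP[g /forallNP gf]] := pselect (forall g, exists i, r g (f i)).
  by exists k, J, f.
apply: IH (transversal_double tf gf) _.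
have := bound _ _ _ tf; move: km; rewrite ltnS => km kO.
by apply: leq_trans km; rewrite ltn_sub2l.
Qed.

End ElementaryTwoQuotient.

(** * Isometries and Cayley transforms *)

(* The Leibniz formula, expanded over the choices of a summand in each factor,
   writes the matrix with entries [det (g i + g j)] as a product through a space
   of dimension n! 2^n. *)
Lemma det_add_rank (K : fieldType) n m (g : 'I_m -> 'M[K]_n) :
    (forall i, \det (g i + g i) != 0) ->
    (forall i j, i != j -> \det (g i + g j) = 0) ->
  (m <= #|{: 'S_n * {ffun 'I_n -> bool}}|)%N.
Proof.
move=> gii gij; pose T : finType := ('S_n * {ffun 'I_n -> bool})%type.
pose U := \matrix_(i < m, k < #|{: T}|)
  ((-1) ^+ (enum_val k).1 *
   \prod_(l | (enum_val k).2 l) g i l ((enum_val k).1 l)).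
pose V := \matrix_(k < #|{: T}|, j < m)
  (\prod_(l | ~~ (enum_val k).2 l) g j l ((enum_val k).1 l)).
have UV i j : \det (g i + g j) = (U *m V) i j.
  rewrite mxE /determinant.
  transitivity (\sum_(s : 'S_n) \sum_(f : {ffun 'I_n -> bool}) (-1) ^+ s *
      \prod_l (if f l then g i l (s l) else g j l (s l))).
    apply: eq_bigr => s _; rewrite -mulr_sumr.
    rewrite -(bigA_distr_bigA (fun l b => if b then g i l (s l) else g j l (s l))).
    by congr (_ * _); apply: eq_bigr => l _; rewrite big_bool mxE.
  rewrite pair_bigA /= (reindex (@enum_val T {: T})) /=; last exact/onW_bij/enum_val_bij.
  apply: eq_bigr => k _; rewrite !mxE -mulrA; congr (_ * _).
  rewrite (bigID (enum_val k).2) /=; congr (_ * _); apply: eq_bigr => l.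
    by move=> ->.
  by move/negPf->.
have /(congr1 mxrank) : U *m V = diag_mx (\row_i \det (g i + g i)).
  apply/matrixP => i j; rewrite -UV !mxE; case: eqVneq => [->|ij]; first by [].
  by rewrite gij// mulr0n.
rewrite (mxrank_unit (_ : diag_mx _ \in unitmx)); last first.
  rewrite unitmxE det_diag unitfE; apply/prodf_neq0 => i _; rewrite mxE; exact: gii.
by move=> <-; apply: leq_trans (mxrankM_maxl _ _) (rank_leq_col _).
Qed.

(** The forms take values in A; [B] lists their scalar coordinates, which are bilinear. The adjoint
    is therefore the plain transpose, and the involutions do not appear. *)
Definition isometry_mx (K : fieldType) n (J L : Type) (rho : J -> 'M[K]_n)
    (B : L -> 'M[K]_n) (g : 'M[K]_n) : Prop :=
  [/\ g \in unitmx, forall j, rho j *m g = g *m rho j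
    & forall l, g *m B l *m g^T = B l].

(** If q is the part of the characteristic polynomial prime to X, a Bezout relation u q + v X^(m+1)
    = 1 makes (v X^(m+1) - 1) X^(m+1) a multiple of that polynomial, and Cayley-Hamilton applies.
    The exponent stays positive even if h is invertible, so that the idempotent is always a multiple
    of h. *)
Lemma fitting_poly (K : fieldType) n (h : 'M[K]_n.+1) :
  exists k (u : {poly K}), (horner_mx h u * h ^+ k.+1 - 1) * h ^+ k.+1 = 0.
Proof.
have [m [q]] := multiplicity_XsubC (char_poly h) 0.
rewrite -size_poly_eq0 size_char_poly /= => q0 chi.
have : coprimep q (('X - 0%:P) ^+ m.+1) by rewrite coprimep_expr// coprimep_XsubC.
move=> /Bezout_eq1_coprimepP[[u v] /= uv].
exists m, v; move: uv chi; rewrite subr0 => uv chi.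
have -> : h ^+ m.+1 = horner_mx h ('X ^+ m.+1) by rewrite rmorphXn /= horner_mx_X.
rewrite -rmorphM -(rmorph1 (horner_mx h)) -rmorphB -rmorphM -uv opprD addrCA subrr addr0.
rewrite mulNr -mulrA exprSr (mulrA q) -chi rmorphN rmorphM rmorphM /=.
by rewrite Cayley_Hamilton mul0r mulr0 oppr0.
Qed.

(* [c = g (2 e - 1)] where [e] is the Fitting idempotent of [1 + g], which is
   symmetric for all the forms. *)
Lemma isometry_sq_cayley (K : fieldType) n (J L : Type) (rho : J -> 'M[K]_n)
    (B : L -> 'M[K]_n) (g : 'M[K]_n) : (2%:R : K) != 0 ->
  isometry_mx rho B g -> exists c,
    [/\ isometry_mx rho B c, 1%:M + c \in unitmx & c *m c = g *m g].
Proof.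
move=> two; case: n rho B g => [|n] rho B g.
  move=> gU; exists g; split=> //; by rewrite unitmxE det_mx00 unitr1.
case=> gu grho gB; pose h := 1 + g.
have [k [u uh]] := fitting_poly h.
pose e := horner_mx h u * h ^+ k.+1.
have comm_e x : GRing.comm x g -> GRing.comm x e.
  move=> xg; have xh : GRing.comm x h by apply: commrD => //; apply: commr1.
  apply: commrM; last exact: commrX.
  exact: comm_mx_horner.
have hk0 : (1 - e) * h ^+ k.+1 = 0 by apply: oppr_inj; rewrite -mulNr opprB uh oppr0.
have ee : e * e = e.
  apply/eqP; rewrite -subr_eq0 -{3}[e]mulr1 -mulrBr; apply/eqP.
  have -> : e * (e - 1) = (e - 1) * e by apply: commrB => //; exact: commr1.
  rewrite {2}/e mulrA; have -> : (e - 1) * horner_mx h u = horner_mx h u * (e - 1).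
    apply: commr_sym; apply: commrB; last exact: commr1.
    by apply: comm_e; apply: commr_sym; apply: comm_mx_horner; apply: commrD => //; apply: commr1.
  by rewrite -mulrA /e uh mulr0.
have ge : g * e = e * g by exact: comm_e.
have eE : e = e * h * (horner_mx h u * h ^+ k).
  rewrite -mulrA (mulrA h); have -> : h * horner_mx h u = horner_mx h u * h.
    by apply: comm_mx_horner.
  by rewrite -(mulrA _ h) -exprS -/e ee.
(* Invariance of C gives h C = C + g C = g C h^T, which moves powers of h across C. As 1 - e kills
   h^(k+1), this yields e C (1 - e)^T = 0. *)
have hkB (C : 'M_n.+1) j : g *m C *m g^T = C -> h ^+ j * C = g ^+ j * C * (h ^+ j)^T.
  move=> gC; have hC : h * C = g * C * h^T.
    by rewrite /h mulrDl mul1r linearD /= trmx1 mulrDr mulr1 -!mulmxE gC addrC.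
  elim: j => [|j IH]; first by rewrite !expr0 trmx1 mulr1.
  have hg : h ^+ j * g = g * h ^+ j.
    by apply: commr_sym; apply: commrX; apply: commrD => //; apply: commr1.
  rewrite {1}exprSr -mulrA hC !mulrA hg -(mulrA g) IH !mulrA -exprS -!mulrA.
  by rewrite -[_^T * h^T]trmx_mul mulmxE -exprS.
have eBe (C : 'M_n.+1) : g *m C *m g^T = C -> e * C * (1 - e)^T = 0.
  move=> gC; rewrite {1}/e -(mulrA _ _ C) hkB// -!mulrA -[_^T * _^T]trmx_mul.
  by rewrite mulmxE hk0 trmx0 !mulr0.
have eB (C : 'M_n.+1) : g *m C *m g^T = C -> e * C = C * e^T.
  move=> gC; have := eBe _ gC.
  rewrite linearB /= trmx1 mulrBr mulr1 => /eqP; rewrite subr_eq0 => /eqP ->.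
  (* C need not be symmetric: the other half, (1 - e) C e^T = 0, comes from the invariant form
     C^T. *)
  have gCT : g *m C^T *m g^T = C^T by rewrite -{2}gC !trmx_mul trmxK mulmxA.
  move: (congr1 trmx (eBe _ gCT)); rewrite trmx0 -!mulmxE !trmx_mul !trmxK mulmxA.
  by rewrite !mulmxE mulrBl mul1r mulrBl => /eqP; rewrite subr_eq0 => /eqP ->.
clearbody e; pose s := e *+ 2 - 1.
have ss : s * s = 1.
  have dd : e *+ 2 * (e *+ 2) = e *+ 2 + e *+ 2.
    by rewrite mulrnAl mulrnAr ee -mulrnA -mulrnDr.
  by rewrite /s mulrBr mulr1 mulrBl mul1r dd addrK opprB addrC subrK.
have comm_s x : GRing.comm x g -> GRing.comm x s.
  by move=> xg; apply: commrB; [apply: commrMn; apply: comm_e|apply: commr1].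
have gs : g * s = s * g by apply: comm_s.
have sB (C : 'M_n.+1) : g *m C *m g^T = C -> s * C * s^T = C.
  move=> gC; have sC : s * C = C * s^T.
    rewrite /s mulrBl mul1r mulrnAl eB// linearB linearMn /= trmx1.
    by rewrite mulrBr mulr1 mulrnAr.
  by rewrite sC -mulrA -[_ * _^T]trmx_mul mulmxE ss trmx1 mulr1.
exists (g * s); split.
- split.
  + rewrite -mulmxE unitmx_mul gu /=; apply: (@mulmx1_unit _ _ s s _).1; exact: ss.
  + move=> j; rewrite -mulmxE mulmxA grho -!mulmxA; congr (_ *m _).
    by apply: comm_s; exact: grho.
  + move=> l; rewrite -!mulmxE trmx_mul !mulmxA -(mulmxA g s) -(mulmxA g (s *m _)).
    by rewrite mulmxE sB// -mulmxE gB.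
(* On the image of e, s is 1 and h is invertible. On the image of 1 - e, s is -1 and h is nilpotent:
   a vector w there with w h = 2 w satisfies 2^(k+1) w = w h^(k+1) = 0. *)
- have gsE : 1 + g * s = e * h + (1 - e) * (2%:R - h).
    have -> : g = h - 1 by rewrite /h addrC addKr.
    have eh : h * e = e * h by rewrite /h mulrDl mul1r mulrDr mulr1 ge.
    rewrite /s mulrBr mulr1 mulrBl mulrnAr mul1r eh mulrBl mul1r mulrBr mulr_natr.
    rewrite !opprB mulr2n -[2%:R]/(1 + 1) !addrA.
    by rewrite [LHS](ACl (2*1*5*6*3*4))%AC.
  rewrite -row_free_unit; apply/inj_row_free => v; rewrite [_ + _]gsE => v0.
  have eh : e * h = h * e.
    apply: commr_sym; apply: comm_e; apply: commr_sym.
    by apply: commrD => //; apply: commr1.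
  have e2h : e * (2%:R - h) = (2%:R - h) * e.
    by apply: commrB => //; apply: commr_nat.
  have ve : v *m (e * h) = 0.
    have : v *m (e * h + (1 - e) * (2%:R - h)) *m e = 0 by rewrite v0 mul0mx.
    rewrite -mulmxA mulmxE mulrDl -!mulrA -eh -e2h (mulrA e) ee (mulrA (1 - e)) mulrBl mul1r ee.
    by rewrite subrr mul0r addr0.
  move: v0; rewrite mulmxDr ve add0r => v1.
  pose w := v *m (1 - e).
  have wh : w *m h = w *+ 2.
    have : w *m (1 + 1 - h) = 0 by rewrite -mulmxA.
    by rewrite mulmxBr mulmxDr mulmx1 -mulr2n => /eqP; rewrite subr_eq0 => /eqP.
  have wk j : w *m h ^+ j = w *+ (2 ^ j).
    elim: j => [|j IH]; first by rewrite expr0 mulmx1.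
    rewrite exprSr -mulmxE mulmxA IH -scaler_nat -scalemxAl wh -!scaler_nat.
    by rewrite scalerA -natrM mulnC expnS.
  have w0 : w = 0.
    move: (wk k.+1); rewrite -mulmxA mulmxE hk0 mulmx0 => /esym/eqP.
    by rewrite -scaler_nat scaler_eq0 natrX expf_eq0 (negPf two) andbF => /eqP.
  move: w0; rewrite /w mulmxBr mulmx1 => /eqP; rewrite subr_eq0 => /eqP ->.
  rewrite eE.
  have -> : v *m (e * h * (horner_mx h u * h ^+ k)) =
    v *m (e * h) *m (horner_mx h u * h ^+ k) by rewrite -mulmxA.
  by rewrite ve mul0mx.
- by rewrite mulmxE -!mulrA (mulrA s) -gs -(mulrA g s) ss mulr1.
Qed.

Lemma invmx_comm (K : comUnitRingType) n (k x : 'M[K]_n) :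
  x \in unitmx -> k *m x = x *m k -> k *m invmx x = invmx x *m k.
Proof.
by move=> xu kx; rewrite -[LHS](mulKmx xu) (mulmxA x) -kx -mulmxA mulmxV// mulmx1.
Qed.

Lemma isometry_mx1 (K : fieldType) n (J L : Type) (rho : J -> 'M[K]_n)
    (B : L -> 'M[K]_n) : isometry_mx rho B 1%:M.
Proof.
split=> [|k|l]; first exact: unitmx1; first by rewrite mul1mx mulmx1.
by rewrite trmx1 mul1mx mulmx1.
Qed.

Lemma isometry_mxM (K : fieldType) n (J L : Type) (rho : J -> 'M[K]_n)
    (B : L -> 'M[K]_n) g h :
  isometry_mx rho B g -> isometry_mx rho B h -> isometry_mx rho B (g *m h).
Proof.
case=> gu grho gB [hu hrho hB]; split=> [|k|l].
- by rewrite unitmx_mul gu.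
- by rewrite mulmxA grho -mulmxA hrho mulmxA.
- by rewrite trmx_mul !mulmxA -(mulmxA g) -(mulmxA g) hB gB.
Qed.

Lemma isometry_mxV (K : fieldType) n (J L : Type) (rho : J -> 'M[K]_n)
    (B : L -> 'M[K]_n) g :
  isometry_mx rho B g -> isometry_mx rho B (invmx g).
Proof.
case=> gu grho gB; split=> [|k|l]; [by rewrite unitmx_inv|exact: invmx_comm|].
by rewrite -{1}(gB l) !mulmxA mulVmx// mul1mx -mulmxA -trmx_mul mulVmx// trmx1 mulmx1.
Qed.

(** The Lie algebra of the group [isometry_mx]. *)
Definition skew_mx (K : fieldType) n (J L : Type) (rho : J -> 'M[K]_n)
    (B : L -> 'M[K]_n) (a : 'M[K]_n) : Prop :=
  (forall k, rho k *m a = a *m rho k) /\ forall l, a *m B l + B l *m a^T = 0.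

(** Skewness turns 1 - a on the left of B l into (1 + a)^T on its right and conversely, and 1 + a
    commutes with 1 - a. *)
Lemma cayley_isometry (K : fieldType) n (J L : Type) (rho : J -> 'M[K]_n)
    (B : L -> 'M[K]_n) a :
  skew_mx rho B a -> 1%:M + a \in unitmx -> 1%:M - a \in unitmx ->
  isometry_mx rho B (invmx (1%:M + a) *m (1%:M - a)).
Proof.
case=> arho aB ua ub; split=> [|k|l]; first by rewrite unitmx_mul unitmx_inv ua.
  rewrite mulmxA invmx_comm//; last by rewrite mulmxDr mulmxDl mulmx1 mul1mx arho.
  by rewrite -!mulmxA mulmxBr mulmxBl mulmx1 mul1mx arho.
have key : (1%:M - a) *m B l *m (1%:M - a)^T = (1%:M + a) *m B l *m (1%:M + a)^T.
  have aBE : a *m B l = - (B l *m a^T) by apply/eqP; rewrite -addr_eq0 aB.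
  have aBm : (1%:M - a) *m B l = B l *m (1%:M + a)^T.
    by rewrite mulmxBl mul1mx aBE opprK linearD /= trmx1 mulmxDr mulmx1.
  have aBp : (1%:M + a) *m B l = B l *m (1%:M - a)^T.
    by rewrite mulmxDl mul1mx aBE linearB /= trmx1 mulmxBr mulmx1.
  rewrite aBm aBp -!mulmxA -!trmx_mul; congr (_ *m _^T).
  rewrite mulmxBl mulmxDl !mul1mx mulmxBr mulmxDr !mulmx1.
  by rewrite opprD addrA addrK addrA subrK.
rewrite trmx_mul !mulmxA -!(mulmxA (invmx _)) mulmxA -(mulmxA (1%:M - a)) mulmxA key.
rewrite !mulmxA mulVmx// mul1mx -mulmxA -trmx_mul mulVmx// trmx1 mulmx1//.
Qed.

(** With d = (1 + c)^-1 and a = d (1 - c), one has 1 + a = 2 d and 1 - a = 2 c d. *)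
Lemma isometry_cayley (K : fieldType) n (J L : Type) (rho : J -> 'M[K]_n)
    (B : L -> 'M[K]_n) c : (2%:R : K) != 0 ->
  isometry_mx rho B c -> 1%:M + c \in unitmx ->
  exists2 a, skew_mx rho B a & [/\ 1%:M + a \in unitmx, 1%:M - a \in unitmx
    & c = invmx (1%:M + a) *m (1%:M - a)].
Proof.
move=> two [cu crho cB] uc; pose d := invmx (1%:M + c).
have dc : c *m d = d *m c by apply: invmx_comm => //; rewrite mulmxDr mulmxDl mulmx1 mul1mx.
have pd : (1%:M + c) *m d = 1%:M by rewrite mulmxV.
have unit2 (x : 'M[K]_n) : x \in unitmx -> x *+ 2 \in unitmx.
  by move=> xu; rewrite -scaler_nat unitmxZ// unitfE.
pose a := d *m (1%:M - c).
have aE : a = (1%:M - c) *m d by rewrite /a mulmxBr mulmxBl mulmx1 mul1mx dc.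
have a1 : 1%:M + a = d *+ 2.
  by rewrite aE -{1}pd -mulmxDl addrACA subrr addr0 mulmxDl mul1mx -mulr2n.
have a2 : 1%:M - a = (c *m d) *+ 2.
  by rewrite aE -{1}pd -mulmxBl opprB addrC addrA subrK mulmxDl -mulr2n.
exists a; last first.
  split; first by rewrite a1 unit2 // unitmx_inv.
    by rewrite a2 unit2// unitmx_mul cu unitmx_inv.
  rewrite a1 a2; apply: (canRL (mulKmx _)); first by rewrite unit2 ?unitmx_inv.
  by rewrite -!scaler_nat -scalemxAl dc.
split=> [k|l].
  rewrite /a mulmxA invmx_comm//; last by rewrite mulmxDr mulmxDl mulmx1 mul1mx crho.
  by rewrite -!mulmxA mulmxBr mulmxBl mulmx1 mul1mx crho.
have da : (1%:M + c) *m a = 1%:M - c by rewrite mulmxA pd mul1mx.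
(* Skewness is tested after multiplication by 1 + c on the left and (1 + c)^T on the right. There
   only (1 + c) a = 1 - c is needed, and all terms cancel by c B c^T = B. *)
move: (a) da => {a aE a1 a2} a da.
apply: (can_inj (mulKmx uc)); apply: (can_inj (mulmxK (_ : (1%:M + c)^T \in unitmx))).
  by rewrite unitmx_tr.
rewrite mulmx0 mul0mx mulmxDr mulmxDl !mulmxA da -(mulmxA _ a^T) -trmx_mul da.
rewrite linearB linearD /= trmx1.
rewrite !(mulmxBl, mulmxDl, mulmxBr, mulmxDr, mul1mx, mulmx1) cB.
rewrite !opprD !addrA [LHS](ACl (1*4*2*6*3*7*5*8))%AC /=.
by rewrite subrr add0r addNr add0r subrr add0r subrr.
Qed.

(* The projection [1 - V V^+] is defined over the small field, whatever the field
   in which the solutions are taken. *)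
Lemma solution_projection (F : fieldType) N d (Q : Type) (E : Q -> 'M[F]_(N, d)) :
  exists2 p : 'M[F]_N, forall q, p *m E q = 0
    & forall (K : fieldType) (j : {rmorphism F -> K}) (x : 'rV[K]_N),
        (forall q, x *m map_mx j (E q) = 0) -> x *m map_mx j p = x.
Proof.
(* The family of equations may be infinite. A matrix V of maximal rank whose rows are consequences
   of them, over every extension K, has all the equations in its row space and replaces them. *)
pose P (V : 'M[F]_N) := forall (K : fieldType) (j : {rmorphism F -> K}) (x : 'rV[K]_N),
  (forall q, x *m map_mx j (E q) = 0) -> x *m map_mx j V^T = 0.
pose Pr r := `[< exists V, P V /\ \rank V = r >].
have Pr0 : exists r, Pr r.
  exists 0%N; apply/asboolP; exists 0; rewrite mxrank0; split=> // K j x _.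
  by rewrite trmx0 map_mx0 mulmx0.
have Prb r : Pr r -> (r <= N)%N by move=> /asboolP[V [_ <-]]; exact: rank_leq_row.
case: (ex_maxnP Pr0 Prb) => r /asboolP[V [PV rV]] rmax.
have EV q : ((E q)^T <= V)%MS.
  have PVE : P (V + (E q)^T)%MS.
    move=> K j x xE; have /submxP[D ->] : (V + (E q)^T <= col_mx V (E q)^T)%MS.
      by rewrite addsmxE.
    rewrite trmx_mul tr_col_mx trmxK map_mxM map_row_mx mulmxA mul_mx_row.
    by rewrite xE PV// row_mx0 mul0mx.
  have := rmax (\rank (V + (E q)^T)%MS); rewrite -rV => le.
  have VE : (V + (E q)^T <= V)%MS.
    rewrite -(geq_leqif (mxrank_leqif_sup (addsmxSl V (E q)^T))).
    by apply: le; apply/asboolP; exists (V + (E q)^T)%MS.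
  exact: submx_trans (addsmxSr _ _) VE.
exists (1%:M - V^T *m pinvmx V^T) => [q|K j x xE].
  have /submxP[D /(congr1 trmx)] := EV q; rewrite trmxK trmx_mul => ->.
  by rewrite mulmxA mulmxBl mul1mx mulmxKpV// subrr mul0mx.
rewrite map_mxB map_mx1 mulmxBr mulmx1 map_mxM mulmxA (PV _ _ _ xE) mul0mx.
by rewrite subr0.
Qed.

Definition gl (T : comNzRingType) n (X : 'M[T]_n) : Prop := exists Y, X *m Y = 1%:M.

Lemma glV (T : comNzRingType) n (X : 'M[T]_n) :
  gl X -> exists Y, [/\ gl Y, X *m Y = 1%:M & Y *m X = 1%:M].
Proof. by case=> Y XY; have YX := mulmx1C XY; exists Y; split=> //; exists X. Qed.

Lemma glM (T : comNzRingType) n (X Y : 'M[T]_n) : gl X -> gl Y -> gl (X *m Y).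
Proof.
case=> X' XX' [Y' YY']; exists (Y' *m X').
by rewrite mulmxA -(mulmxA X) YY' mulmx1.
Qed.

Lemma gl1 (T : comNzRingType) n : gl (1%:M : 'M[T]_n).
Proof. by exists 1%:M; rewrite mulmx1. Qed.

Lemma map_gl_unit (T : comNzRingType) (K : fieldType) (f : {rmorphism T -> K}) n
    (X : 'M[T]_n) : gl X -> map_mx f X \in unitmx.
Proof.
by case=> Y XY; apply: (@mulmx1_unit _ _ _ (map_mx f Y) _).1; rewrite -map_mxM XY map_mx1.
Qed.

(* The determinant of [1 + c X] is the value at [c] of a polynomial with value 1 at 0. *)
Lemma det1D_scale (T : comNzRingType) n (c : T) (X : 'M[T]_n) :
  exists t, \det (1%:M + c *: X) = 1 + c * t.
Proof.
pose M := 1%:M + 'X *: map_mx polyC X.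
have ME a : \det (1%:M + a *: X) = (\det M).[a].
  rewrite -horner_evalE -det_map_mx; congr (\det _); apply/matrixP => i k.
  rewrite !mxE /= horner_evalE !hornerE /=.
  by case: (i == k); rewrite !hornerE.
have : root (\det M - 1) 0 by rewrite /root !hornerE -ME scale0r addr0 det1 subrr.
case/factor_theorem => q /(congr1 (fun p => p.[c])); rewrite !hornerE -ME subr0.
by move=> /(canRL (subrK _)) ->; exists q.[c]; rewrite addrC mulrC.
Qed.

(* Vectors are rows, so [g] is the map [x |-> x g] from the second structure to the
   first one. *)
Definition mx_isom (R T : comNzRingType) (f : {rmorphism R -> T}) n (J L : Type)
    (rho : J -> 'M[R]_n) (B : L -> 'M[R]_n) (rho' : J -> 'M[R]_n) (B' : L -> 'M[R]_n)
    (g : 'M[T]_n) : Prop :=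
  [/\ gl g, forall k, map_mx f (rho' k) *m g = g *m map_mx f (rho k)
    & forall l, map_mx f (B' l) = g *m map_mx f (B l) *m g^T].

Section MxIsom.
Variables (R T : comNzRingType) (f : {rmorphism R -> T}) (n : nat) (J L : Type).

Lemma mx_isom_refl (rho : J -> 'M[R]_n) (B : L -> 'M[R]_n) :
  mx_isom f rho B rho B 1%:M.
Proof.
split=> [|k|l]; first exact: gl1; first by rewrite mul1mx mulmx1.
by rewrite trmx1 mul1mx mulmx1.
Qed.

Lemma mx_isom_trans (rho rho' rho'' : J -> 'M[R]_n) (B B' B'' : L -> 'M[R]_n) g h :
  mx_isom f rho B rho' B' g -> mx_isom f rho' B' rho'' B'' h ->
  mx_isom f rho B rho'' B'' (h *m g).
Proof.
case=> gu grho gB [hu hrho hB]; split=> [|k|l]; first exact: glM.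
  by rewrite mulmxA hrho -mulmxA grho mulmxA.
by rewrite hB gB trmx_mul !mulmxA.
Qed.

Lemma mx_isom_sym (rho rho' : J -> 'M[R]_n) (B B' : L -> 'M[R]_n) g h :
  mx_isom f rho B rho' B' g -> h *m g = 1%:M -> mx_isom f rho' B' rho B h.
Proof.
case=> gu grho gB hg; have gh := mulmx1C hg; split=> [|k|l].
- by exists g.
- by rewrite -[LHS]mul1mx -hg -mulmxA (mulmxA g) -grho -!mulmxA gh mulmx1.
- by rewrite gB !mulmxA hg mul1mx -mulmxA -trmx_mul hg trmx1 mulmx1.
Qed.

End MxIsom.

Lemma gl_unitmx (K : comUnitRingType) n (g : 'M[K]_n) : gl g <-> g \in unitmx.
Proof.
split=> [[h /mulmx1_unit[]]//|gu]; by exists (invmx g); rewrite mulmxV.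
Qed.

Lemma gl_map (T U : comNzRingType) (h : {rmorphism T -> U}) n (g : 'M[T]_n) :
  gl g -> gl (map_mx h g).
Proof. by case=> g' gg'; exists (map_mx h g'); rewrite -map_mxM gg' map_mx1. Qed.

Lemma map_mx_inj (T U : nzRingType) (h : T -> U) a b :
  injective h -> injective (fun X : 'M[T]_(a, b) => map_mx h X).
Proof.
move=> h_inj X Y /matrixP XY; apply/matrixP => u v; apply: h_inj.
by have := XY u v; rewrite !mxE.
Qed.

Section MxIsomMap.
Variables (R T U : comNzRingType) (f : {rmorphism R -> T}) (h : {rmorphism T -> U}).
Variables (e : {rmorphism R -> U}) (n : nat) (J L : Type).
Variables (rho rho' : J -> 'M[R]_n) (B B' : L -> 'M[R]_n) (g : 'M[T]_n).
Hypothesis fhe : forall x, h (f x) = e x.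

Let map_fhe (M : 'M[R]_n) : map_mx e M = map_mx h (map_mx f M).
Proof. by apply/matrixP => u v; rewrite !mxE. Qed.

Lemma mx_isom_map : mx_isom f rho B rho' B' g -> mx_isom e rho B rho' B' (map_mx h g).
Proof.
case=> ggl grho gB; split=> [|k|l]; first exact: gl_map.
  by rewrite !map_fhe -!map_mxM grho.
by rewrite !map_fhe map_trmx -!map_mxM gB.
Qed.

(** Identities descend along an injection but invertibility does not, hence the hypothesis on g over
    T. *)
Lemma mx_isom_descent : injective h -> gl g ->
  mx_isom e rho B rho' B' (map_mx h g) -> mx_isom f rho B rho' B' g.
Proof.
move=> h_inj ggl [_ grho gB]; split=> // [k|l]; apply: (map_mx_inj h_inj) => /=.
  by rewrite !map_mxM -!map_fhe.
by rewrite !map_mxM -map_trmx -!map_fhe.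
Qed.

End MxIsomMap.

Lemma isometry_mxP (R : comNzRingType) (K : fieldType) (f : {rmorphism R -> K}) n
    (J L : Type) (rho : J -> 'M[R]_n) (B : L -> 'M[R]_n) g :
  isometry_mx (fun k => map_mx f (rho k)) (fun l => map_mx f (B l)) g <->
  mx_isom f rho B rho B g.
Proof.
split=> -[ggl grho gB]; split=> //; first exact/gl_unitmx.
exact/gl_unitmx.
Qed.

Lemma dependent_choice (I : Type) (X : I -> Type) (P : forall i, X i -> Prop) :
  (forall i, exists x, P i x) -> exists f, forall i, P i (f i).
Proof. by move=> h; exists (fun i => projT1 (cid (h i))) => i; case: cid. Qed.

Lemma dependent_choice2 (I : Type) (X : I -> Type) (P Q : forall i, X i -> Prop) :
  (forall i, exists2 x, P i x & Q i x) ->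
  exists f, (forall i, P i (f i)) /\ (forall i, Q i (f i)).
Proof.
move=> h; have /dependent_choice[f fP] : forall i, exists x, P i x /\ Q i x.
  by move=> i; have [x] := h i; exists x.
by exists f; split=> i; case: (fP i).
Qed.

(** * Matrix identities for a perturbed Cayley transform *)

Section Sandwich.
Variables (K : fieldType) (n : nat) (g p q : 'M[K]_n).
Hypotheses (gu : g \in unitmx) (pu : p \in unitmx) (qu : q \in unitmx).

(** Used with p = 1 + a, q = 1 - a and z = a - y: the right-hand sides become 1 + y here and 1 - y
    in [sandwich1D]. The inner matrices differ from 1 by z between fixed matrices, so they are
    congruent to 1 when y is close to a. *)
Lemma sandwich1B z :
  p *m invmx g *m (1%:M - g *m invmx p *m z *m invmx g) *m g = p - z.
Proof.
rewrite mulmxBr mulmx1 mulmxBl !mulmxA !(mulmxKV gu).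
by rewrite (mulmxV pu) mul1mx.
Qed.

Lemma sandwich1D z :
  p *m invmx g *m (1%:M + g *m invmx p *m z *m (invmx q *m p *m invmx g)) *m g *m
    invmx p *m q = q + z.
Proof.
rewrite mulmxDr mulmx1 !mulmxDl !mulmxA !(mulmxKV gu).
by rewrite (mulmxK pu) (mulmxV pu) !mul1mx (mulmxKV qu).
Qed.

(** The factor p g^-1 common to both perturbed matrices cancels in their quotient, and the errors X
    and Y end up on the left of g, where integral factors are harmless. *)
Lemma sandwich_quotient X Y Y' : X \in unitmx -> Y' *m Y = 1%:M ->
  g *m (invmx p *m q) = Y' *m X *m g *m
    (invmx (p *m invmx g *m X *m g) *m (p *m invmx g *m Y *m g *m invmx p *m q)).
Proof.
move=> Xu Y'Y; set A := p *m invmx g *m X *m g.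
have Au : A \in unitmx by rewrite !unitmx_mul unitmx_inv pu gu Xu.
have XA : X *m g = g *m invmx p *m A.
  by rewrite /A !mulmxA (mulmxKV pu) (mulmxV gu) mul1mx.
clearbody A; rewrite -(mulmxA Y') XA !mulmxA (mulmxK Au) (mulmxKV pu) (mulmxK gu) Y'Y.
by rewrite mul1mx.
Qed.

End Sandwich.

(** * Double cosets *)

Section LocalGlobal.
Variables (R : comNzRingType) (F : fieldType) (iF : {rmorphism R -> F}).
Variables (S : finType) (s0 : S) (T : S -> comNzRingType) (K : S -> fieldType).
Variables (iT : forall i, {rmorphism R -> T i}) (o : forall i, {rmorphism T i -> K i}).
Variables (j : forall i, {rmorphism F -> K i}) (pi : forall i, T i).
Arguments iT : clear implicits.
Arguments o : clear implicits.
Arguments j : clear implicits.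
Hypothesis o_inj : forall i, injective (o i).
Hypothesis iF_inj : injective iF.
Hypothesis o_iT : forall i r, o i (iT i r) = j i (iF r).
Hypothesis pi_unit : forall i t, exists t', (1 + pi i * t) * t' = 1.
Hypothesis denominator : forall i (x : K i), exists m t, o i (pi i ^+ m) * x = o i t.
Hypothesis approximation : forall (x : forall i, K i) m,
  exists r, forall i, exists t, x i - j i r = o i (pi i ^+ m * t).
Hypothesis integral_everywhere : forall x : F,
  (forall i, exists t, j i x = o i t) -> exists r, x = iF r.
Hypothesis two_neq0 : (2%:R : F) != 0.

Local Notation "M ^j_ i" := (map_mx (j i) M) (at level 2, i at level 1).
Local Notation "M ^o_ i" := (map_mx (o i) M) (at level 2, i at level 1).

(** * Approximation of matrices and of solutions of linear equations *)

Lemma map_iT_iF i a b (M : 'M[R]_(a, b)) :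
  (map_mx (iT i) M)^o_i = (map_mx iF M)^j_i.
Proof. by apply/matrixP => u v; rewrite !mxE. Qed.

Lemma mx_denominator i a b (X : 'M[K i]_(a, b)) :
  exists m, forall m', (m <= m')%N ->
    exists X0, o i (pi i ^+ m') *: X = X0^o_i.
Proof.
have /choice[f fP] : forall uv, exists mt : nat * T i,
    o i (pi i ^+ mt.1) * X uv.1 uv.2 = o i mt.2.
  by move=> [u v]; have [m [t e]] := denominator (X u v); exists (m, t).
exists (\max_uv (f uv).1)%N => m' fm.
exists (\matrix_(u, v) (pi i ^+ (m' - (f (u, v)).1) * (f (u, v)).2)).
apply/matrixP => u v; rewrite !mxE rmorphM -fP /= mulrA -rmorphM -exprD subnK//.
by apply: leq_trans fm; exact: (leq_bigmax (u, v)).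
Qed.

Lemma gl_near1 i n (X : 'M[T i]_n) : gl (1%:M + pi i *: X).
Proof.
have [t dt] := det1D_scale (pi i) X; have [t' tt'] := pi_unit t.
exists (t' *: \adj (1%:M + pi i *: X)).
by rewrite -scalemxAr mul_mx_adj dt scale_scalar_mx mulrC tt'.
Qed.

Lemma mx_approximation a b (x : forall i, 'M[K i]_(a, b)) m :
  exists y : 'M[F]_(a, b), forall i, exists X,
    x i - y^j_i = o i (pi i ^+ m) *: X^o_i.
Proof.
have /choice[f fP] : forall uv, exists r, forall i, exists t,
    x i uv.1 uv.2 - j i r = o i (pi i ^+ m * t).
  by move=> [u v]; exact: approximation.
exists (\matrix_(u, v) f (u, v)) => i.
have /choice[t tP] := fP^~ i.
exists (\matrix_(u, v) t (u, v)); apply/matrixP => u v.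
by rewrite !mxE -rmorphM -tP.
Qed.

(** An arbitrary approximation of x over F is projected to the solution space by a p defined over F.
    Since p fixes x, the error is merely multiplied by p. *)
Lemma solution_approximation a b d (Q : Type) (E : Q -> 'M[F]_(a * b, d))
    (x : forall i, 'M[K i]_(a, b)) m :
  (forall i q, mxvec (x i) *m (E q)^j_i = 0) ->
  exists2 y : 'M[F]_(a, b), forall q, mxvec y *m E q = 0
    & forall i, exists X, x i - y^j_i = o i (pi i ^+ m) *: X^o_i.
Proof.
move=> xE; have [p pE px] := solution_projection E.
have /choice[c cP] : forall i, exists m, forall m', (m <= m')%N ->
    exists X0, o i (pi i ^+ m') *: p^j_i = X0^o_i.
  by move=> i; exact: mx_denominator.
(* The extra precision pays for the denominators of p. *)
have [y yP] := mx_approximation x (m + \max_i c i)%N.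
exists (vec_mx (mxvec y *m p)) => [q|i]; first by rewrite vec_mxK -mulmxA pE mulmx0.
have [X XP] := yP i; have [p0 p0P] := cP i _ (leq_bigmax i).
exists (vec_mx (mxvec X *m p0)).
rewrite -[x i](mxvecK) -(px _ _ _ (xE i)) map_vec_mx map_mxM -linearB /= -mulmxBl.
rewrite map_mxvec -linearB /= XP exprD rmorphM -scalerA.
have mxvecZ (k : K i) (M : 'M[K i]_(a, b)) : mxvec (k *: M) = k *: mxvec M.
  exact: linearZ.
rewrite !mxvecZ -!scalemxAl linearZ /=; congr (_ *: _).
rewrite scalemxAr p0P.
by rewrite map_vec_mx map_mxM map_mxvec.
Qed.

Lemma intertwiner_approximation a b (J : Type) (rho : J -> 'M[F]_a)
    (rho' : J -> 'M[F]_b) (x : forall i, 'M[K i]_(a, b)) m :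
  (forall i k, (rho k)^j_i *m x i = x i *m (rho' k)^j_i) ->
  exists2 y : 'M[F]_(a, b), forall k, rho k *m y = y *m rho' k
    & forall i, exists X, x i - y^j_i = o i (pi i ^+ m) *: X^o_i.
Proof.
move=> xrho; pose E k : 'M[F]_(a * b) :=
  lin_mx (mulmx (rho k) : 'M_(a, b) -> _) - lin_mx (mulmxr (rho' k)).
have [|y yE yx] := @solution_approximation _ _ _ _ E x m.
  move=> i k; rewrite map_mxB (map_lin_mx (gf := mulmx (rho k)^j_i)); last first.
    by move=> A; rewrite map_mxM.
  rewrite (map_lin_mx (gf := mulmxr (rho' k)^j_i)); last first.
    by move=> A; rewrite /= map_mxM.
  by rewrite mulmxBr !mul_vec_lin /= xrho subrr.
exists y => // k; have := yE k; rewrite mulmxBr !mul_vec_lin /= => /eqP.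
by rewrite subr_eq0 => /eqP; exact: (can_inj mxvecK).
Qed.

Section Forms.
Variables (n : nat) (J L : Type) (rho : J -> 'M[R]_n) (B : L -> 'M[R]_n).
Local Notation rhoF := (fun k => map_mx iF (rho k)).
Local Notation BF := (fun l => map_mx iF (B l)).
Local Notation rhoK i := (fun k => (rhoF k)^j_i).
Local Notation BK i := (fun l => (BF l)^j_i).

Lemma skew_approximation (x : forall i, 'M[K i]_n) m :
    (forall i, skew_mx (rhoK i) (BK i) (x i)) ->
  exists2 y : 'M[F]_n, skew_mx rhoF BF y
    & forall i, exists X, x i - y^j_i = o i (pi i ^+ m) *: X^o_i.
Proof.
move=> xS; pose E (q : J + L) : 'M[F]_(n * n) := match q with
  | inl k => lin_mx (mulmx (rhoF k) : 'M_n -> 'M_n) - lin_mx (mulmxr (rhoF k))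
  | inr l => lin_mx (mulmxr (BF l)) + lin_mx (mulmx (BF l) \o trmx : 'M_n -> 'M_n)
  end.
have [|y yE yx] := @solution_approximation _ _ _ _ E x m.
  move=> i [k|l] /=.
    rewrite map_mxB (map_lin_mx (gf := mulmx (rhoK i k))); last first.
      by move=> A; rewrite map_mxM.
    rewrite (map_lin_mx (gf := mulmxr (rhoK i k))); last first.
      by move=> A; rewrite /= map_mxM.
    by rewrite mulmxBr !mul_vec_lin /= (xS i).1 subrr.
  rewrite map_mxD (map_lin_mx (gf := mulmxr (BK i l))); last first.
    by move=> A; rewrite /= map_mxM.
  rewrite (map_lin_mx (gf := mulmx (BK i l) \o trmx)); last first.
    by move=> A; rewrite /= map_mxM map_trmx.
  by rewrite mulmxDr !mul_vec_lin -linearD /= (xS i).2 linear0.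
exists y => //; split=> [k|l].
  have := yE (inl k); rewrite mulmxBr !mul_vec_lin /= => /eqP.
  by rewrite subr_eq0 => /eqP; exact: (can_inj mxvecK).
have := yE (inr l); rewrite mulmxDr !mul_vec_lin -linearD /= => /eqP.
by rewrite mxvec_eq0 => /eqP.
Qed.

Lemma twoK i : (2%:R : K i) != 0.
Proof. by rewrite -(rmorph_nat (j i)) fmorph_eq0. Qed.

(** The exponent covers one denominator for each of P and Q and leaves a factor pi, as [gl_near1]
    requires. *)
Lemma sandwich_small i D (P Q : 'M[K i]_n) P0 X Q0 :
    o i (pi i ^+ D) *: P = P0^o_i -> o i (pi i ^+ D) *: Q = Q0^o_i ->
  P *m (o i (pi i ^+ (D + D).+1) *: X^o_i) *m Q = (pi i *: (P0 *m X *m Q0))^o_i.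
Proof.
move=> PP QQ; rewrite map_mxZ !map_mxM -PP -QQ exprS exprD !rmorphM /=.
by rewrite -!scalemxAl -!scalemxAr -!scalemxAl !scalerA -mulrA.
Qed.

Lemma common_denominator (P Q Q' : forall i, 'M[K i]_n) :
  exists D, forall i, [/\ exists X, o i (pi i ^+ D) *: P i = X^o_i,
    exists X, o i (pi i ^+ D) *: Q i = X^o_i
    & exists X, o i (pi i ^+ D) *: Q' i = X^o_i].
Proof.
have /choice[d dP] := fun i => mx_denominator (P i).
have /choice[e eP] := fun i => mx_denominator (Q i).
have /choice[f fP] := fun i => mx_denominator (Q' i).
exists (\max_i maxn (d i) (maxn (e i) (f i)))%N => i.
have := leq_bigmax (F := fun i => maxn (d i) (maxn (e i) (f i))) i.
by rewrite !geq_max => /and3P[di ei fi]; split; [exact: dP|exact: eP|exact: fP].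
Qed.

(* Writing [c = (1 + a)^-1 (1 - a)] and [u = (1 + y)^-1 (1 - y)] with [y] close to
   [a], conjugation by [g (1 + a)^-1] and [g] turns the two factors of [u] into
   those of [c] up to matrices [X], [Y] congruent to 1. *)
Lemma cayley_approximation (g c : forall i, 'M[K i]_n) :
    (forall i, g i \in unitmx) -> (forall i, isometry_mx (rhoK i) (BK i) (c i)) ->
    (forall i, 1%:M + c i \in unitmx) ->
  exists2 u : 'M[F]_n, isometry_mx rhoF BF u
    & forall i, exists2 h, gl h & g i *m c i = h^o_i *m g i *m u^j_i.
Proof.
move=> gu cI cu.
have aE i : exists a, skew_mx (rhoK i) (BK i) a /\ [/\ 1%:M + a \in unitmx,
    1%:M - a \in unitmx & c i = invmx (1%:M + a) *m (1%:M - a)].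
  by have [a aS aP] := isometry_cayley (twoK i) (cI i) (cu i); exists a.
pose a i := projT1 (cid (aE i)).
have aS i : skew_mx (rhoK i) (BK i) (a i) := (projT2 (cid (aE i))).1.
have aP i : [/\ 1%:M + a i \in unitmx, 1%:M - a i \in unitmx
    & c i = invmx (1%:M + a i) *m (1%:M - a i)] := (projT2 (cid (aE i))).2.
move: (a) aS aP => {aE a} a aS aP.
pose P i := g i *m invmx (1%:M + a i).
pose Q i := invmx (1%:M - a i) *m (1%:M + a i) *m invmx (g i).
have [D DP] := common_denominator P Q (fun i => invmx (g i)).
have [y yS ya] := skew_approximation (D + D).+1 aS.
have XY i : exists X Y, [/\ gl X, gl Y,
    1%:M + y^j_i = (1%:M + a i) *m invmx (g i) *m X^o_i *m g i &
    1%:M - y^j_i = (1%:M + a i) *m invmx (g i) *m Y^o_i *m g i *m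
      invmx (1%:M + a i) *m (1%:M - a i)].
  have [[P0 PP] [Q0 QQ] [G0 GG]] := DP i; have [Z ZP] := ya i.
  have [au bu _] := aP i.
  exists (1%:M + pi i *: (- (P0 *m Z *m G0))), (1%:M + pi i *: (P0 *m Z *m Q0)).
  split; [exact: gl_near1|exact: gl_near1| |].
    rewrite scalerN map_mxB map_mx1 -(sandwich_small _ PP GG) -ZP /P.
    by rewrite sandwich1B// opprB addrACA subrr addr0.
  rewrite map_mxD map_mx1 -(sandwich_small _ PP QQ) -ZP /P /Q.
  by rewrite sandwich1D// [RHS]addrA subrK.
(* Invertibility over F of 1 + y and 1 - y can be tested in one extension, and [s0] provides it. *)
have [X0 [Y0 [X0gl Y0gl X0e Y0e]]] := XY s0; have [au0 bu0 _] := aP s0.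
have yu : 1%:M + y \in unitmx.
  rewrite -(map_unitmx (j s0)) map_mxD map_mx1 X0e !unitmx_mul unitmx_inv gu au0.
  by rewrite map_gl_unit.
have yv : 1%:M - y \in unitmx.
  rewrite -(map_unitmx (j s0)) map_mxB map_mx1 Y0e !unitmx_mul !unitmx_inv gu au0 bu0.
  by rewrite map_gl_unit.
exists (invmx (1%:M + y) *m (1%:M - y)); first exact: cayley_isometry.
move=> i; have [X [Y [Xgl Ygl Xe Ye]]] := XY i.
have [Y' [Y'gl YY' Y'Y]] := glV Ygl; have [au bu ce] := aP i.
exists (Y' *m X); first exact: glM.
rewrite ce !map_mxM map_invmx map_mxD map_mxB map_mx1 Xe Ye.
apply: sandwich_quotient => //; first by rewrite map_gl_unit.
by rewrite -map_mxM Y'Y map_mx1.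
Qed.

(** * The genus as a double coset space *)

Definition genus_mx (B' : L -> 'M[R]_n) : Prop :=
  (exists g, mx_isom iF rho B rho B' g) /\
  forall i, exists g, mx_isom (iT i) rho B rho B' g.

Definition equiv_mx (B' B'' : L -> 'M[R]_n) : Prop :=
  exists g, mx_isom idfun rho B' rho B'' g.

Local Notation tuple := (forall i, 'M[K i]_n).

Definition local_isometry (g : tuple) := forall i, isometry_mx (rhoK i) (BK i) (g i).

(* The form [B'] is attached to the double coset of [g], where [g i = k^-1 gamma]
   compares the global and the local isometries from [B] to [B']. *)
Definition attached (g : tuple) (B' : L -> 'M[R]_n) : Prop :=
  exists2 gamma, mx_isom iF rho B rho B' gamma
    & forall i, exists2 k, gl k & gamma^j_i = k^o_i *m g i.

(** Only integrality is asked of h: between local isometries it equals g' u^-1 g^-1, so it is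
    automatically an isometry. *)
Definition same_coset (g g' : tuple) : Prop :=
  exists2 u : 'M[F]_n, isometry_mx rhoF BF u
    & forall i, exists2 h, gl h & g' i = h^o_i *m g i *m u^j_i.

Lemma mx_integral_everywhere a b (x : 'M[F]_(a, b)) :
  (forall i, exists X, x^j_i = X^o_i) -> exists X, x = map_mx iF X.
Proof.
move=> xX; have /choice[f fP] : forall uv, exists r, x uv.1 uv.2 = iF r.
  move=> [u v]; apply: integral_everywhere => i; have [X /matrixP/(_ u v)] := xX i.
  by rewrite !mxE => ->; exists (X u v).
by exists (\matrix_(u, v) f (u, v)); apply/matrixP => u v; rewrite !mxE -fP.
Qed.

Lemma gl_near_integral (g : 'M[F]_n) :
  (forall i, exists2 h : 'M[T i]_n, gl h & g^j_i = h^o_i) ->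
  exists2 d : 'M[R]_n, gl d & g = map_mx iF d.
Proof.
move=> gh; have gu : g \in unitmx.
  by have [h hgl he] := gh s0; rewrite -(map_unitmx (j s0)) he map_gl_unit.
have [|d de] := @mx_integral_everywhere _ _ g; first by move=> i; have [h _ ->] := gh i; exists h.
have [|d' d'e] := @mx_integral_everywhere _ _ (invmx g).
  move=> i; have [h /glV[h' [_ hh' h'h]] he] := gh i; exists h'.
  rewrite map_invmx he; have hu : h^o_i \in unitmx by rewrite -he map_unitmx.
  by rewrite -[RHS](mulKmx hu) -map_mxM hh' map_mx1 mulmx1.
exists d => //; exists d'; apply: (map_mx_inj iF_inj); rewrite /= map_mxM -de -d'e map_mx1.
by rewrite mulmxV.
Qed.

Local Notation jF i := (j i \o iF).

Lemma isometry_mxKP i g :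
  isometry_mx (rhoK i) (BK i) g <-> mx_isom (jF i) rho B rho B g.
Proof.
rewrite -isometry_mxP; have E (M : 'M[R]_n) : map_mx (jF i) M = (map_mx iF M)^j_i.
  exact: map_mx_comp.
have -> : (fun k => map_mx (jF i) (rho k)) = rhoK i by apply/funext => k; rewrite E.
by have -> : (fun l => map_mx (jF i) (B l)) = BK i by apply/funext => l; rewrite E.
Qed.

Let o_isom i (B1 B2 : L -> 'M[R]_n) k :
  mx_isom (iT i) rho B1 rho B2 k -> mx_isom (jF i) rho B1 rho B2 k^o_i.
Proof. by apply: mx_isom_map => x; exact: o_iT. Qed.

Let j_isom i (B1 B2 : L -> 'M[R]_n) k :
  mx_isom iF rho B1 rho B2 k -> mx_isom (jF i) rho B1 rho B2 k^j_i.
Proof. exact: mx_isom_map. Qed.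

(** The integral factor k i is gamma (g i)^-1, an isometry over K i from B to B', and it descends to
    T i. *)
Lemma attached_genus g B' : local_isometry g -> attached g B' -> genus_mx B'.
Proof.
move=> gI [gam gamI gamk]; split; first by exists gam.
move=> i; have [k kgl kE] := gamk i; exists k.
apply: (mx_isom_descent (e := jF i) (o_iT i) (@o_inj i)) => //.
have gu : g i \in unitmx by case: (gI i).
have -> : k^o_i = gam^j_i *m invmx (g i) by rewrite kE mulmxK.
apply: (mx_isom_trans _ (@j_isom i _ _ _ gamI)).
by apply/isometry_mxKP; apply: isometry_mxV.
Qed.

Lemma genus_attached B' : genus_mx B' -> exists2 g, local_isometry g & attached g B'.
Proof.
move=> [[gam gamI] /dependent_choice[k kI]].
have ku i : (k i)^o_i \in unitmx by have [kgl _ _] := kI i; exact: map_gl_unit.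
exists (fun i => invmx (k i)^o_i *m gam^j_i).
  move=> i; apply/isometry_mxKP; apply: mx_isom_trans (@j_isom i _ _ _ gamI) _.
  exact: mx_isom_sym (@o_isom i _ _ _ (kI i)) (mulVmx (ku i)).
exists gam => // i; have [kgl _ _] := kI i; exists (k i) => //.
by rewrite (mulKVmx (ku i)).
Qed.

(** An intertwiner gam over F close to all g i has the form (1 - pi X) g i with X integral, provided
    the precision exceeds the denominators of the inverses of the g i. The form is then transported
    by gam. *)
Lemma attached_exists g : local_isometry g -> exists B', attached g B'.
Proof.
move=> gI; have gu i : g i \in unitmx by case: (gI i).
have [D DP] := common_denominator (fun i => invmx (g i)) (fun=> 1%:M) (fun=> 1%:M).
have [|gam gamrho gamg] := @intertwiner_approximation _ _ _ rhoF rhoF g D.+1.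
  by move=> i; case: (gI i).
have gamk i : exists2 k : 'M[T i]_n, gl k & gam^j_i = k^o_i *m g i.
  have [X XP] := gamg i; have [[G GP] _ _] := DP i.
  exists (1%:M + pi i *: (- (X *m G))); first exact: gl_near1.
  have -> : gam^j_i = g i - o i (pi i ^+ D.+1) *: X^o_i by rewrite -XP opprB addrC subrK.
  rewrite scalerN map_mxB map_mx1 mulmxBl mul1mx map_mxZ map_mxM -GP.
  by rewrite -scalemxAr scalerA -rmorphM -exprS -scalemxAl (mulmxKV (gu i)).
have gamu : gam \in unitmx.
  have [k kgl kE] := gamk s0.
  by rewrite -(map_unitmx (j s0)) kE unitmx_mul gu map_gl_unit.
(* As g i preserves B, the transported form is k B k^T over K i, which is integral. *)
have BP l : exists B', map_mx iF B' = gam *m BF l *m gam^T.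
  have [|X XE] := @mx_integral_everywhere _ _ (gam *m BF l *m gam^T); last by exists X.
  move=> i; have [k kgl kE] := gamk i; exists (k *m map_mx (iT i) (B l) *m k^T).
  rewrite !map_mxM -!map_trmx map_iT_iF kE trmx_mul !mulmxA.
  by have [_ _ gB] := gI i; rewrite -{2}(gB l) !mulmxA.
have /choice[B' B'P] := BP.
exists B'; exists gam => //; split=> //; exact/gl_unitmx.
Qed.

(** From u one gets gam' u^-1 gam^-1, which is k' h k^-1 locally and hence lies in GL(R).
    Conversely, d over R gives u = gam^-1 d^-1 gam' and h = k'^-1 d k. *)
Lemma attached_same_coset g g' B' B'' :
    local_isometry g -> local_isometry g' -> attached g B' -> attached g' B'' ->
  same_coset g g' <-> equiv_mx B' B''.
Proof.
move=> gI gI' [gam gamI gamk] [gam' gamI' gamk'].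
have gu i : g i \in unitmx by case: (gI i).
have gu' i : g' i \in unitmx by case: (gI' i).
have gamu : gam \in unitmx by case: gamI => /gl_unitmx.
have gamu' : gam' \in unitmx by case: gamI' => /gl_unitmx.
split=> [[u uI uh]|[d dI]].
  have uu : u \in unitmx by case: uI.
  have dI : mx_isom iF rho B' rho B'' (gam' *m invmx u *m invmx gam).
    apply: mx_isom_trans (mx_isom_sym gamI (mulVmx gamu)) _.
    apply: mx_isom_trans _ gamI'; apply/isometry_mxP; exact: isometry_mxV.
  have [|d dgl dE] := @gl_near_integral (gam' *m invmx u *m invmx gam).
    move=> i; have [h hgl hE] := uh i; have [k kgl kE] := gamk i.
    have [k' kgl' kE'] := gamk' i; have [kV [kVgl kkV kVk]] := glV kgl.
    exists (k' *m h *m kV); first exact/glM/kVgl/glM.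
    rewrite !map_mxM !map_invmx kE' hE !mulmxA mulmxK ?map_unitmx//.
    apply: (canLR (mulmxK _)); first by rewrite map_unitmx.
    by rewrite kE !mulmxA -(mulmxA _ kV^o_i) -(map_mxM (o i) kV) kVk map_mx1 mulmx1.
  exists d; apply: (mx_isom_descent (h := iF) (e := iF)) => //.
  by rewrite -dE.
have dI' : mx_isom iF rho B' rho B'' (map_mx iF d).
  by apply: mx_isom_map dI.
have du : map_mx iF d \in unitmx by case: dI' => /gl_unitmx.
exists (invmx gam *m invmx (map_mx iF d) *m gam').
  apply/isometry_mxP; apply: mx_isom_trans gamI' _.
  apply: mx_isom_trans (mx_isom_sym dI' (mulVmx du)) _.
  exact: mx_isom_sym gamI (mulVmx gamu).
move=> i; have [k kgl kE] := gamk i; have [k' kgl' kE'] := gamk' i.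
have [kV' [kVgl' kkV' kVk']] := glV kgl'.
have [dgl _ _] := dI.
exists (kV' *m map_mx (iT i) d *m k); first exact/glM/kgl/glM/gl_map.
have dju : (map_mx iF d)^j_i \in unitmx by rewrite map_unitmx.
rewrite !map_mxM !map_invmx map_iT_iF -(mulmxA _ k^o_i (g i)) -kE !mulmxA.
rewrite mulmxK ?map_unitmx// (mulmxK dju) kE' mulmxA -map_mxM kVk' map_mx1 mul1mx//.
Qed.

(** * Multiplication of double cosets *)

Definition tmul (g h : tuple) : tuple := fun i => g i *m h i.
Definition tinv (g : tuple) : tuple := fun i => invmx (g i).

Lemma local_isometryM g h :
  local_isometry g -> local_isometry h -> local_isometry (tmul g h).
Proof. by move=> gI hI i; apply: isometry_mxM. Qed.

Lemma local_isometryV g : local_isometry g -> local_isometry (tinv g).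
Proof. by move=> gI i; apply: isometry_mxV. Qed.

Lemma local_isometry1 : local_isometry (fun=> 1%:M).
Proof. by move=> i; apply: isometry_mx1. Qed.

Lemma local_isometry_unit g : local_isometry g -> forall i, g i \in unitmx.
Proof. by move=> gI i; case: (gI i). Qed.

Lemma isometry_mx_map u i : isometry_mx rhoF BF u -> isometry_mx (rhoK i) (BK i) u^j_i.
Proof.
by move=> uI; apply/isometry_mxKP; apply: j_isom; apply/isometry_mxP.
Qed.

Lemma same_coset_refl g : same_coset g g.
Proof.
exists 1%:M; first exact: isometry_mx1.
by move=> i; exists 1%:M; [exact: gl1|rewrite !map_mx1 mulmx1 mul1mx].
Qed.

Lemma same_coset_trans g g' g'' :
  same_coset g g' -> same_coset g' g'' -> same_coset g g''.
Proof.
move=> [u uI uh] [v vI vh]; exists (u *m v); first exact: isometry_mxM.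
move=> i; have [h hgl hE] := uh i; have [k kgl kE] := vh i.
by exists (k *m h); [exact: glM|rewrite kE hE !map_mxM !mulmxA].
Qed.

Lemma same_coset_sym g g' : same_coset g g' -> same_coset g' g.
Proof.
move=> [u uI uh]; exists (invmx u); first exact: isometry_mxV.
move=> i; have [h hgl hE] := uh i; have [k [kgl hk kh]] := glV hgl.
exists k => //; have uu : u^j_i \in unitmx by rewrite map_unitmx; case: uI.
by rewrite hE map_invmx !mulmxA (mulmxK uu) -map_mxM kh map_mx1 mul1mx.
Qed.

(** Exposes u and h as tuples of isometries, so that they can be commuted with other tuples; the
    last clause applies the same pair to any x. *)
Lemma same_cosetP g g' : local_isometry g -> local_isometry g' -> same_coset g g' ->
  exists u h, [/\ local_isometry u, local_isometry h,
    forall i, g' i = h i *m g i *m u i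
    & forall x : tuple, same_coset x (fun i => h i *m x i *m u i)].
Proof.
move=> gI gI' [u uI /dependent_choice2[h [hgl hE]]].
have uIi i : isometry_mx (rhoK i) (BK i) u^j_i by exact: isometry_mx_map.
exists (fun i => u^j_i), (fun i => (h i)^o_i); split=> // [i|x]; last first.
  by exists u => // i; exists (h i).
have -> : (h i)^o_i = g' i *m invmx u^j_i *m invmx (g i).
  rewrite hE mulmxK; last by case: (uIi i).
  by rewrite mulmxK ?local_isometry_unit.
by apply: isometry_mxM; [apply: isometry_mxM|]; rewrite ?isometry_mxV//; exact: isometry_mxV.
Qed.

Definition cayley (c : tuple) := forall i, 1%:M + c i \in unitmx.

Lemma same_coset_cayleyr g c : local_isometry g -> local_isometry c -> cayley c ->
  same_coset g (tmul g c).
Proof.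
move=> gI cI cC.
have [u uI uh] := cayley_approximation (local_isometry_unit gI) cI cC.
by exists u.
Qed.

(** One has c g = g (g^-1 c g), and 1 plus the conjugate is the conjugate of 1 + c. *)
Lemma same_coset_cayleyl g c : local_isometry g -> local_isometry c -> cayley c ->
  same_coset g (tmul c g).
Proof.
move=> gI cI cC; have gu := local_isometry_unit gI.
have -> : tmul c g = tmul g (tmul (tinv g) (tmul c g)).
  by apply: functional_extensionality_dep => i; rewrite /tmul /tinv (mulKVmx (gu i)).
apply: same_coset_cayleyr => //.
  by apply: local_isometryM; [exact: local_isometryV|exact: local_isometryM].
move=> i; rewrite /tmul /tinv.
have -> : 1%:M + invmx (g i) *m (c i *m g i) =
    invmx (g i) *m (1%:M + c i) *m g i.
  by rewrite mulmxDr mulmxDl mulmx1 (mulVmx (gu i)) !mulmxA.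
by rewrite !unitmx_mul unitmx_inv gu cC.
Qed.

Lemma cayley_sq p : local_isometry p ->
  exists c, [/\ local_isometry c, cayley c & tmul p p = tmul c c].
Proof.
move=> pI; have /dependent_choice[c cP] := fun i => isometry_sq_cayley (twoK i) (pI i).
exists c; split=> [i|i|]; try by case: (cP i).
by apply: functional_extensionality_dep => i; case: (cP i).
Qed.

Lemma same_coset_sql p z : local_isometry p -> local_isometry z ->
  same_coset z (tmul (tmul p p) z).
Proof.
move=> pI zI; have [c [cI cC ->]] := cayley_sq pI.
have -> : tmul (tmul c c) z = tmul c (tmul c z).
  by apply: functional_extensionality_dep => i; rewrite /tmul /tinv mulmxA.
apply: same_coset_trans (same_coset_cayleyl zI cI cC) _.
by apply: same_coset_cayleyl => //; exact: local_isometryM.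
Qed.

(* A commutator is a product of squares: [x y x^-1 y^-1 = (x y)^2 (y^-1 x^-1 y)^2 y^-2]. *)
Lemma same_coset_comml x y z :
    local_isometry x -> local_isometry y -> local_isometry z ->
  same_coset (tmul (tmul y x) z) (tmul (tmul x y) z).
Proof.
move=> xI yI zI; have xu := local_isometry_unit xI; have yu := local_isometry_unit yI.
have yVI := local_isometryV yI; have xVI := local_isometryV xI.
pose p := tmul x y; pose q := tmul (tmul (tinv y) (tinv x)) y; pose s := tinv y.
pose w := tmul (tmul y x) z.
have pI : local_isometry p by exact: local_isometryM.
have qI : local_isometry q by do !apply: local_isometryM.
have wI : local_isometry w by do !apply: local_isometryM.
have -> : tmul (tmul x y) z = tmul (tmul p p) (tmul (tmul q q) (tmul (tmul s s) w)).
  apply: functional_extensionality_dep => i; rewrite /p /q /s /w /tmul /tinv !mulmxA.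
  by rewrite !(mulmxK (yu i), mulmxKV (yu i), mulmxK (xu i), mulmxKV (xu i)).
have sI : local_isometry s by [].
apply: same_coset_trans (same_coset_sql sI wI) _.
have w1I : local_isometry (tmul (tmul s s) w) by do !apply: local_isometryM.
apply: same_coset_trans (same_coset_sql qI w1I) _.
by apply: same_coset_sql => //; do !apply: local_isometryM.
Qed.

(** Conjugation by z carries the product x y to the left of z, where [same_coset_comml] applies. *)
Lemma same_coset_commr x y z :
    local_isometry x -> local_isometry y -> local_isometry z ->
  same_coset (tmul z (tmul x y)) (tmul z (tmul y x)).
Proof.
move=> xI yI zI; have zu := local_isometry_unit zI.
have conjI a : local_isometry a -> local_isometry (tmul (tmul z a) (tinv z)).
  by move=> aI; apply: local_isometryM (local_isometryV zI); exact: local_isometryM.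
have := same_coset_comml (conjI _ yI) (conjI _ xI) zI.
have conjE a b : tmul (tmul (tmul (tmul z a) (tinv z)) (tmul (tmul z b) (tinv z))) z
    = tmul z (tmul a b).
  by apply: functional_extensionality_dep => i; rewrite /tmul /tinv !mulmxA !(mulmxKV (zu i)).
by rewrite !conjE.
Qed.

(** If g' = h g u, then x g is equivalent to h x g u while x g' = x h g u, so it remains to exchange
    h and x on the left. *)
Lemma same_coset_mull x g g' :
    local_isometry x -> local_isometry g -> local_isometry g' ->
  same_coset g g' -> same_coset (tmul x g) (tmul x g').
Proof.
move=> xI gI gI' /(same_cosetP gI gI')[u [h [uI hI gE huP]]].
apply: same_coset_trans (huP _) _.
have -> : (fun i => h i *m (x i *m g i) *m u i) = tmul (tmul h x) (tmul g u).
  by apply: functional_extensionality_dep => i; rewrite /tmul /tinv !mulmxA.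
have -> : tmul x g' = tmul (tmul x h) (tmul g u).
  by apply: functional_extensionality_dep => i; rewrite /tmul /tinv gE !mulmxA.
by apply: same_coset_comml => //; exact: local_isometryM.
Qed.

Lemma same_coset_mulr x g g' :
    local_isometry x -> local_isometry g -> local_isometry g' ->
  same_coset g g' -> same_coset (tmul g x) (tmul g' x).
Proof.
move=> xI gI gI' /(same_cosetP gI gI')[u [h [uI hI gE huP]]].
apply: same_coset_trans (huP _) _.
have -> : (fun i => h i *m (g i *m x i) *m u i) = tmul (tmul h g) (tmul x u).
  by apply: functional_extensionality_dep => i; rewrite /tmul /tinv !mulmxA.
have -> : tmul g' x = tmul (tmul h g) (tmul u x).
  by apply: functional_extensionality_dep => i; rewrite /tmul /tinv gE !mulmxA.
by apply: same_coset_commr => //; exact: local_isometryM.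
Qed.

(** * Finiteness of the number of double cosets *)

Definition cayley_bound := #|{: 'S_n * {ffun 'I_n -> bool}}|.

(** Take a maximal family of isometries whose pairwise sums are singular. Every isometry g has an
    invertible sum with some member, and the index of that member is the colour of g. *)
Lemma cayley_classes i : exists cls : 'M[K i]_n -> 'I_cayley_bound.+1,
  forall g g', isometry_mx (rhoK i) (BK i) g -> isometry_mx (rhoK i) (BK i) g' ->
    cls g = cls g' -> exists2 x, isometry_mx (rhoK i) (BK i) x
      & x + g \in unitmx /\ x + g' \in unitmx.
Proof.
pose P m := `[< exists r : 'I_m -> 'M[K i]_n,
  (forall a, isometry_mx (rhoK i) (BK i) (r a)) /\
  (forall a b, a != b -> \det (r a + r b) = 0) >].
have P0 : exists m, P m.
  exists 0%N; apply/asboolP; exists (fun=> 0); split=> [[]|[]]//.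
have det2 g : isometry_mx (rhoK i) (BK i) g -> \det (g + g) != 0.
  by move=> [gu _ _]; rewrite -unitfE -unitmxE -mulr2n -scaler_nat unitmxZ// unitfE twoK.
have Pb m : P m -> (m <= cayley_bound)%N.
  by move=> /asboolP[r [rI rdet]]; apply: det_add_rank rdet => a; exact: det2.
case: (ex_maxnP P0 Pb) => m Pm mmax; have mb := Pb m Pm.
move: Pm => /asboolP[r [rI rdet]].
have hit g : isometry_mx (rhoK i) (BK i) g -> exists a, r a + g \in unitmx.
  move=> gI; apply: contrapT => /forallNP ng.
  have rg a : \det (r a + g) = 0.
    by apply/eqP; move/negP: (ng a); rewrite unitmxE unitfE negbK.
  have : P m.+1.
    apply/asboolP; exists (fun a => if unlift ord0 a is Some b then r b else g).
    split=> [a|a b]; first by case: unliftP.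
    case: (unliftP ord0 a) => [a' ->|->]; case: (unliftP ord0 b) => [b' ->|->] //.
    + by rewrite (inj_eq lift_inj) => /rdet.
    + by move=> _; rewrite addrC rg.
  by move=> /mmax; rewrite ltnn.
(* Matrices that are not isometries get the default colour [ord0]; the successor in the bound makes
   the colour type nonempty. *)
have hit' (g : 'M[K i]_n) : exists c : 'I_cayley_bound.+1,
    isometry_mx (rhoK i) (BK i) g -> exists2 a : 'I_m, c = inord a & r a + g \in unitmx.
  have [gI|ngI] := pselect (isometry_mx (rhoK i) (BK i) g); last by exists ord0.
  by have [a ag] := hit g gI; exists (inord a) => _; exists a.
have /choice[cls clsP] := hit'.
exists cls => g g' gI gI'; have [a -> ag] := clsP g gI; have [a' -> ag'] := clsP g' gI'.
move=> /(congr1 (@nat_of_ord _)); rewrite !inordK ?ltnS ?(leq_trans (ltnW (ltn_ord _)) mb)//.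
by move/val_inj => aa'; exists (r a) => //; rewrite {2}aa'.
Qed.

(** Two tuples of equal colour are both linked to one x: if x + y is invertible, so is 1 + x^-1 y,
    and y = x (x^-1 y). *)
Lemma same_coset_classes : exists cls : tuple -> {ffun S -> 'I_cayley_bound.+1},
  forall g g', local_isometry g -> local_isometry g' -> cls g = cls g' ->
    same_coset g g'.
Proof.
have /dependent_choice[cls clsP] := cayley_classes.
exists (fun g => [ffun i => cls i (g i)]) => g g' gI gI' /ffunP cE.
have /dependent_choice2[x [xI xu]] : forall i,
    exists2 x, isometry_mx (rhoK i) (BK i) x & x + g i \in unitmx /\ x + g' i \in unitmx.
  by move=> i; apply: clsP => //; have := cE i; rewrite !ffunE.
have xU := local_isometry_unit xI.
have xVI : local_isometry (tinv x) by exact: local_isometryV.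
have step y : local_isometry y -> (forall i, x i + y i \in unitmx) -> same_coset x y.
  move=> yI xy; have -> : y = tmul x (tmul (tinv x) y).
    by apply: functional_extensionality_dep => i; rewrite /tmul /tinv (mulKVmx (xU i)).
  apply: same_coset_cayleyr => //; first exact: local_isometryM.
  move=> i; rewrite /tmul /tinv -(mulVmx (xU i)) -mulmxDr unitmx_mul unitmx_inv xU.
  exact: xy.
apply: same_coset_trans (same_coset_sym (step g gI _)) (step g' gI' _) => i.
- by case: (xu i).
- by case: (xu i).
Qed.

Theorem genus_mx_power_of_two : exists N (B_ : 'I_(2 ^ N) -> L -> 'M[R]_n),
  (forall a, genus_mx (B_ a)) /\
  forall B', genus_mx B' ->
    exists a, equiv_mx B' (B_ a) /\ forall b, equiv_mx B' (B_ b) -> b = a.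
Proof.
pose G := {g : tuple | local_isometry g}.
have [cls clsP] := same_coset_classes.
pose mulG (x y : G) : G := exist _ _ (local_isometryM (svalP x) (svalP y)).
pose oneG : G := exist _ _ local_isometry1.
have [||||||||N [f fP]] := @elementary_two_quotient G mulG oneG
    (fun x y => same_coset (sval x) (sval y)) _ (fun x => cls (sval x)).
- by move=> x; exact: same_coset_refl.
- by move=> x y; exact: same_coset_sym.
- by move=> x y z; exact: same_coset_trans.
- move=> [x xI] [y yI] [z zI] [w wI] /= xy zw.
  apply: same_coset_trans (same_coset_mulr zI xI yI xy) _.
  exact: same_coset_mull.
- move=> [x xI] [y yI] [z zI] /=.
  have -> : tmul x (tmul y z) = tmul (tmul x y) z.
    by apply: functional_extensionality_dep => i; rewrite /tmul /tinv mulmxA.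
  exact: same_coset_refl.
- move=> [x xI] /=; have -> : tmul (fun=> 1%:M) x = x.
    by apply: functional_extensionality_dep => i; rewrite /tmul /tinv mul1mx.
  exact: same_coset_refl.
- move=> [x xI] /=; apply: same_coset_sym.
  have := same_coset_sql xI local_isometry1.
  have -> : tmul (tmul x x) (fun=> 1%:M) = tmul x x.
    by apply: functional_extensionality_dep => i; rewrite /tmul /tinv mulmx1.
  by [].
- by move=> [x xI] [y yI] /=; exact: clsP.
have /choice[B_ B_P] : forall a, exists B', attached (sval (f a)) B'.
  by move=> a; apply: attached_exists; exact: svalP.
exists N, B_; split=> [a|B' /genus_attached[g gI gB']].
  by apply: attached_genus (B_P a); exact: svalP.
have [a [ga aP]] := fP (exist _ g gI).
exists a; split=> [|b].
  by apply: (attached_same_coset gI (svalP (f a)) gB' (B_P a)).1.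
by move/(attached_same_coset gI (svalP (f b)) gB' (B_P b)).2 => /aP.
Qed.

End Forms.
End LocalGlobal.

(** * Completions of a principal ideal domain *)

Lemma fractionP (R : idomainType) (x : {fraction R}) :
  exists a b, b != 0 /\ x = FracField.tofrac a / FracField.tofrac b.
Proof.
elim/quotW: x => r; exists \n_r, \d_r; have dr := denom_ratioP r; split=> //.
apply: (canRL (mulfK _)); first by rewrite tofrac_eq0.
rewrite -[GRing.mul]/(@FracField.mul R) !piE /FracField.mulf.
apply/eqmodP; rewrite /= FracField.equivfE.
by rewrite !numden_Ratio ?mulf_neq0 ?oner_eq0// !mulr1 mulrC.
Qed.

Lemma fraction_extension (R : idomainType) (K : fieldType) (f : {rmorphism R -> K}) :
  injective f -> exists j : {rmorphism {fraction R} -> K},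
    forall r, j (FracField.tofrac r) = f r.
Proof.
move=> f_inj; have f0 b : b != 0 -> f b != 0.
  by apply: contra => /eqP; rewrite -(rmorph0 f) => /f_inj ->.
have F0 (b : R) : b != 0 -> FracField.tofrac b != 0 by rewrite tofrac_eq0.
have /choice[j jP] : forall x : {fraction R}, exists k, forall a b, b != 0 ->
    x = FracField.tofrac a / FracField.tofrac b -> k = f a / f b.
  move=> x; have [a [b [b0 xE]]] := fractionP x; exists (f a / f b) => c d d0.
  rewrite xE => /eqP; rewrite eqr_div ?F0// -!tofracM tofrac_eq => /eqP e.
  by apply/eqP; rewrite eqr_div ?f0// -!rmorphM e.
have jB : zmod_morphism j.
  move=> x y; have [a [b [b0 xE]]] := fractionP x; have [c [d [d0 yE]]] := fractionP y.
  rewrite (jP _ _ _ b0 xE) (jP _ _ _ d0 yE) (jP (x - y) (a * d - c * b) (b * d)).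
  - by rewrite -[- (f c / f d)]mulNr addf_div ?f0// rmorphB !rmorphM mulNr.
  - exact: mulf_neq0.
  - by rewrite xE yE -[- (_ / FracField.tofrac d)]mulNr addf_div ?F0// tofracB !tofracM mulNr.
have jM : monoid_morphism j.
  split=> [|x y].
    rewrite (jP 1 1 1) ?rmorph1 ?divr1 ?oner_eq0// tofrac1 divr1//.
  have [a [b [b0 xE]]] := fractionP x; have [c [d [d0 yE]]] := fractionP y.
  rewrite (jP _ _ _ b0 xE) (jP _ _ _ d0 yE) (jP (x * y) (a * c) (b * d)).
  - by rewrite !rmorphM mulf_div.
  - exact: mulf_neq0.
  - by rewrite xE yE !tofracM mulf_div.
pose j' : {rmorphism {fraction R} -> K} := HB.pack j
  (GRing.isZmodMorphism.Build _ _ j jB) (GRing.isMonoidMorphism.Build _ _ j jM).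
by exists j' => r; rewrite /= (jP _ r 1) ?rmorph1 ?divr1 ?oner_eq0// tofrac1 divr1.
Qed.

(** The completion is a bare commutative ring, so units and inverses are first chosen classically to
    make it an [idomainType]. *)
Lemma domain_fraction (T : comNzRingType) :
  (forall t u : T, t * u = 0 -> (t == 0) || (u == 0)) ->
  exists (K : fieldType) (o : {rmorphism T -> K}), injective o /\
    forall x, exists t u, u != 0 /\ x = o t / o u.
Proof.
move=> integral.
pose unit : {pred T} := fun t => `[< exists u, u * t = 1 >].
pose inv t := if pselect (exists u : T, u * t = 1) is left e then projT1 (cid e) else t.
have mulVr : {in unit, left_inverse 1 inv *%R}.
  move=> t /asboolP ut; rewrite /inv; case: pselect => // e.
  by case: cid.
have unitP (t u : T) : u * t = 1 -> t \in unit by move=> ut; apply/asboolP; exists u.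
have inv_out : {in [predC unit], inv =1 id}.
  by move=> t /negP nt; rewrite /inv; case: pselect => // -[u ut]; case: nt; exact: unitP ut.
pose D0 : comUnitRingType :=
  HB.pack T (GRing.ComNzRing_hasMulInverse.Build T mulVr unitP inv_out).
pose D : idomainType := HB.pack D0 (GRing.ComUnitRing_isIntegral.Build D0 integral).
pose g (x : T) : {fraction D} := FracField.tofrac (x : D).
have gB : zmod_morphism g by move=> x y; exact: (tofracB (x : D) (y : D)).
have gM : monoid_morphism g.
  by split=> [|x y]; [exact: (tofrac1 D)|exact: (tofracM (x : D) (y : D))].
pose o : {rmorphism T -> {fraction D}} := HB.pack g
  (GRing.isZmodMorphism.Build _ _ g gB) (GRing.isMonoidMorphism.Build _ _ g gM).
exists {fraction D}, o; split=> [x y /eqP|x].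
  by rewrite [_ == _](tofrac_eq (x : D) (y : D)) => /eqP.
by have [a [b [b0 xE]]] := fractionP (x : {fraction D}); exists a, b.
Qed.

Lemma idealr_of (R : nzRingType) (P : R -> Prop) :
    P 0 -> ~ P 1 -> (forall a u v, P u -> P v -> P (a * u + v)) ->
  exists J : idealr R, forall x, x \in (J : {pred R}) <-> P x.
Proof.
move=> P0 P1 PD; pose Q : {pred R} := fun x => `[< P x >].
have QP : idealr_closed Q.
  split; first exact/asboolP.
    by apply/asboolP.
  by move=> a u v /asboolP uP /asboolP vP; apply/asboolP; exact: PD.
pose J : idealr R := HB.pack Q (isIdealr.Build R Q QP).
by exists J => x; split=> /asboolP.
Qed.

(** * The completion at a nonzero principal prime *)

Section ValuedCompletion.
Local Open Scope quotient_scope.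
Variables (R : idomainType) (R_PID : is_PID R) (p : prime_idealr R) (pi : R).
Hypothesis pP : forall x, x \in (p : {pred R}) <-> exists q, x = q * pi.
Hypothesis pi_neq0 : pi != 0.
Local Notation "x %:F" := (@FracField.tofrac R x).
Local Notation S := (localization p).
Local Notation J := (loc_ideal (p := p)).
Local Notation T := (completion_at p).
Local Notation piS := (to_loc p pi).

Let tofrac_neq0 s : s \notin (p : {pred R}) -> s%:F != 0.
Proof.
by move=> sp; rewrite tofrac_eq0; apply: contra sp => /eqP->; exact: idealr0.
Qed.

(* Otherwise the quotients of [a] by the powers of [pi] generate an ideal that
   is not principal. *)
Lemma pi_valuation (a : R) : a != 0 ->
  exists k a', a' \notin (p : {pred R}) /\ a = pi ^+ k * a'.
Proof.
move=> a0; apply: contrapT => nk.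
have div k : exists b, a = pi ^+ k * b.
  elim: k => [|k [b ab]]; first by exists a; rewrite mul1r.
  have [/pP[q bq]|bp] := boolP (b \in (p : {pred R})).
    by exists q; rewrite ab bq exprSr -mulrA [q * _]mulrC.
  by case: nk; exists k, b.
have /choice[b bP] := div.
have bS k : b k = pi * b k.+1.
  apply: (mulfI (expf_neq0 k pi_neq0)); rewrite -bP mulrA -exprSr; exact: bP.
have bm k m : (k <= m)%N -> exists c, b k = c * b m.
  move/subnK <-; elim: (m - k)%N => [|d [c bc]]; first by exists 1; rewrite mul1r.
  by exists (c * pi); rewrite -mulrA addSn -bS.
have [|||I IP] := @idealr_of R (fun x => exists k c, x = c * b k).
- by exists 0%N, 0; rewrite mul0r.
- move=> [k [c]]; rewrite bS => e1.
  have : 1 \in (p : {pred R}) by apply/pP; exists (c * b k.+1); rewrite e1 mulrCA mulrC.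
  by rewrite idealr1.
- move=> x u v [k [c ->]] [m [d ->]].
  have [c' cE] := bm _ _ (leq_maxl k m); have [d' dE] := bm _ _ (leq_maxr k m).
  exists (maxn k m), (x * c * c' + d * d'); rewrite cE dE mulrDl !mulrA; congr (_ + _).
have [d dP] := R_PID I.
have /IP[k [c dE]] : d \in (I : {pred R}) by apply/dP; exists 1; rewrite mul1r.
have /dP[q bq] : b k.+1 \in (I : {pred R}) by apply/IP; exists k.+1, 1; rewrite mul1r.
have b0 : b k.+1 != 0.
  by apply: contraNneq a0 => b0; rewrite (bP k.+1) b0 mulr0.
have e1 : q * c * pi = 1.
  by apply: (mulIf b0); rewrite mul1r -mulrA -bS -mulrA -dE -bq.
have : 1 \in (p : {pred R}) by apply/pP; exists (q * c).
by rewrite idealr1.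
Qed.

Let valM (x y : S) : val (x * y) = val x * val y. Proof. exact: rmorphM. Qed.
Let val1 : val (1 : S) = 1. Proof. exact: rmorph1. Qed.
Let val0 : val (0 : S) = 0. Proof. exact: rmorph0. Qed.

Lemma locP (x : S) : exists a s, s \notin (p : {pred R}) /\ val x = a%:F / s%:F.
Proof. by have /asboolP[a [s]] := valP x; exists a, s. Qed.

Lemma loc_mk (a s : R) : s \notin (p : {pred R}) -> exists x : S, val x = a%:F / s%:F.
Proof.
move=> sp; have h : loc_pred p (a%:F / s%:F) by apply/asboolP; exists a, s.
by exists (exist _ (a%:F / s%:F) h : S).
Qed.

Lemma loc_idealP (x : S) : x \in (J : {pred S}) <-> exists y, x = piS * y.
Proof.
split=> [/asboolP[a [s [/pP[q ->] sp xE]]]|[y ->]].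
  have [y yE] := loc_mk q sp; exists y; apply: val_inj.
  by rewrite valM /= yE xE tofracM mulrA [pi%:F * _]mulrC.
have [a [s [sp yE]]] := locP y; apply/asboolP; exists (pi * a), s; split=> //.
  by apply/pP; exists a; rewrite mulrC.
by rewrite valM /= yE tofracM mulrA.
Qed.

Lemma loc_unit (x : S) : x \notin (J : {pred S}) -> exists y, x * y = 1.
Proof.
have [a [s [sp xE]]] := locP x => xJ.
have ap : a \notin (p : {pred R}).
  by apply: contra xJ => ap; apply/asboolP; exists a, s.
have [y yE] := loc_mk s ap; exists y; apply: val_inj.
rewrite valM yE xE val1 mulf_div [s%:F * _]mulrC divff//.
by rewrite mulf_neq0 ?tofrac_neq0.
Qed.

Lemma loc_mulI (x y z : S) : x != 0 -> x * y = x * z -> y = z.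
Proof.
move=> x0 /(congr1 val); rewrite !valM => /mulfI e; apply/val_inj/e.
by apply: contra x0 => /eqP x0; apply/eqP/val_inj; rewrite x0 val0.
Qed.

Lemma piS_neq0 k : piS ^+ k != 0.
Proof.
apply: contra pi_neq0 => /eqP/(congr1 val); rewrite val0 rmorphXn /= => /eqP.
by rewrite expf_eq0 tofrac_eq0 => /andP[].
Qed.

Lemma loc_ideal_expP n (x : S) : ideal_exp (J : idealr S) n x <-> exists y, x = piS ^+ n * y.
Proof.
elim: n x => [|n IH] x /=; first by split=> // _; exists x; rewrite mul1r.
split=> [[s sP ->]|[y ->]].
  elim: s sP => [|u s IHs] sP; first by exists 0; rewrite big_nil mulr0.
  have [|y yE] := IHs; first by move=> v vs; apply: sP; rewrite inE vs orbT.
  have [/loc_idealP[z zE] /IH[w wE]] := sP u (mem_head _ _).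
  exists (z * w + y); rewrite big_cons yE zE wE exprS mulrDr; congr (_ + _).
  by rewrite -!mulrA; congr (_ * _); rewrite mulrCA.
exists [:: (piS, piS ^+ n * y)]; last by rewrite big_seq1 exprS mulrA.
move=> u; rewrite inE => /eqP -> /=; split; last by apply/IH; exists y.
by apply/loc_idealP; exists 1; rewrite mulr1.
Qed.

(** Replaces computation in the quotient by termwise computation with sequences. *)
Definition represents (x : nat -> S) (t : T) : Prop :=
  exists2 c : coherent_seq J, val c = x & t = \pi_({ideal_quot null_seq (J := J)}) c.

Lemma representsP t : exists x, represents x t.
Proof. by exists (val (repr t)), (repr t) => //; rewrite reprK. Qed.

Lemma represents_coherent x t : represents x t ->
  forall n m, (n <= m)%N -> exists y, x m - x n = piS ^+ n * y.
Proof.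
by move=> [c <- _] n m nm; apply/loc_ideal_expP; have /asboolP := valP c; apply.
Qed.

Lemma represents_mk x :
  (forall n m, (n <= m)%N -> exists y, x m - x n = piS ^+ n * y) ->
  exists t, represents x t.
Proof.
move=> xP; have h : coherent J x.
  by apply/asboolP => n m nm; apply/loc_ideal_expP; exact: xP.
by exists (\pi_({ideal_quot null_seq (J := J)}) (exist _ x h : coherent_seq J)), (exist _ x h).
Qed.

Lemma represents_eq x y t u : represents x t -> represents y u ->
  (forall n, exists z, x n - y n = piS ^+ n * z) <-> t = u.
Proof.
move=> [c <- ->] [d <- ->]; split=> [xy|/eqP].
  apply/eqP; rewrite -Quotient.idealrBE; apply/asboolP => n.
  by apply/loc_ideal_expP; exact: xy.
rewrite -Quotient.idealrBE => /asboolP cd n; apply/loc_ideal_expP; exact: cd.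
Qed.

Lemma representsD x y t u : represents x t -> represents y u ->
  represents (fun n => x n + y n) (t + u).
Proof. by move=> [c <- ->] [d <- ->]; exists (c + d) => //; rewrite rmorphD. Qed.

Lemma representsM x y t u : represents x t -> represents y u ->
  represents (fun n => x n * y n) (t * u).
Proof. by move=> [c <- ->] [d <- ->]; exists (c * d) => //; rewrite rmorphM. Qed.

Lemma represents_compl s : represents (fun=> s) (to_compl J s).
Proof. by exists (exist _ (fun=> s) (to_compl_subproof J s)). Qed.

Lemma represents1 : represents (fun=> 1) 1.
Proof. by rewrite -(rmorph1 (to_compl J)); exact: represents_compl. Qed.

Local Notation piT := (to_completion_at p pi).

Lemma represents_unit x t : represents x t -> x 1%N \notin (J : {pred S}) ->
  exists u, t * u = 1.
Proof.
(* Coherence modulo J^0 says nothing about [x 0]. From index 1 on, all terms are congruent modulo J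
   and hence units, so the inverse sequence is shifted by one. *)
move=> xt x1; have /choice[y yP] : forall n, exists y, x n.+1 * y = 1.
  move=> n; apply: loc_unit; apply: contra x1 => xn.
  have [z zE] := represents_coherent xt (ltn0Sn n : (1 <= n.+1)%N).
  have -> : x 1%N = x n.+1 - (x n.+1 - x 1%N) by rewrite opprB addrC subrK.
  by rewrite rpredB// zE expr1; apply/loc_idealP; exists z.
have [|u yu] := @represents_mk y.
  move=> n m nm; have [z zE] := represents_coherent xt (nm : (n.+1 <= m.+1)%N).
  exists (- (piS * y m * y n * z)).
  have -> : y m - y n = - ((x m.+1 - x n.+1) * (y m * y n)).
    by rewrite mulrBl mulrA yP mul1r (mulrC (y m)) mulrA yP mul1r opprB.
  by rewrite zE exprS; ring.
exists u; apply/(represents_eq (representsM xt yu) represents1) => n.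
have [z zE] := represents_coherent xt (leqnSn n).
exists (- z * y n); rewrite -(yP n) -mulrBl -opprB zE mulrA mulrN//.
Qed.

(** Division by pi loses one step of precision, whence the shift from n.+1 to n. *)
Lemma represents_div x t : represents x t -> x 1%N \in (J : {pred S}) ->
  exists t' y, [/\ represents y t', t = piT * t' & forall n, x n.+1 = piS * y n].
Proof.
move=> xt x1; have /choice[y yP] : forall n, exists y, x n.+1 = piS * y.
  move=> n; apply/loc_idealP.
  have [z zE] := represents_coherent xt (ltn0Sn n : (1 <= n.+1)%N).
  have -> : x n.+1 = (x n.+1 - x 1%N) + x 1%N by rewrite subrK.
  by rewrite rpredD// zE expr1; apply/loc_idealP; exists z.
have [|t' yt'] := @represents_mk y.
  move=> n m nm; have [z zE] := represents_coherent xt (nm : (n.+1 <= m.+1)%N).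
  exists z; apply: (loc_mulI (piS_neq0 1)).
  by rewrite expr1 mulrBr -!yP zE exprS mulrA.
exists t', y; split=> //.
apply/(represents_eq xt (representsM (represents_compl piS) yt')) => n.
have [z zE] := represents_coherent xt (leqnSn n).
by exists (- z); rewrite -yP -opprB zE mulrN.
Qed.

Lemma completion_piI t : piT * t = 0 -> t = 0.
Proof.
have [x xt] := representsP t.
have x0 : represents (fun=> 0) 0.
  by rewrite -[X in represents _ X](rmorph0 (to_compl J)); exact: represents_compl.
move/(represents_eq (representsM (represents_compl piS) xt) x0) => px.
apply/(represents_eq xt x0) => n; have [z zE] := represents_coherent xt (leqnSn n).
have [w wE] := px n.+1; exists (w - z).
have xw : x n.+1 = piS ^+ n * w.
  by apply: (loc_mulI (piS_neq0 1)); rewrite expr1 mulrA -exprS -wE subr0.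
by rewrite mulrBr -zE -xw subr0 opprB addrC subrK.
Qed.

Lemma completion_piXI k t : piT ^+ k * t = 0 -> t = 0.
Proof.
by elim: k => [|k IH]; [rewrite mul1r|rewrite exprS -mulrA => /completion_piI].
Qed.

(** Some term x n is outside J^n. Induction on n: either x 1 is a unit, and so is t, or t is
    divisible by pi and the quotient has such a term at a smaller index. *)
Lemma completion_factor t : t != 0 ->
  exists m u u', t = piT ^+ m * u /\ u * u' = 1.
Proof.
move=> t0; have [x xt] := representsP t.
have x0 : represents (fun=> 0) 0.
  by rewrite -[X in represents _ X](rmorph0 (to_compl J)); exact: represents_compl.
have [n xn] : exists n, ~ exists z, x n = piS ^+ n * z.
  apply: contrapT => /forallNP xz; case/eqP: t0; apply/(represents_eq xt x0) => n.
  by rewrite subr0; apply: contrapT; exact: xz.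
elim: n t x xt xn {t0} => [|n IH] t x xt xn.
  by case: xn; exists (x 0%N); rewrite mul1r.
have [x1|x1] := boolP (x 1%N \in (J : {pred S})); last first.
  by have [u tu] := represents_unit xt x1; exists 0%N, t, u; rewrite mul1r.
have [t' [y [yt' -> xy]]] := represents_div xt x1.
have [|m [u [u' [-> uu']]]] := IH _ _ yt'.
  by move=> [z yz]; apply: xn; exists z; rewrite xy yz exprS mulrA.
by exists m.+1, u, u'; rewrite exprS mulrA.
Qed.

Lemma completion_integral (t u : T) : t * u = 0 -> (t == 0) || (u == 0).
Proof.
move=> tu; apply/norP => -[/completion_factor[m [v [v' [tE vv']]]]].
move=> /completion_factor[k [w [w' [uE ww']]]].
have : piT ^+ (m + k) * (v * w) = 0 by rewrite exprD mulrACA -tE -uE.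
move=> /completion_piXI/(congr1 ( *%R^~ (v' * w'))); rewrite mulrACA vv' ww' mul0r mulr1.
by move/eqP; rewrite oner_eq0.
Qed.

Lemma completion_1piD t : exists t', (1 + piT * t) * t' = 1.
Proof.
have [x xt] := representsP t.
apply: represents_unit (representsD represents1 (representsM (represents_compl piS) xt)) _.
apply/negP => h; have : (1 : S) \in (J : {pred S}).
  rewrite -[1](addrK (piS * x 1%N)) rpredB//; apply/loc_idealP; by exists (x 1%N).
by rewrite idealr1.
Qed.

(** Successive digits: a remainder t' minus its term x 1 is divisible by pi. *)
Lemma completion_approx n t : exists s t', t = to_compl J s + piT ^+ n * t'.
Proof.
elim: n t => [|n IH] t; first by exists 0, t; rewrite rmorph0 add0r mul1r.
have [s [t' ->]] := IH t; have [x xt] := representsP t'.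
have [||t'' [y [_ t'E _]]] := @represents_div (fun n => x n - x 1%N) (t' - to_compl J (x 1%N)).
- have := representsD xt (represents_compl (- x 1%N)); by rewrite rmorphN.
- by rewrite subrr idealr0.
exists (s + piS ^+ n * x 1%N), t''; rewrite rmorphD rmorphM rmorphXn /=.
rewrite exprSr -(mulrA _ piT) -t'E mulrBr !addrA.
by rewrite addrAC addrK.
Qed.

Lemma completion_pi_ideal r t : to_completion_at p r = piT * t -> r \in (p : {pred R}).
Proof.
have [x xt] := representsP t.
move/(represents_eq (represents_compl (to_loc p r)) (representsM (represents_compl piS) xt)).
move=> /(_ 1%N)[z]; rewrite expr1 => rz.
have : to_loc p r \in (J : {pred S}).
  apply/loc_idealP; exists (z + x 1%N); rewrite mulrDr -rz subrK//.
move=> /asboolP[a [s [/pP[q ->] sp]]] /= /(congr1 ( *%R^~ s%:F)).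
rewrite divfK ?tofrac_neq0// -tofracM => /eqP; rewrite tofrac_eq => /eqP rs.
have : r * s \in (p : {pred R}) by apply/pP; exists q.
by rewrite prime_idealrM (negPf sp) orbF.
Qed.

Lemma completion_valued_field :
  exists (K : fieldType) (o : {rmorphism T -> K}) (j : {rmorphism {fraction R} -> K}),
  [/\ injective o, forall r, o (to_completion_at p r) = j r%:F,
      forall x, exists m t, o (piT ^+ m) * x = o t,
      forall x m, exists r t, x - j r = o (piT ^+ m * t)
    & forall r t, j r = o t -> exists a s, s \notin (p : {pred R}) /\ r = a%:F / s%:F].
Proof.
have [K [o [o_inj oP]]] := domain_fraction completion_integral.
have iT0 r : to_completion_at p r = 0 -> r = 0.
  move=> r0; apply/eqP; apply: contraT => /pi_valuation[k [a [ap rE]]].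
  move: r0; rewrite rE rmorphM rmorphXn /= => /completion_piXI a0.
  by case/negP: ap; apply: (@completion_pi_ideal _ 0); rewrite a0 mulr0.
have iT_inj : injective (o \o to_completion_at p).
  by move=> r s /o_inj/eqP; rewrite -subr_eq0 -rmorphB => /eqP/iT0/eqP; rewrite subr_eq0 => /eqP.
have [j jE] := fraction_extension iT_inj.
have oT r : o (to_completion_at p r) = j r%:F by rewrite jE.
have o0 t : t != 0 -> o t != 0.
  by apply: contra => /eqP; rewrite -(rmorph0 o) => /o_inj ->.
have piT0 m : o (piT ^+ m) != 0.
  by rewrite rmorphXn expf_neq0// o0//; apply: contra pi_neq0 => /eqP/iT0 ->.
have oS (s : S) : o (to_compl J s) = j (val s).
  have [a [b [bp sE]]] := locP s.
  have b0 : j b%:F != 0 by rewrite fmorph_eq0 tofrac_neq0.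
  apply: (mulIf b0); rewrite -[RHS]rmorphM sE divfK ?tofrac_neq0// -!oT -rmorphM.
  congr (o _); rewrite -rmorphM; congr (to_compl J _); apply: val_inj.
  by rewrite valM sE /= divfK ?tofrac_neq0.
have den x : exists m t, o (piT ^+ m) * x = o t.
  have [t [u [u0 ->]]] := oP x; have [m [v [v' [uE vv']]]] := completion_factor u0.
  exists m, (t * v'); have v0 : o v != 0.
    by apply: o0; apply: contraNneq u0 => v0; rewrite uE v0 mulr0.
  rewrite uE !rmorphM invfM [o t * _]mulrCA mulVKf ?piT0//; congr (_ * _).
  apply: (mulfI v0); rewrite mulfV// -rmorphM vv' rmorph1//.
exists K, o, j; split=> // [x m|r t].
  (* After multiplication by pi^k, x is integral; precision m + k leaves m after dividing back. *)
  have [k [t xt]] := den x; have [s [t' tE]] := completion_approx (m + k) t.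
  have pk : (pi ^+ k)%:F != 0 by rewrite tofrac_eq0 expf_neq0.
  exists (val s / (pi ^+ k)%:F), t'; apply: (mulfI (piT0 k)).
  rewrite mulrBr xt tE rmorphD oS exprD -rmorphM mulrA.
  rewrite [piT ^+ k * _]mulrC -[piT ^+ k](rmorphXn (to_completion_at p)) oT -rmorphM.
  by rewrite mulrCA divff// mulr1 addrC addKr.
have [a [b [b0 rE]]] := fractionP r => jr.
have [a0|a0] := eqVneq a 0.
  exists 0, 1; rewrite idealr1; split=> //.
  by rewrite rE a0 tofrac0 !mul0r.
have [k [a' [ap aE]]] := pi_valuation a0; have [m [b' [bp bE]]] := pi_valuation b0.
have tab : to_completion_at p a = t * to_completion_at p b.
  apply: o_inj; rewrite rmorphM !oT -jr -rmorphM rE divfK// tofrac_eq0//.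
(* If b has the smaller or equal valuation, pi^m cancels. Otherwise a' would be a multiple of pi in
   the completion, so it would lie in p. *)
have [mk|km] := leqP m k.
  exists (pi ^+ (k - m) * a'), b'; split=> //; rewrite rE aE bE.
  have -> : pi ^+ k = pi ^+ (k - m) * pi ^+ m by rewrite -exprD subnK.
  have b1 : (pi ^+ m * b')%:F != 0 by rewrite -bE tofrac_eq0.
  apply/eqP; rewrite (eqr_div _ _ b1 (tofrac_neq0 bp)) -!tofracM tofrac_eq.
  by apply/eqP; ring.
case/negP: ap; apply: (@completion_pi_ideal _ (t * piT ^+ (m - k).-1 * to_completion_at p b')).
apply/eqP; rewrite -subr_eq0; apply/eqP/(@completion_piXI k).
rewrite mulrBr; apply/eqP; rewrite subr_eq0; apply/eqP.
transitivity (to_completion_at p a); first by rewrite aE rmorphM rmorphXn.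
rewrite tab bE rmorphM rmorphXn /=.
rewrite -{1}(subnK (ltnW km)) exprD -{1}(prednK (_ : 0 < m - k)%N) ?subn_gt0// exprS.
by ring.
Qed.

End ValuedCompletion.

(** * Comaximal elements and simultaneous approximation *)

Definition comaximal (R : comNzRingType) (a b : R) : Prop :=
  exists u v, u * a + v * b = 1.

Lemma comaximal1 (R : comNzRingType) (a : R) : comaximal a 1.
Proof. by exists 0, 1; rewrite mul0r add0r mulr1. Qed.

Lemma comaximal_sym (R : comNzRingType) (a b : R) : comaximal a b -> comaximal b a.
Proof. by move=> [u [v e]]; exists v, u; rewrite addrC. Qed.

Lemma comaximalM (R : comNzRingType) (a b c : R) :
  comaximal a b -> comaximal a c -> comaximal a (b * c).
Proof.
move=> [u [v e]] [x [y f]]; exists (u * (x * a + y * c) + v * b * x), (v * y).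
by rewrite f mulr1 -[1 in RHS]e -[v * b in RHS]mulr1 -f; ring.
Qed.

Lemma comaximalX (R : comNzRingType) (a b : R) m k :
  comaximal a b -> comaximal (a ^+ m) (b ^+ k).
Proof.
have X (x y : R) n : comaximal x y -> comaximal x (y ^+ n).
  move=> xy; elim: n => [|n IH]; first exact: comaximal1.
  by rewrite exprS; apply: comaximalM.
by move=> ab; apply/X/comaximal_sym/X/comaximal_sym.
Qed.

(** The elements e are idempotent and orthogonal only modulo the powers pi k ^+ M. *)
Lemma orthogonal_idempotents (R : comNzRingType) (S : finType) (pi : S -> R) M :
    (forall i k, i != k -> comaximal (pi i) (pi k)) ->
  forall i, exists e, (exists a, 1 - e = pi i ^+ M * a) /\
    forall k, k != i -> exists b, e = pi k ^+ M * b.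
Proof.
move=> pico i.
have : comaximal (pi i ^+ M) (\prod_(k | k != i) pi k ^+ M).
  apply: (big_ind (comaximal (pi i ^+ M))) => [||k ki]; first exact: comaximal1.
    by move=> x y; exact: comaximalM.
  by apply/comaximalX/pico; rewrite eq_sym.
case=> u [v e1]; exists (v * \prod_(k | k != i) pi k ^+ M); split.
  by exists u; apply: (canLR (addrK _)); rewrite [_ * u]mulrC e1.
by move=> k ki; rewrite (bigD1 k)//= mulrCA; eexists.
Qed.

(** The approximation r i of x i may have poles at the other primes; multiplication by e i removes
    them and hardly changes r i at i. *)
Lemma chinese_approximation (R F : comNzRingType) (iF : {rmorphism R -> F})
    (S : finType) (T : S -> comNzRingType) (K : S -> comNzRingType)
    (iT : forall i, {rmorphism R -> T i}) (o : forall i, {rmorphism T i -> K i})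
    (j : forall i, {rmorphism F -> K i}) (pi : S -> R) :
    (forall i r, o i (iT i r) = j i (iF r)) ->
    (forall i k, i != k -> comaximal (pi i) (pi k)) ->
    (forall i (x : K i), exists m t, o i (iT i (pi i) ^+ m) * x = o i t) ->
    (forall i (x : K i) m, exists r t, x - j i r = o i (iT i (pi i) ^+ m * t)) ->
  forall (x : forall i, K i) m,
    exists r, forall i, exists t, x i - j i r = o i (iT i (pi i) ^+ m * t).
Proof.
move=> oT pico den approx x m.
have /choice[r rP] : forall i, exists r, exists t,
    x i - j i r = o i (iT i (pi i) ^+ m * t) by move=> i; exact: approx.
have /choice[d dP] : forall ik : S * S, exists d, exists t,
    o ik.1 (iT ik.1 (pi ik.1) ^+ d) * j ik.1 (r ik.2) = o ik.1 t.
  by move=> [i k]; exact: den.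
(* Precision m, plus the worst denominator of any r k at any i. *)
pose M := (m + \max_ik d ik)%N.
have /choice[e eP] := orthogonal_idempotents M pico.
have small i k c : exists t, j i (iF (pi i ^+ M * c) * r k) = o i (iT i (pi i) ^+ m * t).
  have [t tE] := dP (i, k); rewrite /= in tE.
  exists (iT i (pi i) ^+ (M - m - d (i, k)) * iT i c * t).
  rewrite [in RHS]rmorphM [in RHS]rmorphM -tE rmorphM -oT.
  have ME : M = (m + ((M - m - d (i, k)) + d (i, k)))%N.
    by rewrite subnK /M ?addKn//; exact: (leq_bigmax (i, k)).
  rewrite {1}ME !rmorphM !rmorphXn /= !exprD; ring.
exists (\sum_k iF (e k) * r k) => i.
have [[a aE] bP] := eP i; have [t1 t1E] := rP i; have [t2 t2E] := small i i a.
have /choice[t3 t3E] : forall k, exists t, k != i ->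
    j i (iF (e k) * r k) = o i (iT i (pi i) ^+ m * t).
  move=> k; have [->|ki] := eqVneq k i; first by exists 0.
  have [_ /(_ i)] := eP k; rewrite eq_sym ki => /(_ isT)[b ->].
  by have [t tE] := small i k b; exists t.
exists (t1 + t2 - \sum_(k | k != i) t3 k).
rewrite (bigD1 i)//= rmorphD opprD addrA mulrBr mulrDr rmorphB rmorphD -t1E -t2E -aE.
rewrite mulr_sumr !rmorph_sum /=; congr (_ - _); last exact: eq_bigr.
by rewrite rmorphB rmorph1 mulrBl mul1r rmorphB addrA subrK.
Qed.

(** * Maximal and prime ideals *)

Lemma maximal_above (R : comNzRingType) (D : idealr R) :
  exists2 J : idealr R, maximal_ideal J & {subset (D : {pred R}) <= (J : {pred R})}.
Proof.
pose ideal_above (A : set R) := [/\ A 0, ~ A 1,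
  forall a u v, A u -> A v -> A (a * u + v) & forall u, u \in (D : {pred R}) -> A u].
have DP : ideal_above (fun u => u \in (D : {pred R})).
  split=> //; [exact: idealr0|by rewrite idealr1|].
  by move=> a u v uD vD; rewrite rpredD ?idealMr.
have [|A [[A0|AP] Amax]] := @Zorn_bigcup R (fun A => A = set0 \/ ideal_above A).
- move=> F FP Ftot; have [[A [FA AP]]|nA] := pselect (exists A, F A /\ ideal_above A); last first.
    left; apply/seteqP; split=> // u [B FB Bu]; case: (FP B FB) => [B0|BP].
      by rewrite B0 in Bu.
    by case: nA; exists B.
  right; have ideal B u : F B -> B u -> ideal_above B.
    by move=> FB Bu; case: (FP B FB) => // B0; rewrite B0 in Bu.
  split.
  + by exists A => //; case: AP.
  + by move=> [B FB B1]; case: (ideal _ _ FB B1).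
  + move=> a u v [B FB Bu] [C FC Cv].
    have [BC|CB] := Ftot B C FB FC.
      by exists C => //; case: (ideal _ _ FC Cv) => _ _ + _; apply=> //; exact: BC.
    by exists B => //; case: (ideal _ _ FB Bu) => _ _ + _; apply=> //; exact: CB.
  + by move=> u uD; exists A => //; case: AP => _ _ _; apply.
- case: (Amax (fun u => u \in (D : {pred R}))); last by right.
  by rewrite A0; split=> // /(_ 0); apply; exact: idealr0.
have [A0 A1 AM AD] := AP; have [|||J JP] := @idealr_of R A => //.
exists J => [J' JJ' u uJ'|u /AD/JP//]; apply/JP; apply: contrapT => nAu.
case: (Amax (fun u => u \in (J' : {pred R}))).
  by split=> [x /JP/JJ'//|h]; apply: nAu; exact: h.
right; split=> [|||x /AD/JP/JJ'//]; [exact: idealr0|by rewrite idealr1|].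
by move=> a x y xD yD; rewrite rpredD ?idealMr.
Qed.

Lemma maximal_comaximal (R : comNzRingType) (J : idealr R) (b : R) :
  maximal_ideal J -> b \notin (J : {pred R}) ->
  exists x c, x \in (J : {pred R}) /\ x + c * b = 1.
Proof.
move=> Jmax bJ; apply: contrapT => n1.
have [|||J' J'P] := @idealr_of R (fun u => exists x c, x \in (J : {pred R}) /\ x + c * b = u).
- by exists 0, 0; rewrite idealr0 mul0r addr0.
- exact: n1.
- move=> a u v [x [c [xJ <-]]] [y [d [yJ <-]]].
  by exists (a * x + y), (a * c + d); rewrite rpredD ?idealMr//; split=> //; ring.
case/negP: bJ; apply: (Jmax J'); last first.
  by apply/J'P; exists 0, 1; rewrite idealr0 mul1r add0r.
by move=> x xJ; apply/J'P; exists x, 0; rewrite mul0r addr0.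
Qed.

Lemma prime_idealr_of (R : nzRingType) (J : idealr R) :
  prime_idealr_closed (J : {pred R}) ->
  exists p : prime_idealr R, (p : {pred R}) =i (J : {pred R}).
Proof.
move=> JP; pose p : prime_idealr R := HB.pack (J : R -> bool)
  (Idealr.on (J : R -> bool)) (isPrimeIdealrClosed.Build R (J : R -> bool) JP).
by exists p.
Qed.

Lemma maximal_prime (R : comNzRingType) (J : idealr R) : maximal_ideal J ->
  exists p : prime_idealr R, (p : {pred R}) =i (J : {pred R}).
Proof.
move=> Jmax; apply: prime_idealr_of => a b ab; apply/orP.
have [aJ|aJ] := boolP (a \in (J : {pred R})); [by left|right].
have [x [c [xJ e1]]] := maximal_comaximal Jmax aJ.
have -> : b = b * x + c * (a * b) by rewrite -[LHS]mulr1 -e1; ring.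
by apply: rpredD; apply: idealMr.
Qed.

(** [completion_at] depends on the prime as a structure, so equality of the sets must become
    equality of the structures. *)
Lemma prime_idealr_eq (R : comNzRingType) (p q : prime_idealr R) :
  (p : {pred R}) =i (q : {pred R}) -> p = q.
Proof.
move=> pq; have {pq} : (p : R -> bool) = (q : R -> bool) by apply/funext => x; exact: pq.
case: p q => [P [[P1] [P2] [P3] [P4]]] [Q [[Q1] [Q2] [Q3] [Q4]]] /= PQ.
subst Q.
by rewrite (Prop_irrelevance P1 Q1) (Prop_irrelevance P2 Q2)
  (Prop_irrelevance P3 Q3) (Prop_irrelevance P4 Q4).
Qed.

Section SemilocalPID.
Variables (R : idomainType) (R_PID : is_PID R) (R_semilocal : semilocal R).
Hypothesis F_neq_R : exists x : {fraction R}, forall r : R, x <> FracField.tofrac r.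
Local Notation "x %:F" := (@FracField.tofrac R x).

Lemma principal_prime (p : prime_idealr R) :
  exists d, forall x, x \in (p : {pred R}) <-> exists q, x = q * d.
Proof. exact: R_PID (p : idealr R). Qed.

(** Nonzero primes of a principal ideal domain are maximal, so they occur in the finite list given
    by semilocality. *)
Lemma finite_nonzero_primes :
  exists (S : finType) (s0 : S) (p : S -> prime_idealr R) (pi : S -> R),
  [/\ forall i x, x \in (p i : {pred R}) <-> exists q, x = q * pi i,
      forall i, pi i != 0, forall i k, i != k -> comaximal (pi i) (pi k),
      forall (D : idealr R) d, d \in (D : {pred R}) -> d != 0 ->
        exists i, {subset (D : {pred R}) <= (p i : {pred R})}
    & forall (q : prime_idealr R) d, d \in (q : {pred R}) -> d != 0 -> exists i, q = p i].
Proof.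
have [n [m mP]] := R_semilocal.
(* The list may contain repetitions, the zero ideal and ideals that are not maximal; only first
   occurrences of nonzero maximal ideals are kept. *)
pose good (i : 'I_n) := [/\ maximal_ideal (m i),
  exists2 d, d \in (m i : {pred R}) & d != 0
  & forall k : 'I_n, (k < i)%N -> ~ (m k : {pred R}) =i (m i : {pred R})].
pose S := {i : 'I_n | `[< good i >]}.
have Sgood (i : S) : good (val i) by apply/asboolP/(valP i).
have /choice[p pP] : forall i : S, exists p : prime_idealr R,
    (p : {pred R}) =i (m (val i) : {pred R}).
  by move=> i; case: (Sgood i) => mi _ _; exact: maximal_prime.
have /choice[pi piP] := fun i => principal_prime (p i).
have pi0 i : pi i != 0.
  have [_ [d dm d0] _] := Sgood i; apply: contra d0 => /eqP pi0.
  by move: dm; rewrite -pP => /piP[q ->]; rewrite pi0 mulr0.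
have above (D : idealr R) d : d \in (D : {pred R}) -> d != 0 ->
    exists i, {subset (D : {pred R}) <= (p i : {pred R})}.
  move=> dD d0; have [J Jmax DJ] := maximal_above D; have [i0 Ji0] := mP J Jmax.
  pose Q k := `[< exists2 l : 'I_n, (l : nat) = k & (J : {pred R}) =i (m l : {pred R}) >].
  have exQ : exists k, Q k by exists i0; apply/asboolP; exists i0.
  case: (ex_minnP exQ) => k /asboolP[i ik Ji] kmin.
  have gi : good i.
    split.
    - move=> J' sub u uJ'; rewrite -Ji; apply: (Jmax J') => // v vJ.
      by apply: sub; rewrite -Ji.
    - by exists d => //; rewrite -Ji; exact: DJ.
    - move=> l li lE; have : Q l by apply/asboolP; exists l => // x; rewrite Ji lE.
      by move=> /kmin; rewrite -ik leqNgt li.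
  exists (exist _ i (introT (asboolP _) gi) : S) => u uD; rewrite pP /= -Ji; exact: DJ.
(* The denominator of a fraction outside R is a nonzero nonunit, so some prime of the list contains
   it. *)
have [s0 _] : exists i : S, True.
  have [x xR] := F_neq_R; have [a [b [b0 xE]]] := fractionP x.
  have [|||D DP] := @idealr_of R (fun u => exists q, u = q * b).
  - by exists 0; rewrite mul0r.
  - move=> [q e1]; apply: (xR (a * q)).
    have bF : b%:F != 0 by rewrite tofrac_eq0.
    by rewrite xE; apply: (canLR (mulfK bF)); rewrite -tofracM -mulrA -e1 mulr1.
  - by move=> c u v [q ->] [r ->]; exists (c * q + r); ring.
  have [|i _] := above D b _ b0; first by apply/DP; exists 1; rewrite mul1r.
  by exists i.
have maxp (i : S) (J : idealr R) : {subset (p i : {pred R}) <= (J : {pred R})} ->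
    {subset (J : {pred R}) <= (p i : {pred R})}.
  move=> sub u uJ; rewrite pP; have [mi _ _] := Sgood i; apply: (mi J) => // v vm.
  by apply: sub; rewrite pP.
exists S, s0, p, pi; split=> // [i k ik|q d dq d0].
  have nk : pi k \notin (m (val i) : {pred R}).
    apply/negP => km; have ki : {subset (p k : {pred R}) <= (p i : {pred R})}.
      by move=> u /piP[c ->]; rewrite pP idealMr.
    have pE : (p k : {pred R}) =i (p i : {pred R}).
      by move=> u; apply/idP/idP; [exact: ki|exact: (maxp k (p i : idealr R) ki)].
    have mE : (m (val k) : {pred R}) =i (m (val i) : {pred R}).
      by move=> u; rewrite -!pP pE.
    have [_ _ ni] := Sgood i; have [_ _ nk] := Sgood k.
    case: (ltngtP (val i) (val k)) => [lt|lt|/val_inj/val_inj e].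
    - by apply: (nk _ lt) => u; rewrite mE.
    - exact: (ni _ lt).
    - by rewrite e eqxx in ik.
  have [mi _ _] := Sgood i.
  have [x [c []]] := maximal_comaximal mi nk.
  by rewrite -pP => /piP[r ->] e1; exists r, c.
(* The generator w of q is c times pi i. If c were in q, pi i would be a unit; hence pi i lies in
   q. *)
have [i qi] := above (q : idealr R) d dq d0; exists i; apply: prime_idealr_eq => u.
apply/idP/idP; first exact: qi.
have [w wP] := principal_prime q.
have /qi/piP[c wE] : w \in (q : {pred R}) by apply/wP; exists 1; rewrite mul1r.
have w0 : w != 0 by apply: contra d0 => /eqP w0; have /wP[r ->] := dq; rewrite w0 mulr0.
have : c * pi i \in (q : {pred R}) by apply/wP; exists 1; rewrite mul1r.
rewrite prime_idealrM => /orP[/wP[r cE]|piq].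
  have e1 : r * pi i = 1 by apply: (mulIf w0); rewrite mul1r [RHS]wE cE; ring.
  have : 1 \in (p i : {pred R}) by apply/piP; exists r.
  by rewrite idealr1.
by move=> /piP[r ->]; rewrite idealMr.
Qed.

End SemilocalPID.
(** * Systems of forms in coordinates *)

(** The first coordinates form an ideal generated by some d. A vector x0 attaining d is added to a
    basis of the vectors with first coordinate 0, unless d = 0. *)
Lemma PID_submodule_basis (R : idomainType) n (M : 'rV[R]_n -> Prop) : is_PID R ->
    M 0 -> (forall a x y, M x -> M y -> M (a *: x + y)) ->
  exists r (b : 'M[R]_(r, n)),
    (forall x, M x <-> exists c, x = c *m b) /\ forall c : 'rV[R]_r, c *m b = 0 -> c = 0.
Proof.
move=> R_PID; elim: n M => [|n IH].
  move=> M M0 ML.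
  exists 0%N, 0; split=> [x|c _]; last exact: thinmx0.
  by split=> _; [exists 0; rewrite (thinmx0 x) (thinmx0 (_ *m _))|rewrite (thinmx0 x)].
rewrite -[n.+1]/(1 + n)%N => M M0 ML.
have MB x y : M x -> M y -> M (x - y).
  by move=> Mx My; rewrite addrC -scaleN1r; apply: ML.
have MZ a x : M x -> M (a *: x) by move=> Mx; rewrite -[_ *: _]addr0; apply: ML.
have MD x y : M x -> M y -> M (x + y) by move=> Mx My; rewrite -[x]scale1r; apply: ML.
have [d [x0 [Mx0 x0d dP]]] : exists d x0, [/\ M x0, x0 0 0 = d
    & forall x, M x -> exists q, x 0 0 = q * d].
  (* An [idealr] is proper, so the unit ideal of first coordinates is treated apart. *)
  have [[x Mx x1]|n1] := pselect (exists2 x, M x & x 0 0 = 1).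
    by exists 1, x; split=> // y _; exists (y 0 0); rewrite mulr1.
  have [|||I IP] := @idealr_of R (fun u => exists2 x, M x & x 0 0 = u).
  - by exists 0 => //; rewrite mxE.
  - exact: n1.
  - move=> a u v [x Mx <-] [y My <-]; exists (a *: x + y); first exact: ML.
    by rewrite !mxE.
  have [d dP] := R_PID I.
  have /IP[x0 Mx0 x0d] : d \in (I : {pred R}) by apply/dP; exists 1; rewrite mul1r.
  by exists d, x0; split=> // x Mx; apply/dP/IP; exists x.
have [|a x y Mx My|r [b [bP bfree]]] := IH (fun y => M (row_mx 0 y : 'rV_(1 + n))).
- by rewrite row_mx0.
- have -> : row_mx 0 (a *: x + y) = a *: (row_mx 0 x : 'rV_(1 + n)) + row_mx 0 y.
    by rewrite scale_row_mx add_row_mx scaler0 addr0.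
  exact: ML.
have split0 (x : 'rV[R]_(1 + n)) : x 0 0 = 0 -> x = row_mx 0 (rsubmx x).
  move=> x00; rewrite -{1}(hsubmxK x); congr row_mx; apply/rowP => i.
  by rewrite !mxE ord1 -[RHS]x00; congr (x _ _); apply: val_inj.
have first (c : 'rV[R]_r) : (row_mx 0 (c *m b) : 'rV[R]_(1 + n)) =
    c *m (row_mx 0 b : 'M_(r, 1 + n)).
  by rewrite mul_mx_row mulmx0.
have [d0|d0] := eqVneq d 0.
  exists r, (row_mx 0 b : 'M_(r, 1 + n)); split=> [x|c].
    split=> [Mx|[c ->]]; last by rewrite -first; apply/bP; exists c.
    have x00 : x 0 0 = 0 by have [q ->] := dP x Mx; rewrite d0 mulr0.
    have /bP[c cE] : M (row_mx 0 (rsubmx (x : 'rV_(1 + n)))) by rewrite -split0.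
    by exists c; rewrite -first -cE; apply: split0.
  rewrite -first => /eqP; rewrite -[0 in X in _ == X](row_mx0 _ _ 1 n) => /eqP/eq_row_mx[_].
  exact: bfree.
exists (1 + r)%N, (col_mx x0 (row_mx 0 b : 'M_(r, 1 + n))); split=> [x|c].
  split=> [Mx|[c ->]]; last first.
    rewrite -[c]hsubmxK mul_row_col -first; apply: MD.
      by rewrite [lsubmx c]mx11_scalar mul_scalar_mx; apply: MZ.
    by apply/bP; exists (rsubmx c).
  have [q qE] := dP x Mx; pose y := x - q *: x0.
  have y00 : y 0 0 = 0 by rewrite !mxE qE x0d subrr.
  have /bP[c cE] : M (row_mx 0 (rsubmx (y : 'rV_(1 + n)))).
    by rewrite -split0//; apply: MB => //; apply: MZ.
  exists (row_mx q%:M c); rewrite mul_row_col mul_scalar_mx -first -cE -split0//.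
  by rewrite addrC subrK.
rewrite -[c]hsubmxK mul_row_col => e.
have q0 : lsubmx c = 0.
  have row0 (y : 'rV[R]_n) : (row_mx 0 y : 'rV[R]_(1 + n)) 0 0 = 0.
    have -> : (0 : 'I_(1 + n)) = lshift n (0 : 'I_1) by apply: val_inj.
    by rewrite row_mxEl mxE.
  have /rowP/(_ 0) := e; rewrite [lsubmx c]mx11_scalar mul_scalar_mx -first.
  rewrite mxE row0 addr0 mxE x0d mxE => /eqP.
  by rewrite [X in _ == X]mxE mulf_eq0 (negPf d0) orbF => /eqP ->; rewrite raddf0.
rewrite q0 -[RHS](row_mx0 _ _ 1 r); congr row_mx; apply: bfree.
move: e; rewrite q0 mul0mx add0r -first -[RHS](row_mx0 _ _ 1 n).
by move/eq_row_mx => [].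
Qed.

Lemma mulmx_rV_inj (T : pzRingType) m n (A A' : 'M[T]_(m, n)) :
  (forall c : 'rV_m, c *m A = c *m A') -> A = A'.
Proof. by move=> h; apply/row_matrixP => i; rewrite !rowE h. Qed.

Lemma bilinear_mx_inj (T : pzRingType) m n (A A' : 'M[T]_(m, n)) :
  (forall (c : 'rV_m) (d : 'rV_n), (c *m A *m d^T) 0 0 = (c *m A' *m d^T) 0 0) -> A = A'.
Proof.
move=> h; apply/matrixP => i k; have := h (delta_mx 0 i) (delta_mx 0 k).
by rewrite !trmx_delta -!rowE -!colE !mxE.
Qed.

Lemma linear_rV_mx (T : comPzRingType) n n' (psi : 'rV[T]_n -> 'rV[T]_n') :
  (forall x y, psi (x + y) = psi x + psi y) -> (forall k x, psi (k *: x) = k *: psi x) ->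
  exists g, forall x, psi x = x *m g.
Proof.
move=> psiD psiZ; exists (\matrix_u psi (delta_mx 0 u)) => x.
have psi0 : psi 0 = 0 by rewrite -(scale0r (0 : 'rV_n)) psiZ scale0r.
rewrite mulmx_sum_row {1}[x]row_sum_delta (big_morph psi psiD psi0).
by apply: eq_bigr => u _; rewrite psiZ rowK.
Qed.

Section CoordinateForms.
Variables (T : comNzRingType) (B : pzRingType) (I J : Type) (m : nat).
Variables (el : J -> T -> B) (one : J) (kB : B -> 'I_m -> T).
Hypothesis el_ind : forall P : B -> Prop,
  (forall a b, P a -> P b -> P (a + b)) -> (forall j k, P (el j k)) -> forall b, P b.
Hypothesis kB_inj : forall a b, kB a =1 kB b -> a = b.

(** Serves both for B = A over R and for B the scalar extension of A, where [el a k] is the tensor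
    of a and k. M has no T-module structure of its own: scalars act through [el one]. *)
Definition coordinates (M : lmodType B^c) n (kM : M -> 'rV[T]_n) (rho : J -> 'M[T]_n) :=
  [/\ forall x y, kM (x + y) = kM x + kM y, bijective kM, rho one = 1%:M
    & forall x j k, kM (x *r el j k) = k *: (kM x *m rho j)].

Definition form_coordinates (M : lmodType B^c) n (kM : M -> 'rV[T]_n)
    (f : I -> M -> M -> B) (Bm : I * 'I_m -> 'M[T]_n) :=
  forall i x y l, kB (f i x y) l = (kM x *m Bm (i, l) *m (kM y)^T) 0 0.

Variables (M N : lmodType B^c) (n n' : nat).
Variables (kM : M -> 'rV[T]_n) (kN : N -> 'rV[T]_n').
Variables (rho : J -> 'M[T]_n) (rho' : J -> 'M[T]_n').
Variables (f : I -> M -> M -> B) (f' : I -> N -> N -> B).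
Variables (Bm : I * 'I_m -> 'M[T]_n) (Bm' : I * 'I_m -> 'M[T]_n').
Hypotheses (kMP : coordinates kM rho) (kNP : coordinates kN rho').
Hypotheses (fP : form_coordinates kM f Bm) (fP' : form_coordinates kN f' Bm').

Lemma isometric_forms_mx : isometric_forms f f' ->
  exists (g : 'M[T]_(n, n')) (h : 'M[T]_(n', n)), [/\ g *m h = 1%:M, h *m g = 1%:M,
    forall j, rho j *m g = g *m rho' j & forall il, Bm il = g *m Bm' il *m g^T].
Proof.
have [kMD [kM' kMK kM'K] rho1 kMZ] := kMP; have [kND [kN' kNK kN'K] rho1' kNZ] := kNP.
have kM'D x y : kM' (x + y) = kM' x + kM' y by apply: (can_inj kMK); rewrite kMD !kM'K.
have kN'D x y : kN' (x + y) = kN' x + kN' y by apply: (can_inj kNK); rewrite kND !kN'K.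
have kM'Z k x : kM' (k *: x) = kM' x *r el one k.
  by apply: (can_inj kMK); rewrite kMZ !kM'K rho1 mulmx1.
have kN'Z k x : kN' (k *: x) = kN' x *r el one k.
  by apply: (can_inj kNK); rewrite kNZ !kN'K rho1' mulmx1.
case=> phi [phi' phiK phi'K] phif.
have phi'D x y : phi' (x + y) = phi' x + phi' y.
  by apply: (can_inj phiK); rewrite linearD !phi'K.
have phi'Z b x : phi' (x *r b) = phi' x *r b.
  by apply: (can_inj phiK); rewrite linearZ /= !phi'K.
have [|k x|g gP] := @linear_rV_mx _ _ _ (fun c => kN (phi (kM' c))).
- by move=> x y; rewrite kM'D linearD kND.
- by rewrite kM'Z linearZ /= kNZ rho1' mulmx1.
have [|k x|h hP] := @linear_rV_mx _ _ _ (fun c => kM (phi' (kN' c))).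
- by move=> x y; rewrite kN'D phi'D kMD.
- by rewrite kN'Z phi'Z kMZ rho1 mulmx1.
have gE x : kN (phi x) = kM x *m g by rewrite -gP kMK.
exists g, h; split.
- by apply: mulmx_rV_inj => c; rewrite mulmxA -gP -hP kNK phiK kM'K mulmx1.
- by apply: mulmx_rV_inj => c; rewrite mulmxA -hP -gP kMK phi'K kN'K mulmx1.
- move=> j; apply: mulmx_rV_inj => c; rewrite -(kM'K c) !mulmxA -gE.
  rewrite -[RHS]scale1r -kNZ -linearZ /= gE kMZ scale1r//.
- move=> [i l]; apply: bilinear_mx_inj => c d; rewrite -(kM'K c) -(kM'K d) -fP phif fP'.
  by rewrite !gE trmx_mul !mulmxA.
Qed.

Lemma mx_isometric_forms (g : 'M[T]_(n, n')) (h : 'M[T]_(n', n)) :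
  g *m h = 1%:M -> h *m g = 1%:M -> (forall j, rho j *m g = g *m rho' j) ->
  (forall il, Bm il = g *m Bm' il *m g^T) -> isometric_forms f f'.
Proof.
have [kMD [kM' kMK kM'K] rho1 kMZ] := kMP; have [kND [kN' kNK kN'K] rho1' kNZ] := kNP.
move=> gh hg grho gB.
have kN'D x y : kN' (x + y) = kN' x + kN' y by apply: (can_inj kNK); rewrite kND !kN'K.
have kM0 : kM 0 = 0 by apply: (addrI (kM 0)); rewrite -kMD !addr0.
have kN'0 : kN' 0 = 0 by apply: (addrI (kN' 0)); rewrite -kN'D !addr0.
pose phi x := kN' (kM x *m g).
have phiD x y : phi (x + y) = phi x + phi y by rewrite /phi kMD mulmxDl kN'D.
have phiZ b x : phi (x *r b) = phi x *r b.
  apply: (el_ind (P := fun b => phi (x *r b) = phi x *r b)) => [b1 b2 e1 e2|j k].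
    have E (V : lmodType B^c) (v : V) : v *r (b1 + b2) = v *r b1 + v *r b2.
      exact: (@scalerDl B^c V).
    by rewrite !E phiD e1 e2.
  apply: (can_inj kNK); rewrite kNZ /phi !kN'K kMZ -scalemxAl -!mulmxA grho//.
have phi_linear : linear phi by move=> b x y; rewrite phiD phiZ.
pose Phi : {linear M -> N} := HB.pack phi (GRing.isLinear.Build B^c M N *:%R phi phi_linear).
exists Phi => [|i x y].
  exists (fun y => kM' (kN y *m h)) => [x|y] /=.
    by rewrite /phi kN'K -mulmxA gh mulmx1 kMK.
  by rewrite /phi kM'K -mulmxA hg mulmx1 kNK.
apply: kB_inj => l; rewrite fP fP' /= /phi !kN'K gB trmx_mul !mulmxA//.
Qed.

End CoordinateForms.

Lemma linear_inverse (R : pzRingType) (M N : lmodType R) (k : {linear M -> N}) :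
  bijective k -> exists k' : {linear N -> M}, cancel k k' /\ cancel k' k.
Proof.
case=> k' kK k'K; have k'L : linear k'.
  by move=> a x y; apply: (can_inj kK); rewrite linearP /= !k'K.
pose K' : {linear N -> M} := HB.pack k' (GRing.isLinear.Build R N M *:%R k' k'L).
by exists K'.
Qed.

Lemma basis_frame (R : nzRingType) (M : lmodType R) n (e : 'I_n -> M) :
    (forall x, exists! c : 'rV[R]_n, x = \sum_(i < n) c 0 i *: e i) ->
  exists k : {linear M -> 'rV[R]_n}, bijective k.
Proof.
move=> eP; have /choice[k kP] : forall x, exists c : 'rV[R]_n,
    x = \sum_(i < n) c 0 i *: e i /\
    forall c' : 'rV[R]_n, x = \sum_(i < n) c' 0 i *: e i -> c = c'.
  by move=> x; have [c [xc cU]] := eP x; exists c.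
have kU x (c : 'rV[R]_n) : x = \sum_(i < n) c 0 i *: e i -> k x = c by case: (kP x) => _; apply.
have kE x : x = \sum_(i < n) k x 0 i *: e i by case: (kP x).
have kL : linear k.
  move=> a x y; apply: kU; rewrite {1}(kE x) {1}(kE y) scaler_sumr -big_split /=.
  apply: eq_bigr => i _; by rewrite !mxE scalerDl scalerA.
pose K : {linear M -> 'rV[R]_n} := HB.pack k (GRing.isLinear.Build R M 'rV[R]_n *:%R k kL).
exists K, (fun c : 'rV[R]_n => \sum_(i < n) c 0 i *: e i) => [x|c] /=; first by rewrite -kE.
exact: kU.
Qed.

(** Projectivity gives a section of a surjection from A^s to P, so P embeds over R into a free
    module of rank s m, where submodules have bases. *)
Lemma module_frame (R : idomainType) (A : algType R) (P : lmodType A^c) :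
    is_PID R -> is_order A -> finitely_generated P -> projective P ->
  exists n (k : {linear Defs.restrict P -> 'rV[R]_n}), bijective k.
Proof.
move=> R_PID [m [e /basis_frame[kA kA_bij]]] [s [g gP]] projP.
pose q (c : 'rV[A^c]_s) : P := \sum_(i < s) c 0 i *: g i.
have qL : linear q.
  move=> a x y; rewrite /q scaler_sumr -big_split /=.
  apply: eq_bigr => i _; by rewrite !mxE scalerDl scalerA.
pose Q : {linear 'rV[A^c]_s -> P} :=
  HB.pack q (GRing.isLinear.Build A^c 'rV[A^c]_s P *:%R q qL).
have [|h hP] := projP _ _ Q idfun.
  move=> y; have [c ->] := gP y; exists (\row_i c i).
  by apply: eq_bigr => i _; rewrite mxE.
have hE (x : P) : q (h x) = x := hP x.
pose iota (x : Defs.restrict P) : 'rV[R]_(s * m) :=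
  mxvec (\matrix_(i < s, l < m) kA (h x 0 i : A) 0 l).
have iota_lin a x y : iota (a *: x + y) = a *: iota x + iota y.
  rewrite -[a *: iota x]linearZ -linearD /=; congr mxvec; apply/matrixP => i l.
  have -> : a *: x + y = (x : P) *r (a%:A : A) + y :> P by [].
  rewrite linearD linearZ /= !mxE.
  have -> : (a%:A : A^c) * (h x 0 i) = a *: (h x 0 i : A) :> A.
    by change ((h x 0 i : A) * a%:A = a *: (h x 0 i : A)); rewrite mulr_algr.
  by rewrite linearP /= !mxE.
have iota_inj : injective iota.
  move=> x y /(can_inj mxvecK)/matrixP xy; rewrite -(hE x) -(hE y); congr (q _).
  apply/rowP => i; apply: (bij_inj kA_bij); apply/rowP => l.
  by have := xy i l; rewrite !mxE.
have [||r [b [bP b_free]]] :=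
    @PID_submodule_basis _ _ (fun v => exists x, v = iota x) R_PID.
- by exists 0; have := iota_lin (-1) 0 0; rewrite scaler0 addr0 scaleN1r addNr.
- by move=> a _ _ [x ->] [y ->]; exists (a *: x + y); rewrite iota_lin.
have /choice[k kP] : forall x, exists c, iota x = c *m b by move=> x; apply/bP; exists x.
have b_inj (c d : 'rV[R]_r) : c *m b = d *m b -> c = d.
  move=> cd; apply/eqP; rewrite -subr_eq0; apply/eqP/b_free.
  by rewrite mulmxBl cd subrr.
have kL : linear k by move=> a x y; apply: b_inj; rewrite -kP iota_lin mulmxDl -scalemxAl -!kP.
pose K : {linear Defs.restrict P -> 'rV[R]_r} :=
  HB.pack k (GRing.isLinear.Build R (Defs.restrict P) 'rV[R]_r *:%R k kL).
have /choice[k' k'P] : forall c : 'rV[R]_r, exists x, c *m b = iota x.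
  by move=> c; apply/bP; exists c.
exists r, K, k' => [x|c] /=; first by apply: iota_inj; rewrite -k'P -kP.
by apply: b_inj; rewrite -kP -k'P.
Qed.

Lemma bilinear_rV_mx (T : comPzRingType) n n' (beta : 'rV[T]_n -> 'rV[T]_n' -> T) :
    (forall x y z, beta (x + y) z = beta x z + beta y z) ->
    (forall x y z, beta x (y + z) = beta x y + beta x z) ->
    (forall k x y, beta (k *: x) y = k * beta x y) ->
    (forall k x y, beta x (k *: y) = k * beta x y) ->
  exists M, forall x y, beta x y = (x *m M *m y^T) 0 0.
Proof.
move=> Dl Dr Zl Zr; have [||g gP] :=
    @linear_rV_mx _ n n' (fun x => \row_v beta x (delta_mx 0 v)).
- by move=> x y; apply/rowP => v; rewrite !mxE Dl.
- by move=> k x; apply/rowP => v; rewrite !mxE Zl.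
exists g => x y; rewrite -gP.
have [||h hP] := @linear_rV_mx _ n' 1 (fun y => \row__ beta x y).
- by move=> z w; apply/rowP => v; rewrite !mxE Dr.
- by move=> k z; apply/rowP => v; rewrite !mxE Zr.
have /rowP/(_ 0) := hP y; rewrite mxE => ->.
rewrite !mxE; apply: eq_bigr => v _; rewrite !mxE mulrC.
have /rowP/(_ 0) := hP (delta_mx 0 v); rewrite -rowE !mxE => <-//.
Qed.

Section Frames.
Variables (R : comNzRingType) (A : algType R) (m : nat) (kA : {linear A -> 'rV[R]_m}).
Hypothesis kA_bij : bijective kA.
Variables (P : lmodType A^c) (n : nat) (k : {linear Defs.restrict P -> 'rV[R]_n}).
Hypothesis k_bij : bijective k.

Definition base_el (a : A) (r : R) : A := r *: a.
Definition base_coord (a : A) : 'I_m -> R := fun l => kA a 0 l.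

Lemma base_el_ind (Q : A -> Prop) : (forall a b, Q a -> Q b -> Q (a + b)) ->
  (forall a r, Q (base_el a r)) -> forall b, Q b.
Proof. by move=> _ QZ b; have := QZ b 1; rewrite /base_el scale1r. Qed.

Lemma base_coord_inj a b : base_coord a =1 base_coord b -> a = b.
Proof. by move=> ab; apply: (bij_inj kA_bij); apply/rowP. Qed.

Lemma frame_coordinates : exists rho : A -> 'M[R]_n,
  coordinates base_el 1 (k : P -> 'rV[R]_n) rho.
Proof.
have [k' [kK k'K]] := linear_inverse k_bij.
have restrictZ (x : P) (a : A) r :
    x *r (r *: a) = r *: (x *r a : Defs.restrict P) :> Defs.restrict P.
  change (x *r (r *: a) = (x *r a) *r (r%:A : A)); rewrite scalerA; congr (_ *: _).
  by change (r *: a = a * r%:A); rewrite mulr_algr.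
have k'Z a x : k' (a *: x) = a *: k' x by exact: linearZ.
have /choice[rho rhoP] : forall a : A, exists g, forall x : 'rV[R]_n,
    k ((k' x : P) *r a : Defs.restrict P) = x *m g.
  move=> a; apply: linear_rV_mx => [x y|r x].
    by rewrite linearD (@scalerDr A^c P) linearD.
  rewrite k'Z; transitivity (k (r *: ((k' x : P) *r a : Defs.restrict P))); last first.
    exact: linearZ.
  congr (k _).
  change (((k' x : P) *r (r%:A : A)) *r a = ((k' x : P) *r a) *r (r%:A : A)).
  rewrite !scalerA; congr (_ *: _).
  by change (r%:A * a = a * r%:A); rewrite mulr_algl mulr_algr.
exists rho; split=> [x y|//||x a r]; first exact: linearD.
  by apply: mulmx_rV_inj => c; rewrite -rhoP scale1r k'K mulmx1.
by rewrite /base_el restrictZ linearZ /= -{1}(kK x) rhoP.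
Qed.

Lemma form_coordinates_exist (I : Type) (sigma : I -> A -> A) (f : I -> P -> P -> A) :
    (forall i, R_involution (sigma i)) -> (forall i, sesquilinear (sigma i) (f i)) ->
  exists Bm, form_coordinates base_coord (k : P -> 'rV[R]_n) f Bm.
Proof.
move=> sI fS; have [k' [kK k'K]] := linear_inverse k_bij.
have k'Z a x : k' (a *: x) = a *: k' x by exact: linearZ.
have /choice[Bm BmP] : forall il : I * 'I_m, exists M, forall x y : 'rV[R]_n,
    kA (f il.1 (k' x) (k' y)) 0 il.2 = (x *m M *m y^T) 0 0.
  move=> [i l]; have [fDl fDr fZl fZr] := form_bilinear (sI i) (fS i).
  apply: bilinear_rV_mx => [x y z|x y z|r x y|r x y] /=.
  - by rewrite linearD [f _ _ _]fDl linearD mxE.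
  - by rewrite linearD [f _ _ _]fDr linearD mxE.
  - by rewrite k'Z [f _ _ _]fZl linearZ /= mxE.
  - by rewrite k'Z [f _ _ _]fZr linearZ /= mxE.
by exists Bm => i x y l; rewrite -BmP /= !kK.
Qed.

End Frames.

Section TensorFrame.
Variables (R T : comNzRingType) (iota : {rmorphism R -> T}).

Lemma tens_frame (M : lmodType R) n (k : {linear M -> 'rV[R]_n}) : bijective k ->
  exists kT : tens iota M -> 'rV[T]_n, [/\ forall x y, kT (x + y) = kT x + kT y,
    bijective kT & forall x c, kT (pure iota x c) = c *: map_mx iota (k x)].
Proof.
move=> /linear_inverse[k' [kK k'K]].
have bal : balanced iota (fun (x : M) c => c *: map_mx iota (k x)).
  split=> [x y c|x c d|r x c].
  - by rewrite linearD map_mxD scalerDr.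
  - by rewrite scalerDl.
  - by rewrite linearZ map_mxZ scalerA mulrC.
pose kT := tens_lift (iota := iota) (fun (x : M) c => c *: map_mx iota (k x)).
have kTD x y : kT (x + y) = kT x + kT y by exact: tens_liftD.
have kTp x c : kT (pure iota x c) = c *: map_mx iota (k x) by exact: tens_lift_pure.
pose kT' (c : 'rV[T]_n) : tens iota M := \sum_u pure iota (k' (delta_mx 0 u)) (c 0 u).
have kT'D x y : kT' (x + y) = kT' x + kT' y.
  by rewrite -big_split; apply: eq_bigr => u _; rewrite mxE pureDr.
have kT0 : kT 0 = 0 by apply: (addrI (kT 0)); rewrite -kTD !addr0.
have pD c : {morph (fun x : M => pure iota x c) : x y / x + y >-> x + y}.
  by move=> x y; exact: pureDl.
have p0 c : pure iota (0 : M) c = 0.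
  by apply: (addrI (pure iota 0 c)); rewrite -pureDl !addr0.
exists kT; split=> //; exists kT' => [z|c].
  apply: (tens_ext (g := kT' \o kT) (h := id)) => [x y|x y|x c] //=.
    by rewrite kTD kT'D.
  rewrite kTp /kT' -[in RHS](kK x) [k x in RHS]row_sum_delta.
  have k'Z a v : k' (a *: v) = a *: k' v by exact: linearZ.
  rewrite linear_sum /= (big_morph _ (pD c) (p0 c)).
  by apply: eq_bigr => u _; rewrite k'Z pureZ !mxE mulrC.
rewrite /kT' (big_morph kT kTD kT0) [RHS]row_sum_delta.
apply: eq_bigr => u _; rewrite kTp k'K; congr (_ *: _).
by apply/rowP => v; rewrite !mxE rmorph_nat.
Qed.

Variables (A : algType R) (m : nat) (kA : {linear A -> 'rV[R]_m}).
Hypothesis kA_bij : bijective kA.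
Local Notation A_T := (tens_alg iota A).

Definition ext_el (a : A) (c : T) : A_T := pure iota a c.

Lemma ext_el_ind (Q : A_T -> Prop) : (forall a b, Q a -> Q b -> Q (a + b)) ->
  (forall a c, Q (ext_el a c)) -> forall b, Q b.
Proof.
move=> QD Qp b; have [s ->] := tensE b; elim: s => [|u s IH].
  rewrite big_nil; have -> : (0 : A_T) = ext_el 0 0.
    by apply: (addrI (ext_el 0 0)); rewrite -[RHS]pureDr !addr0.
  exact: Qp.
by rewrite big_cons; apply: QD IH; exact: Qp.
Qed.

(** [kB] is chosen before P, since the two systems to be compared must share the coordinates of the
    extended algebra. *)
Lemma ext_coordinates : exists kB : A_T -> 'I_m -> T,
  (forall a b, kB a =1 kB b -> a = b) /\
  forall (P : lmodType A^c) n (k : {linear Defs.restrict P -> 'rV[R]_n}), bijective k ->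
  exists kP : ext_mod iota P -> 'rV[T]_n,
    (forall rho, coordinates (base_el (A := A)) 1 (k : P -> 'rV[R]_n) rho ->
      coordinates ext_el 1 kP (fun a => map_mx iota (rho a))) /\
    forall I (sigma : I -> A -> A) (f : I -> P -> P -> A) Bm,
      (forall i, R_involution (sigma i)) -> (forall i, sesquilinear (sigma i) (f i)) ->
      form_coordinates (base_coord kA) (k : P -> 'rV[R]_n) f Bm ->
      form_coordinates kB kP (fun i => ext_form (iota := iota) (f i))
        (fun il => map_mx iota (Bm il)).
Proof.
have [kT [kTD kTbij kTp]] := tens_frame kA_bij.
exists (fun z l => kT z 0 l); split=> [a b ab|P n k k_bij].
  by apply: (bij_inj kTbij); apply/rowP.
have [kP [kPD kPbij kPp]] := tens_frame k_bij.
exists kP; split=> [rho [_ _ rho1 rhoZ]|I sigma f Bm sI fS fB].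
  split=> [//|//||z a c]; first by rewrite rho1 map_mx1.
  have sD (v w : ext_mod iota P) : (v + w) *r ext_el a c = v *r ext_el a c + w *r ext_el a c.
    exact: scalerDr.
  apply: (tens_ext (g := fun z => kP ((z : ext_mod iota P) *r ext_el a c))
    (h := fun z => c *: (kP z *m map_mx iota (rho a)))) => [x y|x y|x d].
  - by rewrite sD kPD.
  - by rewrite kPD mulmxDl scalerDr.
  rewrite ext_act_pure !kPp; have := rhoZ x a 1; rewrite /base_el !scale1r => ->.
  by rewrite map_mxM -scalemxAl scalerA mulrC.
move=> i z w l.
have fb := form_bilinear (sI i) (fS i).
have eDl y : {morph (ext_form (iota := iota) (f i))^~ y : x x' / x + x'}.
  exact: (tens_map2Dl fb).
have eDr x : {morph ext_form (iota := iota) (f i) x : y y' / y + y'}.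
  exact: (tens_map2Dr fb).
apply: (tens_ext (g := fun z => kT (ext_form (iota := iota) (f i) z w) 0 l)
  (h := fun z => (kP z *m map_mx iota (Bm (i, l)) *m (kP w)^T) 0 0)) => [x y|x y|x c].
- by rewrite eDl kTD mxE.
- by rewrite kPD !mulmxDl mxE.
apply: (tens_ext (g := fun w => kT (ext_form (iota := iota) (f i) (pure iota x c) w) 0 l)
  (h := fun w => (kP (pure iota x c) *m map_mx iota (Bm (i, l)) *m (kP w)^T) 0 0))
  => [y y'|y y'|y d].
- by rewrite eDr kTD mxE.
- by rewrite kPD linearD /= mulmxDr mxE.
rewrite (ext_form_pure iota (sI i) (fS i)) kTp !kPp mxE mxE.
have := fB i x y l; rewrite /base_coord => ->.
rewrite linearZ /= -!scalemxAl -scalemxAr !mxE mulrA.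
rewrite map_trmx -!map_mxM rmorph_sum; congr (_ * _).
by apply: eq_bigr => v _; rewrite rmorphM !mxE.
Qed.

End TensorFrame.

(** * The completion at the zero prime *)

Section ZeroPrime.
Local Open Scope quotient_scope.
Variables (R : idomainType) (p : prime_idealr R).
Hypothesis p0 : forall x, x \in (p : {pred R}) -> x = 0.
Local Notation "x %:F" := (@FracField.tofrac R x).
Local Notation S := (localization p).
Local Notation J := (loc_ideal (p := p)).

Local Notation piQ := (\pi_({ideal_quot null_seq (J := J)})).

Let J0 (u : S) : u \in (J : {pred S}) -> u = 0.
Proof.
move=> /asboolP[a [s [/p0 -> _ uE]]]; apply: val_inj.
by rewrite uE tofrac0 mul0r [RHS](rmorph0 (val : S -> {fraction R})).
Qed.

(** Maps over R in both directions are enough to transport matrix isometries between this completion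
    and F. *)
Lemma zero_prime_to_fraction : exists f : {rmorphism completion_at p -> {fraction R}},
  forall r, f (to_completion_at p r) = r%:F.
Proof.
(* J is zero, so null sequences vanish from index 1 on; the term of index 0 is arbitrary. *)
pose ev (c : coherent_seq J) : {fraction R} := val (val c 1%N).
have evP (c d : coherent_seq J) :
    piQ c = piQ d -> ev c = ev d.
  move/eqP; rewrite -Quotient.idealrBE => /asboolP/(_ 1%N)[s sJ cd].
  congr (val _); apply/eqP; rewrite -subr_eq0; apply/eqP.
  transitivity (val (c - d) 1%N) => //.
  by rewrite cd big_seq big1// => u /sJ[/J0 -> _]; rewrite mul0r.
pose f (t : completion_at p) : {fraction R} := ev (repr t).
have fE c : f (piQ c) = ev c by apply: evP; rewrite reprK.
have tE (t : completion_at p) : exists c, t = piQ c by exists (repr t); rewrite [RHS]reprK.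
have fB : zmod_morphism f.
  move=> x y; have [c ->] := tE x; have [d ->] := tE y.
  have -> : piQ c - piQ d = piQ (c - d) by rewrite rmorphB.
  rewrite !fE; transitivity (val (val c 1%N - val d 1%N)); first by [].
  by rewrite rmorphB.
have fM : monoid_morphism f.
  split=> [|x y].
    have -> : 1 = piQ 1 by rewrite rmorph1.
    by rewrite fE; exact: (rmorph1 (val : S -> {fraction R})).
  have [c ->] := tE x; have [d ->] := tE y.
  have -> : piQ c * piQ d = piQ (c * d) by rewrite rmorphM.
  rewrite !fE; transitivity (val (val c 1%N * val d 1%N)); first by [].
  by rewrite rmorphM.
pose f' : {rmorphism completion_at p -> {fraction R}} := HB.pack f
  (GRing.isZmodMorphism.Build _ _ f fB) (GRing.isMonoidMorphism.Build _ _ f fM).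
by exists f' => r /=; rewrite [LHS]fE.
Qed.

Lemma zero_prime_of_fraction : exists f : {rmorphism {fraction R} -> completion_at p},
  forall r, f (r%:F) = to_completion_at p r.
Proof.
have loc x : loc_pred p x.
  have [a [b [b0 xE]]] := fractionP x; apply/asboolP; exists a, b; split=> //.
  by apply: contra b0 => /p0 ->.
pose g (x : {fraction R}) : S := exist _ x (loc x).
have gB : zmod_morphism g.
  by move=> x y; apply: val_inj; rewrite [RHS](rmorphB (val : S -> {fraction R})).
have gM : monoid_morphism g.
  split=> [|x y]; apply: val_inj.
    by rewrite [RHS](rmorph1 (val : S -> {fraction R})).
  by rewrite [RHS](rmorphM (val : S -> {fraction R})).
pose g' : {rmorphism {fraction R} -> S} := HB.pack g
  (GRing.isZmodMorphism.Build _ _ g gB) (GRing.isMonoidMorphism.Build _ _ g gM).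
exists (to_compl J \o g') => r /=; congr (to_compl J _); exact: val_inj.
Qed.

End ZeroPrime.

Lemma isometric_forms_sym (B : pzRingType) (I : Type) (P Q : lmodType B^c)
    (f : I -> P -> P -> B) (g : I -> Q -> Q -> B) :
  isometric_forms f g -> isometric_forms g f.
Proof.
case=> phi [psi phiK psiK] fg.
have psiL : linear psi by move=> a x y; apply: (can_inj phiK); rewrite linearP !psiK.
pose Psi : {linear Q -> P} := HB.pack psi (GRing.isLinear.Build B^c Q P *:%R psi psiL).
by exists Psi => [|i x y]; [exists phi|rewrite fg /= !psiK].
Qed.

Lemma isometric_forms_trans (B : pzRingType) (I : Type) (P Q V : lmodType B^c)
    (f : I -> P -> P -> B) (g : I -> Q -> Q -> B) (h : I -> V -> V -> B) :
  isometric_forms f g -> isometric_forms g h -> isometric_forms f h.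
Proof.
case=> phi phib fg [psi psib gh]; exists (psi \o phi); first exact: bij_comp.
by move=> i x y; rewrite fg gh.
Qed.

Lemma isometric_eq (R : comNzRingType) (A : algType R) (I : Type) (sigma : I -> A -> A)
    (X Y : system sigma) : isometric X = isometric Y <-> isometric X Y.
Proof.
split=> [e|XY]; last first.
  apply/funext => Z; apply/propext; split; apply: isometric_forms_trans => //.
  exact: isometric_forms_sym.
by rewrite e; exists idfun => //; exists id.
Qed.

(** In coordinates, sesquilinearity is a family of linear relations between the matrices of the
    form. They are carried from Bm to B' by an isometry over F and hold over R by injectivity. *)
Lemma sesquilinear_of_mx (R F : comNzRingType) (iF : {rmorphism R -> F})
    (A : algType R) (m : nat) (kA : {linear A -> 'rV[R]_m}) (P : lmodType A^c) (n : nat)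
    (k : {linear Defs.restrict P -> 'rV[R]_n}) (I : Type) (sigma : I -> A -> A)
    (f : I -> P -> P -> A) (rho : A -> 'M[R]_n) (Bm B' : I * 'I_m -> 'M[R]_n)
    (g : 'M[F]_n) :
    injective iF -> bijective kA -> (forall i, sesquilinear (sigma i) (f i)) ->
    coordinates (base_el (A := A)) 1 (k : P -> 'rV[R]_n) rho ->
    form_coordinates (base_coord kA) (k : P -> 'rV[R]_n) f Bm ->
    mx_isom iF rho Bm rho B' g ->
  exists f' : I -> P -> P -> A, (forall i, sesquilinear (sigma i) (f' i)) /\
    form_coordinates (base_coord kA) (k : P -> 'rV[R]_n) f' B'.
Proof.
move=> iF_inj /linear_inverse[kA' [kAK kA'K]] fS [kD [k' kK k'K] _ krho] fB [_ grho gB].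
have kA'Z r v : kA' (r *: v) = r *: kA' v by exact: linearZ.
have krho1 x a : k (x *r a : Defs.restrict P) = k x *m rho a.
  by have := krho x a 1; rewrite /base_el !scale1r.
exists (fun i x y => kA' (\row_l (k x *m B' (i, l) *m (k y)^T) 0 0)); split; last first.
  by move=> i x y l; rewrite /base_coord kA'K mxE.
have row_at (h : 'I_m -> R) l : (\row_l h l) 0 l = h l by rewrite mxE.
move=> i; split=> [x x' y|x y y'|x y a b].
- rewrite -linearD; congr (kA' _); apply/rowP => l.
  by rewrite row_at [RHS]mxE !row_at kD !mulmxDl [LHS]mxE.
- rewrite -linearD; congr (kA' _); apply/rowP => l.
  by rewrite row_at [RHS]mxE !row_at kD linearD mulmxDr [LHS]mxE.
(* [Lam] is the matrix of v |-> sigma(a) v b on A, so it does not depend on the form. *)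
have [||Lam LamP] := @linear_rV_mx _ m m (fun v => kA (sigma i a * kA' v * b)).
- by move=> v w; rewrite linearD mulrDr mulrDl linearD.
- by move=> r v; rewrite kA'Z -scalerAr -scalerAl linearZ.
have LamB l : rho a *m Bm (i, l) *m (rho b)^T = \sum_l' Lam l' l *: Bm (i, l').
  apply: bilinear_mx_inj => c d; have := fB i (k' c *r a) (k' d *r b) l.
  have [_ _ ->] := fS i; rewrite /base_coord !krho1 !k'K trmx_mul !mulmxA => <-.
  rewrite -[f i _ _]kAK LamP mulmx_sumr mulmx_suml summxE mxE; apply: eq_bigr => l' _.
  rewrite -scalemxAr -scalemxAl mxE mulrC; congr (_ * _).
  by have := fB i (k' c) (k' d) l'; rewrite /base_coord !k'K.
have LamB' l : rho a *m B' (i, l) *m (rho b)^T = \sum_l' Lam l' l *: B' (i, l').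
  apply: (map_mx_inj iF_inj) => /=; rewrite !map_mxM -map_trmx gB.
  rewrite !mulmxA grho -!mulmxA -trmx_mul grho trmx_mul !mulmxA.
  rewrite -(mulmxA g) -(mulmxA g) map_trmx -!map_mxM LamB !raddf_sum /=.
  rewrite mulmx_suml; apply: eq_bigr => l' _.
  by rewrite !map_mxZ gB -scalemxAr -scalemxAl.
apply: (can_inj kAK); rewrite kA'K LamP; apply/rowP => l.
rewrite mxE !krho1 trmx_mul !mulmxA.
have -> : k x *m rho a *m B' (i, l) *m (rho b)^T *m (k y)^T =
  k x *m (rho a *m B' (i, l) *m (rho b)^T) *m (k y)^T by rewrite !mulmxA.
rewrite LamB' mulmx_sumr mulmx_suml summxE mxE; apply: eq_bigr => l' _.
by rewrite -scalemxAr -scalemxAl !mxE mulrC.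
Qed.

Lemma invertible_mx_dim (T : comNzRingType) (K : fieldType) (f : {rmorphism T -> K}) n n'
    (g : 'M[T]_(n, n')) (h : 'M[T]_(n', n)) :
  g *m h = 1%:M -> h *m g = 1%:M -> n = n'.
Proof.
have le a b (x : 'M[T]_(a, b)) y : x *m y = 1%:M -> (a <= b)%N.
  move=> /(congr1 (map_mx f)); rewrite map_mxM map_mx1 => xy.
  rewrite -(mxrank1 K a) -xy; apply: leq_trans (mxrankM_maxl _ _) (rank_leq_col _).
by move=> gh hg; apply/eqP; rewrite eqn_leq (le _ _ _ _ gh) (le _ _ _ _ hg).
Qed.

Lemma mx_isom_inv (R T : comNzRingType) (f : {rmorphism R -> T}) n (J L : Type)
    (rho rho' : J -> 'M[R]_n) (B B' : L -> 'M[R]_n) g :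
  mx_isom f rho B rho' B' g -> exists h, mx_isom f rho' B' rho B h.
Proof.
move=> gI; have [/glV[h [_ _ hg]] _ _] := gI.
by exists h; exact: mx_isom_sym gI hg.
Qed.

(** * Comparison of systems through charts *)

Section Charts.
Variables (R : comNzRingType) (A : algType R) (m : nat) (kA : {linear A -> 'rV[R]_m}).
Hypothesis kA_bij : bijective kA.
Variables (I : Type) (sigma : I -> A -> A).
Hypothesis sigma_inv : forall i, R_involution (sigma i).

Definition chart (Y : system sigma) n (k : {linear Defs.restrict (sys_mod Y) -> 'rV[R]_n})
    (rho : A -> 'M[R]_n) (Bm : I * 'I_m -> 'M[R]_n) : Prop :=
  [/\ bijective k, coordinates (base_el (A := A)) 1 (k : sys_mod Y -> 'rV[R]_n) rho
    & form_coordinates (base_coord kA) (k : sys_mod Y -> 'rV[R]_n) (@sys_form _ _ _ _ Y) Bm].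

Section TwoCharts.
Variables (X Y : system sigma) (n n' : nat).
Variables (k : {linear Defs.restrict (sys_mod X) -> 'rV[R]_n}).
Variables (k' : {linear Defs.restrict (sys_mod Y) -> 'rV[R]_n'}).
Variables (rho : A -> 'M[R]_n) (rho' : A -> 'M[R]_n').
Variables (Bm : I * 'I_m -> 'M[R]_n) (Bm' : I * 'I_m -> 'M[R]_n').
Hypotheses (XP : chart k rho Bm) (YP : chart k' rho' Bm').

(** The ranks n and n' are kept independent, because their equality is deduced from this. *)
Lemma isometric_over_chart (T : comNzRingType) (f : {rmorphism R -> T}) :
  isometric_over f X Y -> exists (g : 'M[T]_(n, n')) (h : 'M[T]_(n', n)),
    [/\ g *m h = 1%:M, h *m g = 1%:M,
      forall a, map_mx f (rho a) *m g = g *m map_mx f (rho' a)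
      & forall il, map_mx f (Bm il) = g *m map_mx f (Bm' il) *m g^T].
Proof.
have [kb rhoP BP] := XP; have [kb' rhoP' BP'] := YP.
have [kB [kB_inj kBP]] := ext_coordinates f kA_bij.
have [kT [kT1 kT2]] := kBP _ _ _ kb; have [kT' [kT1' kT2']] := kBP _ _ _ kb'.
apply: (isometric_forms_mx (kT1 _ rhoP) (kT1' _ rhoP')).
  exact: kT2 sigma_inv (@sys_sesqui _ _ _ _ X) BP.
exact: kT2' sigma_inv (@sys_sesqui _ _ _ _ Y) BP'.
Qed.

End TwoCharts.

Section SameRank.
Variables (X Y : system sigma) (n : nat).
Variables (k : {linear Defs.restrict (sys_mod X) -> 'rV[R]_n}).
Variables (k' : {linear Defs.restrict (sys_mod Y) -> 'rV[R]_n}).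
Variables (rho : A -> 'M[R]_n) (rho' : A -> 'M[R]_n).
Variables (Bm : I * 'I_m -> 'M[R]_n) (Bm' : I * 'I_m -> 'M[R]_n).
Hypotheses (XP : chart k rho Bm) (YP : chart k' rho' Bm').

Lemma mx_isom_isometric_over (T : comNzRingType) (f : {rmorphism R -> T}) g :
  mx_isom f rho' Bm' rho Bm g -> isometric_over f X Y.
Proof.
have [kb rhoP BP] := XP; have [kb' rhoP' BP'] := YP.
have [kB [kB_inj kBP]] := ext_coordinates f kA_bij.
have [kT [kT1 kT2]] := kBP _ _ _ kb; have [kT' [kT1' kT2']] := kBP _ _ _ kb'.
case=> /glV[h [_ gh hg]] grho gB.
have eB := kT2 _ _ _ _ sigma_inv (@sys_sesqui _ _ _ _ X) BP.
have eB' := kT2' _ _ _ _ sigma_inv (@sys_sesqui _ _ _ _ Y) BP'.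
exact: (mx_isometric_forms (@ext_el_ind _ _ f A) kB_inj
  (kT1 _ rhoP) (kT1' _ rhoP') eB eB' gh hg grho gB).
Qed.

Lemma isometric_chart : isometric X Y <-> exists g, mx_isom idfun rho' Bm' rho Bm g.
Proof.
have [kb rhoP BP] := XP; have [kb' rhoP' BP'] := YP; split.
  case/(isometric_forms_mx rhoP rhoP' BP BP') => g [h [gh hg grho gB]].
  exists g; split=> [|a|il]; first by exists h.
    by rewrite !map_mx_id.
  by rewrite !map_mx_id.
case=> g [/glV[h [_ gh hg]] grho gB].
apply: (mx_isometric_forms (@base_el_ind _ A) (base_coord_inj kA_bij)
  rhoP rhoP' BP BP' gh hg) => [a|il].
  by have := grho a; rewrite !map_mx_id.
by have := gB il; rewrite !map_mx_id.
Qed.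

End SameRank.
End Charts.

Lemma chart_exists (R : idomainType) (A : algType R) (m : nat) (kA : {linear A -> 'rV[R]_m})
    (I : Type) (sigma : I -> A -> A) (Y : system sigma) :
  is_PID R -> is_order A -> (forall i, R_involution (sigma i)) ->
  exists n (k : {linear Defs.restrict (sys_mod Y) -> 'rV[R]_n}) rho Bm, chart kA k rho Bm.
Proof.
move=> R_PID A_order sI.
have [n [k k_bij]] := module_frame R_PID A_order (sys_fg Y) (@sys_proj _ _ _ _ Y).
have [rho rhoP] := frame_coordinates k_bij.
have [Bm BmP] := form_coordinates_exist kA k_bij sI (@sys_sesqui _ _ _ _ Y).
by exists n, k, rho, Bm.
Qed.

Lemma zero_prime_exists (R : idomainType) :
  exists p : prime_idealr R, forall x, x \in (p : {pred R}) -> x = 0.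
Proof.
have [||a u v -> ->|J JP] := @idealr_of R (fun x => x = 0) => //.
- by move/eqP; rewrite oner_eq0.
- by rewrite mulr0 addr0.
have [|p pJ] := @prime_idealr_of R J; last by exists p => x; rewrite pJ => /JP.
move=> a b /JP/eqP; rewrite mulf_eq0 => /orP[]/eqP ab; apply/orP.
  by left; apply/JP.
by right; apply/JP.
Qed.

Theorem theorem7p1 (R : idomainType)
  (R_PID : is_PID R) (R_semilocal : semilocal R)
  (F_neq_R : exists x : {fraction R}, forall r : R, x <> FracField.tofrac r)
  (two_unit : (2%:R : R) \is a GRing.unit)
  (A : algType R) (A_order : is_order A)
  (I : Type) (sigma : I -> A -> A) (sigma_inv : forall i, R_involution (sigma i))
  (X : system sigma) :
  exists (n : nat) (f : 'I_(2 ^ n) -> gen X), bijective f.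
Proof.
have [m [e /basis_frame[kA kA_bij]]] := A_order.
have [n [k [rho [Bm XP]]]] := chart_exists kA X R_PID A_order sigma_inv.
have [S [s0 [p [pi [piP pi0 pico above primes]]]]] :=
  finite_nonzero_primes R_PID R_semilocal F_neq_R.
pose T i : comNzRingType := completion_at (p i).
pose iT i : {rmorphism R -> T i} := to_completion_at (p i).
pose iF : {rmorphism R -> {fraction R}} := @FracField.tofrac R.
have /dependent_choice[Kod KodP] : forall i, exists Kod : {K : fieldType &
    ({rmorphism T i -> K} * {rmorphism {fraction R} -> K})%type},
  let o := (projT2 Kod).1 in let j := (projT2 Kod).2 in
  [/\ injective o, forall r, o (iT i r) = j (iF r),
      forall x, exists m t, o (iT i (pi i) ^+ m) * x = o t,
      forall x m, exists r t, x - j r = o (iT i (pi i) ^+ m * t)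
    & forall r t, j r = o t -> exists a s, s \notin (p i : {pred R}) /\
        r = FracField.tofrac a / FracField.tofrac s].
  move=> i; have [K [o [j H]]] := completion_valued_field R_PID (piP i) (pi0 i).
  by exists (existT _ K (o, j)).
pose K i : fieldType := projT1 (Kod i).
pose o i : {rmorphism T i -> K i} := (projT2 (Kod i)).1.
pose j i : {rmorphism {fraction R} -> K i} := (projT2 (Kod i)).2.
have o_inj i : injective (o i) by case: (KodP i).
have o_iT i r : o i (iT i r) = j i (iF r) by case: (KodP i).
have den i (x : K i) : exists m t, o i (iT i (pi i) ^+ m) * x = o i t.
  by case: (KodP i).
have approx := chinese_approximation o_iT pico den
  (fun i => let: And5 _ _ _ h _ := KodP i in h).
have iF_inj : injective iF by move=> x y /eqP; rewrite tofrac_eq => /eqP.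
have pi_unit i t : exists t', (1 + iT i (pi i) * t) * t' = 1.
  exact: completion_1piD (piP i) t.
(* The denominators of x form an ideal. If it were proper it would lie in some p i, although x,
   being integral there, has a denominator outside p i. *)
have integral (x : {fraction R}) :
    (forall i, exists t, j i x = o i t) -> exists r, x = iF r.
  move=> xo; apply: contrapT => nx.
  have [|||D DP] := @idealr_of R (fun d => exists r, iF d * x = iF r).
  - by exists 0; rewrite rmorph0 mul0r.
  - by move=> [r]; rewrite rmorph1 mul1r => xr; apply: nx; exists r.
  - move=> a u v [r ur] [s vs]; exists (a * r + s).
    by rewrite !rmorphD !rmorphM mulrDl -mulrA ur vs.
  have [a [b [b0 xE]]] := fractionP x.
  have bF : iF b != 0 by rewrite tofrac_eq0.
  have bD : b \in (D : {pred R}) by apply/DP; exists a; rewrite xE mulrC divfK.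
  have [i Dp] := above D b bD b0; have [t xt] := xo i.
  have [_ _ _ _ /(_ x t xt)[c [s [sp xs]]]] := KodP i.
  have sF : iF s != 0.
    by rewrite tofrac_eq0; apply: contraNneq sp => ->; exact: idealr0.
  by case/negP: sp; apply: Dp; apply/DP; exists c; rewrite xs mulrC divfK.
have two0 : (2%:R : {fraction R}) != 0.
  rewrite -(rmorph_nat iF) tofrac_eq0; apply: contraTneq two_unit => ->.
  by rewrite unitr0.
have [N [B_ [B_genus B_P]]] := genus_mx_power_of_two s0 o_inj iF_inj o_iT pi_unit den approx
  integral two0 rho Bm.
have realize B' : genus_mx iF iT rho Bm B' ->
    exists Y (k' : {linear Defs.restrict (sys_mod Y) -> 'rV[R]_n}),
      chart (sigma := sigma) kA k' rho B'.
  move=> [[g gI] _]; have [k_bij rhoP BmP] := XP.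
  have [f' [f'S f'P]] := sesquilinear_of_mx iF_inj kA_bij (@sys_sesqui _ _ _ _ X) rhoP BmP gI.
  by exists (System (sys_fg X) (@sys_proj _ _ _ _ X) f'S), k.
have local B' Y (k' : {linear Defs.restrict (sys_mod Y) -> 'rV[R]_n}) :
    genus_mx iF iT rho Bm B' -> chart (sigma := sigma) kA k' rho B' ->
    locally_isometric X Y.
  move=> [[g gI] gT] YP q.
  have [[d [dq d0]]|q0] := pselect (exists d, d \in (q : {pred R}) /\ d != 0).
    have [i ->] := primes q d dq d0; have [h /mx_isom_inv[h' h'I]] := gT i.
    exact: mx_isom_isometric_over XP YP _ (iT i) _ h'I.
  have [|f fE] := @zero_prime_of_fraction R q.
    move=> d dq; apply/eqP; apply: contraT => d0; case: q0; by exists d.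
  have /mx_isom_inv[h hI] := mx_isom_map (e := to_completion_at q) fE gI.
  exact: mx_isom_isometric_over XP YP _ _ _ hI.
(* A chart of Y has its own action rho'. Approximating the local isomorphisms by an intertwiner over
   F yields d in GL(R) that conjugates rho' into rho, and only the form changes. *)
have normal Y : locally_isometric X Y -> exists2 B', genus_mx iF iT rho Bm B'
    & forall Z (k' : {linear Defs.restrict (sys_mod Z) -> 'rV[R]_n}),
      chart (sigma := sigma) kA k' rho B' -> isometric Y Z.
  move=> XY; have [n' [k' [rho' [BY YP]]]] := chart_exists kA Y R_PID A_order sigma_inv.
  have over q := isometric_over_chart kA_bij sigma_inv XP YP (XY q).
  have nn' : n = n'.
    have [g [h [gh hg _ _]]] := over (p s0); exact: invertible_mx_dim (o s0) _ _ _ _ gh hg.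
  subst n'.
  have over_mx q : exists g, mx_isom (to_completion_at q) rho' BY rho Bm g.
    have [g [h [gh hg grho gB]]] := over q.
    by exists g; split=> //; exists h.
  have /dependent_choice[g gI] : forall i, exists g, mx_isom (iT i) rho' BY rho Bm g.
    by move=> i; exact: over_mx.
  have [p0 p0P] := zero_prime_exists R.
  have [f fE] := zero_prime_to_fraction p0P.
  have [g0 /(mx_isom_map (e := iF) fE) g0I] := over_mx p0.
  set gF := map_mx f g0 in g0I.
  (* Precision 1 suffices because g i is already invertible over T i: y is g i times a matrix
     congruent to 1. *)
  have [|y yrho yg] := intertwiner_approximation den approx
      (rho := fun a => map_mx iF (rho a)) (rho' := fun a => map_mx iF (rho' a))
      (x := fun i => map_mx (o i) (g i)) 1.
    move=> i a; have [_ grho _] := gI i.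
    by rewrite -!(map_iT_iF o_iT) -!map_mxM grho.
  have [|d dgl yE] := @gl_near_integral _ _ iF _ s0 _ _ o j iF_inj integral _ y.
    move=> i; have [X0 X0E] := yg i; have [/glV[h [hgl gh hg]] _ _] := gI i.
    have [ggl _ _] := gI i.
    exists (g i *m (1%:M + iT i (pi i) *: (- (h *m X0)))).
      apply: glM => //; exact: (gl_near1 (pi := fun i => iT i (pi i)) pi_unit).
    have -> : map_mx (j i) y = map_mx (o i) (g i) - o i (iT i (pi i) ^+ 1) *: map_mx (o i) X0.
      by rewrite -X0E opprB addrC subrK.
    rewrite mulmxDr mulmx1 scalerN mulmxN -scalemxAr mulmxA gh mul1mx.
    by rewrite map_mxB map_mxZ expr1.
  have dI : mx_isom idfun rho' BY rho (fun il => d *m BY il *m d^T) d.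
    split=> // [a|il]; last by rewrite !map_mx_id.
    rewrite !map_mx_id//; apply: (map_mx_inj iF_inj) => /=.
    by rewrite !map_mxM -yE yrho.
  exists (fun il => d *m BY il *m d^T).
    split=> [|i].
      have [h hI] := mx_isom_inv g0I.
      exists (map_mx iF d *m h); apply: mx_isom_trans hI _.
      exact: mx_isom_map dI.
    have [h hI] := mx_isom_inv (gI i).
    exists (map_mx (iT i) d *m h); apply: mx_isom_trans hI _.
    exact: mx_isom_map dI.
  move=> Z kZ ZP; apply/(isometric_chart kA_bij YP ZP).
  exact: mx_isom_inv dI.
have /choice[Y_ Y_P] : forall a, exists Y, locally_isometric X Y /\
    exists k' : {linear Defs.restrict (sys_mod Y) -> 'rV[R]_n},
      chart (sigma := sigma) kA k' rho (B_ a).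
  move=> a; have [Y [k' YP]] := realize _ (B_genus a).
  by exists Y; split; [exact: local (B_genus a) YP|exists k'].
exists N, (fun a => exist _ (isometric (Y_ a))
  (ex_intro2 _ _ (Y_ a) (Y_P a).1 erefl)).
have Y_inj a b : isometric (Y_ a) (Y_ b) -> a = b.
  have [_ [ka kaP]] := Y_P a; have [_ [kb kbP]] := Y_P b.
  move=> /(isometric_chart kA_bij kaP kbP)[g /mx_isom_inv ab].
  have [c [_ cP]] := B_P _ (B_genus a).
  rewrite (cP b ab); apply: cP; exists 1%:M; exact: mx_isom_refl.
have Y_surj (C : gen X) : exists a, sval C = isometric (Y_ a).
  case: C => C [Y XY CE]; have [B' B'g YZ] := normal Y XY.
  have [a [[g0 /mx_isom_inv[g gI]] _]] := B_P _ B'g; have [Z [kZ ZP]] := realize _ B'g.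
  exists a; rewrite /= CE; apply/isometric_eq.
  have [_ [ka kaP]] := Y_P a; apply: isometric_forms_trans (YZ _ _ ZP) _.
  by apply/(isometric_chart kA_bij ZP kaP); exists g.
have /choice[h hP] := Y_surj.
exists h => [a|C].
  by apply/esym/Y_inj/isometric_eq; rewrite -hP.
by move: (h C) (hP C) => a; case: C => C CP /= CE; apply: eq_exist.
Qed.
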